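(* Let $Y$ be an $\mathbb{R}^d$-valued random variable with law $\mathbb{P}_Y$, approximated by $Y_n=Y+\xi_n(Y)$ with a sequence of positive numbers $\alpha_n\uparrow\infty$, on the algebra $\mathcal{D}$ of complex linear combinations of the functions $x\mapsto e^{i\langle u,x\rangle}$, $u\in\mathbb{R}^d$. Suppose that the functions $\xi_n$ satisfy: - $\alpha_n\mathbb{E}[|\xi_n|^3(Y)]\to0$; - $\alpha_n\mathbb{E}[\varphi(Y)\langle u,\xi_n(Y)\rangle^2]\to\mathbb{E}_Y[\varphi\cdot u^\ast\gamma u]$ for all $\varphi\in\mathcal{D}$ and $u\in\mathbb{R}^d$, where $\gamma=(\gamma_{ij})$ is a symmetric matrix of functions with $\gamma_{ij}\in L^\infty(\mathbb{P}_Y)$ and $\frac{\partial\gamma_{ij}}{\partial x_j}$ (in the sense of distributions) in $L^2(\mathbb{P}_Y)$; - $\alpha_n\mathbb{E}[\varphi(Y)\langle u,\xi_n(Y)\rangle]\to0$ for all $\varphi\in\mathcal{D}$ and $u\in\mathbb{R}^d$. Then: a) For every $\varphi\in\mathcal{D}$ there exists $\overline A[\varphi]\in L^2(\mathbb{P}_Y)$ such that for all $\chi\in\mathcal{D}$ $$\lim_n\alpha_n\mathbb{E}[(\varphi(Y_n)-\varphi(Y))\chi(Y)]=\mathbb{E}_Y[\overline A[\varphi]\chi],$$ and $$\overline A[\varphi]=\frac12\sum_{ij}\gamma_{ij}\frac{\partial^2\varphi}{\partial x_i\partial x_j}.$$ b) If for $i=1,\ldots,d$ the partial derivative $\partial_i\mathbb{P}_Y$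 in the sense of distributions is a bounded measure of the form $\rho_i\mathbb{P}_Y$ with $\rho_i\in L^2(\mathbb{P}_Y)$, then for every $\varphi\in\mathcal{D}$ there exist $\overline A[\varphi]$, $\underline A[\varphi]$, $\widetilde A[\varphi]$, $A^{s}[\varphi]$ in $L^2(\mathbb{P}_Y)$ such that for all $\chi\in\mathcal{D}$ $$\lim_n\alpha_n\mathbb{E}[(\varphi(Y_n)-\varphi(Y))\chi(Y)]=\mathbb{E}_Y[\overline A[\varphi]\chi],$$ $$\lim_n\alpha_n\mathbb{E}[(\varphi(Y)-\varphi(Y_n))\chi(Y_n)]=\mathbb{E}_Y[\underline A[\varphi]\chi],$$ $$\lim_n\alpha_n\mathbb{E}[(\varphi(Y_n)-\varphi(Y))(\chi(Y_n)-\chi(Y))]=-2\,\mathbb{E}_Y[\widetilde A[\varphi]\chi],$$ $$\lim_n\alpha_n\mathbb{E}[(\varphi(Y_n)-\varphi(Y))(\chi(Y_n)+\chi(Y))]=2\,\mathbb{E}_Y[A^{s}[\varphi]\chi],$$ and for all $\varphi\in\mathcal{D}$ $$\widetilde A[\varphi]=\frac12\sum_{ij}\gamma_{ij}\frac{\partial^2\varphi}{\partial x_i\partial x_j}+\frac12\sum_i\Big(\sum_j\Big(\frac{\partial\gamma_{ij}}{\partial x_j}+\gamma_{ij}\rho_j\Big)\Big)\frac{\partial\varphi}{\partial x_i},$$ and the square field operator is $$\Gamma[\varphi]=\sum_{ij}\gamma_{ij}\frac{\partial\varphi}{\partial x_i}\frac{\partial\varphi}{\partial x_j}.$$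
   Context: $\mathbb{E}_Y$ is the expectation under $\mathbb{P}_Y$. Bias operators. The algebra $\mathcal{D}$ consists of bounded functions, contains the constants and is dense in $L^2(\mathbb{P}_Y)$. The operators $\overline A$, $\underline A$, $\widetilde A$, $A^{s}$ from $\mathcal{D}$ into $L^2(\mathbb{P}_Y)$ are, when they exist, those determined by the limit relations written in the claim. When $\widetilde A$ exists, i.e. when for every $\varphi\in\mathcal{D}$ there is $\widetilde A[\varphi]\in L^2(\mathbb{P}_Y)$ such that $\lim_n\alpha_n\mathbb{E}[(\varphi(Y_n)-\varphi(Y))(\chi(Y_n)-\chi(Y))]=-2\,\mathbb{E}_Y[\widetilde A[\varphi]\chi]$ for all $\chi\in\mathcal{D}$, the form $\mathcal{E}[\varphi,\chi]=-\mathbb{E}_Y[\widetilde A[\varphi]\chi]$ is closable, its smallest closed extension is a Dirichlet form, and $\Gamma$ denotes its square field operator, given on $\mathcal{D}$ by $\Gamma[\varphi]=\widetilde A[\varphi^2]-2\varphi\widetilde A[\varphi]$ (extended bilinearly to complex functions). *)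

(* Defs.v *)
From HB Require Import structures.
From mathcomp Require Export all_boot all_order all_algebra.
From mathcomp Require Export complex.
From mathcomp Require Export all_classical all_reals all_analysis.

Set Implicit Arguments.
Unset Strict Implicit.
Unset Printing Implicit Defensive.

Import Order.TTheory GRing.Theory Num.Theory.
Export numFieldNormedType.Exports.

Local Open Scope classical_set_scope.
Local Open Scope ring_scope.
Local Open Scope complex_scope.

(* Row vectors carry the product sigma-algebra, as n.-tuple does in the
   library; over the reals it is the Borel sigma-algebra of R^n. *)
Section measurable_rV.
Context {d} {T : sigmaRingType d}.
Variable n : nat.

Let coors : 'I_n -> 'rV[T]_n -> T := fun i x => x ord0 i.

Let rV_set0 : g_sigma_preimage coors set0.
Proof. exact: sigma_algebra0. Qed.

Let rV_setC A : g_sigma_preimage coors A -> g_sigma_preimage coors (~` A).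
Proof. exact: sigma_algebraC. Qed.

Let rV_bigcup (F : _^nat) : (forall i, g_sigma_preimage coors (F i)) ->
  g_sigma_preimage coors (\bigcup_i (F i)).
Proof. exact: sigma_algebra_bigcup. Qed.

HB.instance Definition _ := @isMeasurable.Build (measure_tuple_display d)
  'rV[T]_n (g_sigma_preimage coors) rV_set0 rV_setC rV_bigcup.

End measurable_rV.

Lemma measurable_rV_coord d (T : sigmaRingType d) n (i : 'I_n) :
  measurable_fun [set: 'rV[T]_n] (fun x => x ord0 i).
Proof.
move=> _ Y mY; rewrite setTI; apply: sub_sigma_algebra => /=.
rewrite -bigcup_seq/=; exists i => /=; first by rewrite mem_index_enum.
by exists Y => //; rewrite setTI.
Qed.

Lemma measurable_fun_rVP d1 d2 (T1 : measurableType d1)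
    (T2 : measurableType d2) n (f : T1 -> 'rV[T2]_n) :
  measurable_fun [set: T1] f <->
  forall i, measurable_fun [set: T1] (fun x => f x ord0 i).
Proof.
split=> [mf i|mf].
  exact: (measurableT_comp (@measurable_rV_coord _ T2 n i) mf).
suff : g_sigma_preimage (fun i (x : 'rV[T2]_n) => x ord0 i) `<=`
    [set A | measurable (f @^-1` A)].
  by move=> H _ A mA; rewrite setTI; exact: H.
apply: smallest_sub.
- split; first by rewrite /= preimage_set0.
  + by move=> A /= mA; rewrite setTD preimage_setC; exact: measurableC.
  + by move=> F /= mF; rewrite preimage_bigcup; exact: bigcup_measurable.
- rewrite -bigcup_seq/= => A [i _ [B mB <-]] /=.
  by have := mf i measurableT _ mB; rewrite !setTI.
Qed.

Section lebesgue_measure_rV.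
Context {R : realType}.

Definition rV_cons n (p : measurableTypeR R * 'rV[R]_n) : 'rV[R]_n.+1 :=
  \row_i oapp (p.2 ord0) p.1 (unlift ord0 i).

Lemma measurable_rV_cons n : measurable_fun setT (@rV_cons n).
Proof.
apply/measurable_fun_rVP => i.
have [j ->|->] := unliftP ord0 i.
- rewrite (_ : (fun x => _) = (fun x : 'rV[R]_n => x ord0 j) \o snd).
    apply: measurableT_comp => //; exact: measurable_rV_coord.
  by apply/funext => p /=; rewrite mxE liftK.
- rewrite (_ : (fun x => _) = fst).
    exact: measurable_fst.
  by apply/funext => p /=; rewrite mxE unlift_none.
Qed.

Section step.
Variables (n : nat) (mu : {measure set 'rV[R]_n -> \bar R}).

Definition lebesgue_cons : set 'rV[R]_n.+1 -> \bar R :=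
  pushforward ((@lebesgue_measure R) \x^ mu)%E (@rV_cons n).

Let mpre A : measurable A -> measurable (@rV_cons n @^-1` A).
Proof.
by move=> mA; rewrite -[X in measurable X]setTI; exact: measurable_rV_cons.
Qed.

Let cons0 : lebesgue_cons set0 = 0%E.
Proof. by rewrite /lebesgue_cons /pushforward preimage_set0 measure0. Qed.

Let cons_ge0 A : (0 <= lebesgue_cons A)%E.
Proof. by rewrite /lebesgue_cons /pushforward; apply: measure_ge0. Qed.

Let cons_sigma_additive : semi_sigma_additive lebesgue_cons.
Proof.
move=> F mF tF mUF; rewrite /lebesgue_cons /pushforward preimage_bigcup.
apply: measure_semi_sigma_additive.
- by move=> k; exact: mpre.
- apply/trivIsetP => /= i j _ _ ij; rewrite -preimage_setI.
  by move/trivIsetP : tF => /(_ _ _ _ _ ij) ->//; rewrite preimage_set0.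
- by rewrite -preimage_bigcup; exact: mpre.
Qed.

HB.instance Definition _ := isMeasure.Build _ _ _ lebesgue_cons
  cons0 cons_ge0 cons_sigma_additive.

End step.

(* Lebesgue measure on R^n, as an iterated product; see
   [lebesgue_measure_rV_box]. *)
Fixpoint lebesgue_measure_rV n : {measure set 'rV[R]_n -> \bar R} :=
  match n with
  | 0 => \d_(0 : 'rV[R]_0)
  | m.+1 => lebesgue_cons (lebesgue_measure_rV m)
  end.

Lemma lebesgue_measure_rV_box n (A : 'I_n -> set R) :
  (forall i, measurable (A i)) ->
  (lebesgue_measure_rV n [set x : 'rV[R]_n | forall i, A i (x ord0 i)] =
   \prod_(i < n) lebesgue_measure (A i))%E.
Proof.
elim: n A => [|n IH] A mA.
  rewrite big_ord0 /= diracE mem_set //=; last by case.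
rewrite big_ord_recl /=.
rewrite -(IH (fun i => A (lift ord0 i))) //.
rewrite /lebesgue_cons /pushforward.
set B := [set x : 'rV[R]_n | _].
rewrite (_ : _ @^-1` _ = A ord0 `*` B).
  rewrite product_measure2E //; first exact: mA.
  rewrite (_ : B = \bigcap_(i in [set: 'I_n])
      ((fun x : 'rV[R]_n => x ord0 i) @^-1` A (lift ord0 i))).
    apply: fin_bigcap_measurable => [|i _]; first exact: finite_finset.
    rewrite -[X in measurable X]setTI.
    by apply: (@measurable_rV_coord _ R).
  by apply/seteqP; split => x /= h i; [move=> _; exact: h|exact: h i I].
apply/seteqP; split => [[a v] /= h|[a v] /= [h1 h2] i].
- split; first by have := h ord0; rewrite mxE unlift_none.
  by move=> i; have := h (lift ord0 i); rewrite mxE liftK.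
- by rewrite mxE; have [j ->|->] := unliftP ord0 i; [exact: h2|exact: h1].
Qed.

End lebesgue_measure_rV.

Section calculus_rV.
Context {R : realType} {d : nat}.
Implicit Types (u x : 'rV[R]_d) (f g : 'rV[R]_d -> R) (phi : 'rV[R]_d -> R[i]).

Definition dotv u x : R := \sum_i u ord0 i * x ord0 i.

(* The library norm on row vectors is the sup norm. *)
Definition euclidean_norm x : R := Num.sqrt (dotv x x).

Definition partial (i : 'I_d) f : 'rV[R]_d -> R :=
  fun x => 'D_(delta_mx ord0 i) f x.

Definition cpartial (i : 'I_d) phi : 'rV[R]_d -> R[i] :=
  fun x => partial i (fun y => complex.Re (phi y)) x
           +i* partial i (fun y => complex.Im (phi y)) x.

Fixpoint class_C (k : nat) f : Prop :=
  match k with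
  | 0 => continuous f
  | m.+1 => continuous f /\
      forall i, (forall x, derivable f x (delta_mx ord0 i)) /\
                class_C m (partial i f)
  end.

Definition test_function f : Prop :=
  (forall k, class_C k f) /\ compact (closure [set x | f x != 0]).

Definition locally_integrable_rV f : Prop :=
  measurable_fun setT f /\
  forall K : set 'rV[R]_d, compact K ->
    (\int[lebesgue_measure_rV d]_(x in K) `|f x|%:E < +oo)%E.

Definition distribution_partial (i : 'I_d) f g : Prop :=
  [/\ locally_integrable_rV f, locally_integrable_rV g &
      forall h, test_function h ->
        \int[lebesgue_measure_rV d]_x (f x * partial i h x) =
        - \int[lebesgue_measure_rV d]_x (g x * h x)].

(* The distributional derivative of the measure [mu] in the i-th direction
   is the measure with density [rho] with respect to [mu]. *)
Definition measure_partial (mu : {measure set 'rV[R]_d -> \bar R})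
    (i : 'I_d) (rho : 'rV[R]_d -> R) : Prop :=
  mu.-integrable setT (EFin \o rho) /\
  forall h, test_function h ->
    \int[mu]_x partial i h x = - \int[mu]_x (h x * rho x).

Definition expi (t : R) : R[i] := cos t +i* sin t.

Definition trig_poly phi : Prop :=
  exists (m : nat) (c : 'I_m -> R[i]) (u : 'I_m -> 'rV[R]_d),
    phi = fun x => \sum_k c k * expi (dotv (u k) x).

End calculus_rV.

Section complex_integral.
Context {R : realType} d {T : measurableType d}.

Definition Cintegral (mu : {measure set T -> \bar R}) (f : T -> R[i]) : R[i] :=
  (\int[mu]_x complex.Re (f x)) +i* (\int[mu]_x complex.Im (f x)).

Definition CL2 (mu : {measure set T -> \bar R}) (f : T -> R[i]) : Prop :=
  (fun x => complex.Re (f x)) \in Lfun mu 2%:E /\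
  (fun x => complex.Im (f x)) \in Lfun mu 2%:E.

End complex_integral.

(* The topology on R[i]^o is the one induced by the modulus. *)
Definition Ccvg {R : realType} (z : nat -> R[i]) (l : R[i]) : Prop :=
  (z : nat -> R[i]^o) @ \oo --> (l : R[i]^o).

(* The operators are determined by their limit relations only up to equality
   almost everywhere, and only on trigonometric polynomials; they are
   represented as maps on functions whose values elsewhere are irrelevant. *)
Section bias_operators.
Context {R : realType} {dO : measure_display} {Omega : measurableType dO}.
Context {P : probability Omega R} {d : nat}.
Variables (Y : {RV P >-> 'rV[R]_d}) (Yn : nat -> Omega -> 'rV[R]_d).
Variable alpha : nat -> R.
Implicit Types A : ('rV[R]_d -> R[i]) -> ('rV[R]_d -> R[i]).

(* [K phi chi n w] is the random variable inside the expectation on the left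
   and [c] the constant in front of the expectation on the right. *)
Definition bias_operator
    (K : ('rV[R]_d -> R[i]) -> ('rV[R]_d -> R[i]) -> nat -> Omega -> R[i])
    (c : R[i]) A : Prop :=
  forall phi, trig_poly phi -> CL2 (distribution P Y) (A phi) /\
    forall chi, trig_poly chi ->
      Ccvg (fun n => (alpha n)%:C * Cintegral P (K phi chi n))
           (c * Cintegral (distribution P Y) (fun x => A phi x * chi x)).

Definition theoretical_bias_operator A : Prop :=
  bias_operator (fun phi chi n w =>
    (phi (Yn n w) - phi (Y w)) * chi (Y w)) 1 A.

Definition practical_bias_operator A : Prop :=
  bias_operator (fun phi chi n w =>
    (phi (Y w) - phi (Yn n w)) * chi (Yn n w)) 1 A.

Definition symmetric_bias_operator A : Prop :=
  bias_operator (fun phi chi n w =>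
    (phi (Yn n w) - phi (Y w)) * (chi (Yn n w) - chi (Y w))) (- 2%:R) A.

Definition singular_bias_operator A : Prop :=
  bias_operator (fun phi chi n w =>
    (phi (Yn n w) - phi (Y w)) * (chi (Yn n w) + chi (Y w))) 2%:R A.

End bias_operators.

(* The square field operator, on trigonometric polynomials, of the Dirichlet
   form (phi, chi) |-> - E_Y[A[phi] chi]; it is bilinear (not sesquilinear) on
   complex functions, so the square is not a squared modulus. *)
Definition square_field {R : realType} {d : nat}
    (A : ('rV[R]_d -> R[i]) -> ('rV[R]_d -> R[i])) (phi : 'rV[R]_d -> R[i]) :
    'rV[R]_d -> R[i] :=
  fun x => A (fun y => phi y ^+ 2) x - 2%:R * phi x * A phi x.

(* Main.v *)
(* A Taylor expansion of [expi] along [Y_n = Y + xi_n(Y)] turns the three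
   hypotheses on [xi_n] into the limit relation for the theoretical operator:
   with [phi] and [chi] exponentials, [phi * chi] is again an exponential, the
   linear term vanishes, the quadratic one gives
   [1/2 sum gamma_ij d_i d_j phi], and the remainder is controlled by
   [alpha_n E|xi_n|^3].  The symmetric form is
   [K(phi chi, 1) - K(phi, chi) - K(chi, phi)] in terms of the theoretical form
   [K], so it converges to [E_Y[sum gamma_ij d_i phi d_j chi]]; the practical
   and singular forms are combinations of these two.

   It remains to integrate [gamma_ij d_i phi] by parts under [P_Y], although
   [gamma] is only weakly differentiable and [P_Y] only has distributional
   derivatives [rho_i P_Y].  Let [m] be a measure and let [v'] be the weak
   derivative of [v] in direction [j].  Testing against products of one
   variable functions shows that [v m] coincides, on all Borel sets, with the
   measure [A |-> - int int_{s <= x_j} 1_A(x with x_j := s) v'(x) ds dm(x)].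
   - With [m = P_Y] and [v = 1] this shows that [P_Y] does not charge a set
     [P_Y]-almost all of whose lines in direction [j] are Lebesgue null; one
     direction after the other, [P_Y] is absolutely continuous.
   - With [m] the Lebesgue measure this shows that [v] is, on almost every
     line, a primitive of [v'].  Applied to the density of [P_Y] and to
     [gamma_ij] times a cutoff, it reduces integration by parts to Fubini's
     theorem on lines, where no continuity or local boundedness is needed. *)

(* The difficulty is that [gamma] and the law of [Y] are regular in unrelated senses. The bounds on
   [gamma i j], [dgamma i j] and [rho j] hold under [PY], whereas the weak derivative of [gamma i j]
   is tested against Lebesgue measure, for which it is only locally integrable. The density [f] of
   [PY] need be neither bounded nor continuous, so mollifying one factor offers no evident
   convergence. Absolute continuity links the two sides: what is integrable under [PY] is Lebesgue
   integrable once multiplied by [f], and on almost every line both factors are primitives of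
   integrable functions.

   Signed measures never appear: negative parts are moved to the other side, and two positive
   measures, finite on boxes, are compared on boxes.

   The operators of b) are forced by linear relations. Let [L] be the second order part and [b] the
   drift. Integration by parts gives [L + b] for the symmetric operator; this must be half the sum
   of the theoretical and the practical operator, and the singular one is half their difference.
   Hence [L + 2 b] and [- b]. *)
From HB Require Import structures.
Require Import Defs.
From mathcomp Require Import ring lra measurable_realfun ess_sup_inf.
Set Implicit Arguments.
Unset Strict Implicit.
Unset Printing Implicit Defensive.
Import Order.TTheory GRing.Theory Num.Theory.
Local Open Scope classical_set_scope.
Local Open Scope ring_scope.
Local Open Scope complex_scope.

(** * Smooth functions of one variable *)

Section smooth1.
Context {R : realType}.
Implicit Types f g : R -> R.

(** In one variable a derivative at every point gives continuity, so continuity is requested at the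
    last level only. In [class_C] it is requested at every level, because partial derivatives alone
    do not give it. *)
Fixpoint smooth1 (k : nat) f : Prop :=
  match k with
  | 0 => continuous f
  | m.+1 => (forall x, derivable f x 1) /\ smooth1 m (derive1 f)
  end.

Lemma smooth1_continuous k f : smooth1 k f -> continuous f.
Proof.
case: k => [//|k] [df _] x.
by apply: differentiable_continuous; apply/derivable1_diffP.
Qed.

Lemma smooth1W k f : smooth1 k.+1 f -> smooth1 k f.
Proof.
elim: k f => [|k IH] f; first exact: smooth1_continuous.
by move=> [df sf]; split=> //; exact: IH.
Qed.

Lemma smooth1S k f g : (forall x : R, is_derive x (1 : R) f (g x)) -> smooth1 k g ->
  smooth1 k.+1 f.
Proof.
move=> fg sg; split; first by move=> x; exact: ex_derive.
suff -> : derive1 f = g by [].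
by apply/funext => x; rewrite derive1E; exact: derive_val.
Qed.

Lemma smooth1_is_derive k f (x : R) : smooth1 k.+1 f -> is_derive x (1 : R) f (derive1 f x).
Proof. by case=> df _; rewrite derive1E; exact: derivableP. Qed.

Lemma smooth1_cst k (c : R) : smooth1 k (fun=> c).
Proof.
elim: k c => [|k IH] c; first by move=> x; exact: cst_continuous.
by apply: (@smooth1S _ _ (fun=> 0)); exact: IH.
Qed.

Lemma smooth1D k f g : smooth1 k f -> smooth1 k g ->
  smooth1 k (fun x => f x + g x).
Proof.
elim: k f g => [|k IH] f g sf sg.
  by move=> x; apply: cvgD; [exact: sf|exact: sg].
apply: (@smooth1S _ _ (fun x => derive1 f x + derive1 g x)); last first.
  by apply: IH; [case: sf|case: sg].
by move=> x; exact: (is_deriveD (smooth1_is_derive x sf) (smooth1_is_derive x sg)).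
Qed.

Lemma smooth1M k f g : smooth1 k f -> smooth1 k g ->
  smooth1 k (fun x => f x * g x).
Proof.
elim: k f g => [|k IH] f g sf sg.
  by move=> x; apply: cvgM; [exact: sf|exact: sg].
apply: (@smooth1S _ _ (fun x => f x * derive1 g x + g x * derive1 f x)); last first.
  by apply: smooth1D; apply: IH; [exact: smooth1W|case: sg|
    exact: smooth1W|case: sf].
by move=> x; exact: (is_deriveM (smooth1_is_derive x sf) (smooth1_is_derive x sg)).
Qed.

Lemma smooth1_affine k f (a b : R) : smooth1 k f ->
  smooth1 k (fun x => f (a * x + b)).
Proof.
elim: k f => [|k IH] f sf.
  move=> x; apply: (@continuous_comp _ _ _ (fun x => a * x + b) f).
    apply: cvgD; last exact: cvg_cst.
    by apply: cvgM; [exact: cvg_cst|exact: cvg_id].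
  exact: sf.
apply: (@smooth1S k (fun x => f (a * x + b)) (fun x => derive1 f (a * x + b) * a)); last first.
  by apply: smooth1M; [apply: IH; case: sf|exact: smooth1_cst].
move=> x; apply: (@is_derive1_comp R f (fun x => a * x + b)).
  exact: smooth1_is_derive sf.
rewrite -[X in is_derive _ _ _ X]addr0; apply: is_deriveD.
rewrite -[X in is_derive _ _ _ X]mulr1; exact: is_deriveZ.
Qed.

(** The flat function [exp (- 1 / x)] is the case [p = 1]. Allowing a polynomial in [1 / x] in front
    makes the family stable under differentiation, so that smoothness becomes a plain induction. *)
Definition polyexp (p : {poly R}) (x : R) : R :=
  if 0 < x then p.[x^-1] * expR (- x^-1) else 0.

(** This is [z <= 1 + z <= exp z] at [z = y / n.+1], raised to the power [n.+1]. *)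
Lemma powr_le_expR n (y : R) : 0 <= y ->
  y ^+ n.+1 <= n.+1%:R ^+ n.+1 * expR y.
Proof.
move=> y0.
have n0 : 0 < n.+1%:R :> R by rewrite ltr0n.
have -> : y = n.+1%:R * (y / n.+1%:R).
  by rewrite mulrC -mulrA mulVf ?mulr1 ?gt_eqF.
rewrite expRM_natl exprMn ler_pM2l ?exprn_gt0//.
apply: lerXn2r; rewrite ?nnegrE ?expR_ge0 ?divr_ge0 ?ler0n//.
by apply: le_trans (expR_ge1Dx _); rewrite lerDr.
Qed.

(** The monomial of degree [i] is estimated with the power [i.+1] of [1 / x] in [powr_le_expR]; the
    additional power is what leaves a factor [x]. *)
Lemma polyexp_le p : exists2 C : R, 0 <= C & forall x, `|polyexp p x| <= C * `|x|.
Proof.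
have C0 i : 0 <= `|p`_i| * i.+1%:R ^+ i.+1 by rewrite mulr_ge0// exprn_ge0.
exists (\sum_(i < size p) `|p`_i| * i.+1%:R ^+ i.+1); first exact: sumr_ge0.
move=> x; rewrite /polyexp; case: ltP => x0; last first.
  by rewrite normr0 mulr_ge0// sumr_ge0.
rewrite (gtr0_norm x0) horner_coef !mulr_suml.
apply: le_trans (ler_norm_sum _ _ _) _; apply: ler_sum => i _.
rewrite !normrM -!mulrA ler_wpM2l//.
rewrite (gtr0_norm (expR_gt0 _)) normrX gtr0_norm ?invr_gt0//.
rewrite expRN ler_pdivrMr ?expR_gt0// mulrAC -ler_pdivrMr// -exprSr.
by apply: powr_le_expR; rewrite invr_ge0 ltW.
Qed.

(** The factor ['X^2] stands for [x ^- 2], the derivative of [- x^-1]; it comes with [p] when the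
    exponential is differentiated, and with [- deriv p] when the polynomial is. *)
Lemma polyexp_derive (p : {poly R}) (x : R) :
  is_derive x (1 : R) (polyexp p) (polyexp ('X^2 * (p - deriv p)) x).
Proof.
have [x0|x0|->] := ltgtP x 0.
- rewrite {2}/polyexp ltNge (ltW x0)/=.
  apply: (@near_eq_is_derive _ _ _ (fun=> 0)) => //.
  + near=> y; rewrite /polyexp ltNge ifF//; apply/negbF/ltW.
    by near: y; exact: lt_nbhsl.
- pose u := (fun y : R => p.[y^-1] * expR (- y^-1)).
  have du : is_derive x (1 : R) u (polyexp ('X^2 * (p - deriv p)) x).
    rewrite /polyexp x0 /u.
    have dinv : is_derive x (1 : R) (fun y : R => y^-1) (- x ^- 2).
      have := @is_deriveV R (@id R) x 1 1 (lt0r_neq0 x0) (is_derive_id _ _).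
      by rewrite /GRing.scale /= mulr1.
    have dp : is_derive x (1 : R) (fun y : R => p.[y^-1]) ((deriv p).[x^-1] * (- x ^- 2)).
      exact: (@is_derive1_comp R (horner p) (fun y => y^-1)).
    have de : is_derive x (1 : R) (fun y : R => expR (- y^-1)) (expR (- x^-1) * (x ^- 2)).
      apply: (@is_derive1_comp R expR (fun y => - y^-1)).
      by rewrite -[X in is_derive _ _ _ X]opprK; exact: (is_deriveN dinv).
    apply: (is_derive_eq (is_deriveM dp de)).
    rewrite !hornerE /= exprVn. rewrite /GRing.scale /=. ring.
  apply: (@near_eq_is_derive _ _ _ u) => //.
  + near=> y; rewrite /polyexp ifT//.
    by near: y; exact: lt_nbhsr.
(* At the origin the difference quotient of [polyexp p] is [polyexp (p * 'X)], and the linear bound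
   sends it to 0. *)
- have [C C0 hC] := polyexp_le (p * 'X).
  have p0 q : polyexp q 0 = 0 by rewrite /polyexp ltxx.
  suff h : h^-1 *: (polyexp p (h *: 1 + 0) - polyexp p 0) @[h --> 0^'] --> (0 : R).
    rewrite p0; apply: DeriveDef; first by apply/cvg_ex; exists 0.
    exact: cvg_lim.
  apply/cvgr0Pnorm_le => e e0.
  have [C' C'0 CC'] : exists2 C', 0 < C' & C <= C'.
    by exists (C + 1); rewrite ?lerDl// ltr_wpDl.
  near=> h.
  rewrite addr0 p0 subr0.
  have -> : h^-1 *: polyexp p (h *: 1) = polyexp (p * 'X) h.
    have -> : h *: (1 : R) = h by rewrite -[LHS]/(h * 1) mulr1.
    rewrite /polyexp; case: ifP => h0; last by rewrite scaler0.
    rewrite !hornerE /GRing.scale /=; ring.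
  apply: (le_trans (hC _)); apply: (le_trans (ler_wpM2r _ CC')) => //.
  rewrite mulrC -ler_pdivlMr//; near: h; apply: dnbhs0_le.
  by rewrite divr_gt0.
Unshelve. all: by end_near. Qed.

Lemma smooth1_polyexp k p : smooth1 k (polyexp p).
Proof.
elim: k p => [|k IH] p.
  move=> x; apply: differentiable_continuous; apply/derivable1_diffP.
  by have := polyexp_derive p x => ?; exact: ex_derive.
by apply: (@smooth1S _ _ (polyexp ('X^2 * (p - deriv p)))); [exact: polyexp_derive|exact: IH].
Qed.

(** Smooth minorants of the indicator of []p, q[]. As [n] grows, each factor
    [exp (- 1 / (n.+1 * t))] tends to 1 for [t > 0] and stays 0 otherwise, so the convergence to the
    indicator holds at every point, the end points included. *)
Definition bump (p q : R) (n : nat) (s : R) : R :=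
  polyexp 1 (n.+1%:R * (s - p)) * polyexp 1 (n.+1%:R * (q - s)).

Lemma smooth1_bump k p q n : smooth1 k (bump p q n).
Proof.
apply: smooth1M.
  rewrite (_ : (fun x => _) = fun x => polyexp 1 (n.+1%:R * x + (- (n.+1%:R * p)))).
    by apply: smooth1_affine; exact: smooth1_polyexp.
  by apply/funext => x; rewrite mulrBr.
rewrite (_ : (fun x => _) = fun x => polyexp 1 (- n.+1%:R * x + n.+1%:R * q)).
  by apply: smooth1_affine; exact: smooth1_polyexp.
by apply/funext => x; rewrite mulrBr mulNr addrC.
Qed.

Lemma polyexp1_ge0 x : 0 <= polyexp 1 x.
Proof. by rewrite /polyexp; case: ifP => // _; rewrite hornerE mul1r expR_ge0. Qed.

Lemma polyexp1_le1 x : polyexp 1 x <= 1.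
Proof.
rewrite /polyexp; case: ifP => // x0; rewrite hornerE mul1r.
by rewrite expR_le1 oppr_le0 invr_ge0 ltW.
Qed.

Lemma bump_ge0 p q n s : 0 <= bump p q n s.
Proof. by rewrite mulr_ge0// polyexp1_ge0. Qed.

Lemma bump_le1 p q n s : bump p q n s <= 1.
Proof. by rewrite mulr_ile1// ?polyexp1_ge0// polyexp1_le1. Qed.

Lemma bump_out p q n s : ~~ (p < s < q) -> bump p q n s = 0.
Proof.
rewrite negb_and -!leNgt /bump /polyexp => /orP[ps|qs].
  by rewrite ltNge mulr_ge0_le0// ?subr_le0// mul0r.
by rewrite (ltNge _ (_ * (q - s))) mulr_ge0_le0// ?subr_le0// mulr0.
Qed.

Lemma polyexp1_cvg1 (x : R) : 0 < x -> polyexp 1 (n.+1%:R * x) @[n --> \oo] --> (1 : R).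
Proof.
move=> x0.
rewrite (_ : (fun n => _) = fun n : nat => expR (- (n.+1%:R^-1 * x^-1))); last first.
  by apply/funext => n; rewrite /polyexp mulr_gt0// hornerE mul1r invfM mulrC.
have e0 : expR (- (0 * x^-1)) = 1 :> R by rewrite mul0r oppr0 expR0.
rewrite -[X in _ --> X]e0.
apply: continuous_cvg; first exact: continuous_expR.
by apply: cvgN; apply: cvgM; [exact: cvg_harmonic|exact: cvg_cst].
Qed.

Lemma indic_itvE (p q s : R) : \1_(`]p, q[ : set R) s = (p < s < q)%R%:R :> R.
Proof.
rewrite indicE; case: (boolP (p < s < q)) => h.
  by rewrite mem_set//= in_itv.
by rewrite memNset//= in_itv; exact/negP.
Qed.

Lemma bump_cvg p q s :
  bump p q n s @[n --> \oo] --> (\1_(`]p, q[ : set R) s : R).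
Proof.
rewrite indic_itvE; case: (boolP (p < s < q)) => h.
  move: h => /andP[h1 h2]; rewrite -[X in _ --> X](mulr1 1).
  by apply: cvgM; apply: polyexp1_cvg1; rewrite subr_gt0.
by under eq_fun do rewrite bump_out//; exact: cvg_cst.
Qed.

Local Notation leb := (@lebesgue_measure R).

Lemma integrable_bounded_support f (p q M : R) : measurable_fun setT f ->
  (forall s, `|f s| <= M) -> (forall s, ~~ (p < s < q) -> f s = 0) ->
  leb.-integrable setT (EFin \o f).
Proof.
move=> mf fM f0.
have M0 : 0 <= M by exact: le_trans (fM 0).
apply: (@le_integrable _ _ R leb setT measurableT _ (EFin \o (fun s => M * \1_(`]p, q[ : set R) s))) => //.
- exact/measurable_EFinP.
- move=> s _; rewrite /= lee_fin indic_itvE; case: (boolP (p < s < q)) => h.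
    by rewrite mulr1 (ger0_norm M0).
  by rewrite mulr0 f0 ?normr0//; exact/negP.
rewrite (_ : _ \o _ = (fun s => M%:E * (\1_(`]p, q[ : set R) s)%:E)%E); last first.
  by apply/funext => s /=; rewrite EFinM.
exact: (integrableZl measurableT M (integrable_indic_itv p q _ _)).
Qed.

(** For [f] carried by []p, q[] this is 0 up to [p] and constant from [q] on. The constant is in
    general not 0, so a ramp is not compactly supported and cannot be tested against directly. *)
Definition ramp (f : R -> R) (y : R) : R := \int[leb]_(t in `]-oo, y]) f t.

Lemma ramp_is_derive f (p q M : R) : continuous f -> (forall s, `|f s| <= M) ->
  (forall s, ~~ (p < s < q) -> f s = 0) ->
  forall y : R, is_derive y (1 : R) (ramp f) (f y).
Proof.
move=> cf fM f0 y.
have itf : leb.-integrable setT (EFin \o f).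
  apply: integrable_bounded_support fM f0.
  exact: continuous_measurable_fun.
have [] := @continuous_FTC1 R f -oo%O y (y + 1) _ _ _ (cf y).
- by rewrite ltrDl.
- exact: integrableS itf.
- by rewrite ltNyr.
by rewrite -/(ramp f) derive1E => h <-; exact: derivableP.
Qed.

Lemma smooth1_ramp f (p q M : R) : (forall k, smooth1 k f) ->
  (forall s, `|f s| <= M) ->
  (forall s, ~~ (p < s < q) -> f s = 0) ->
  forall k, smooth1 k (ramp f).
Proof.
move=> sf fM f0 k; apply: smooth1W; apply: (@smooth1S _ _ f) => //.
exact: ramp_is_derive (sf 0%N) fM f0.
Qed.

Lemma Rintegral_cvg d (T : measurableType d) (mu : {measure set T -> \bar R})
    (D : set T) (f_ : nat -> T -> R) (f g : T -> R) :
  measurable D ->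
  (forall n, measurable_fun D (f_ n)) ->
  (forall x, D x -> f_ n x @[n --> \oo] --> f x) ->
  mu.-integrable D (EFin \o g) ->
  (forall n x, D x -> `|f_ n x| <= g x) ->
  \int[mu]_(x in D) f_ n x @[n --> \oo] --> \int[mu]_(x in D) f x.
Proof.
move=> mD mf_ f_f intg f_g.
have mf : measurable_fun D f by apply: measurable_fun_cvg f_f.
have [] := @dominated_convergence _ _ _ mu _ mD
  (fun n => EFin \o f_ n) (EFin \o f) (EFin \o g).
- by move=> n; exact/measurable_EFinP.
- exact/measurable_EFinP.
- apply: aeW => x Dx; apply: cvg_EFin; last exact: f_f.
  by apply: nearW.
- by [].
- by apply: aeW => x n Dx; rewrite lee_fin f_g.
move=> if_ _ h; rewrite /Rintegral; apply: fine_cvg.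
by rewrite fineK//; exact: integrable_fin_num.
Qed.

Lemma bump_le_indic p q n s : bump p q n s <= \1_(`]p, q[ : set R) s.
Proof.
rewrite indic_itvE; case: (boolP (p < s < q)) => h; first exact: bump_le1.
by rewrite bump_out.
Qed.

Section ramp.
Variables (f : R -> R) (p q : R).
Hypothesis mf : measurable_fun setT f.
Hypothesis f_ge0 : forall s, 0 <= f s.
Hypothesis f_le : forall s, f s <= \1_(`]p, q[ : set R) s.

Let integrable_f : leb.-integrable setT (EFin \o f).
Proof.
apply: (@le_integrable _ _ R leb setT measurableT _ _ _ _ (integrable_indic_itv p q false true)).
  exact/measurable_EFinP.
by move=> s _ /=; rewrite lee_fin !ger0_norm ?f_le ?(le_trans (f_ge0 s)).
Qed.

Let f_out s : ~~ (p < s < q) -> f s = 0.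
Proof.
move=> h; apply/eqP; rewrite eq_le f_ge0 andbT.
by apply: le_trans (f_le s) _; rewrite indic_itvE (negbTE h).
Qed.

Lemma ramp_ge0 y : 0 <= ramp f y.
Proof. by apply: Rintegral_ge0 => s _. Qed.

Lemma ramp_le y : ramp f y <= \int[leb]_t \1_(`]p, q[ : set R) t.
Proof.
rewrite /ramp Rintegral_mkcond; apply: le_Rintegral => //.
- by rewrite -restrict_EFin; apply/integrable_restrict => //; rewrite setTI; exact: integrableS integrable_f.
- exact: integrable_indic_itv.
- by move=> s _; rewrite patchE; case: ifP => // _.
Qed.

Lemma ramp_left y : y <= p -> ramp f y = 0.
Proof.
move=> yp; rewrite /ramp (@eq_Rintegral _ _ _ leb _ (fun=> 0)).
  by rewrite Rintegral_cst//= mul0r.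
move=> s; rewrite inE/= in_itv/= => sy; apply: f_out.
by rewrite negb_and -leNgt (le_trans sy).
Qed.

Lemma ramp_right y : q <= y -> ramp f y = \int[leb]_t f t.
Proof.
move=> qy; rewrite /ramp Rintegral_mkcond; congr Rintegral; apply/funext => s.
rewrite patchE; case: ifPn => //; rewrite notin_setE/= in_itv/= => /negP.
rewrite -ltNge => ys; rewrite f_out// negb_and -!leNgt.
by rewrite (le_trans qy (ltW ys)) orbT.
Qed.

End ramp.

Lemma ramp_bump_cvg p q y :
  ramp (bump p q n) y @[n --> \oo] --> ramp (\1_(`]p, q[ : set R)) y.
Proof.
apply: (@Rintegral_cvg _ _ leb _ _ _ (\1_(`]p, q[ : set R))) => //.
- move=> n; apply: measurable_funTS; apply: continuous_measurable_fun.
  exact: (smooth1_bump 0).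
- by move=> s _; exact: bump_cvg.
- exact: integrableS (integrable_indic_itv p q false true).
- by move=> n s _; rewrite ger0_norm ?bump_ge0// bump_le_indic.
Qed.

End smooth1.

(** The form in which dominated convergence serves below: uniformly bounded factors against one
    fixed integrable function, under a measure that may be infinite. *)
Lemma Rintegral_cvgM {R : realType} d (T : measurableType d)
    (mu : {measure set T -> \bar R}) (F : nat -> T -> R) (f v : T -> R) (C : R) :
  mu.-integrable setT (EFin \o v) ->
  (forall n, measurable_fun setT (F n)) ->
  (forall x, F n x @[n --> \oo] --> f x) ->
  (forall n x, `|F n x| <= C) ->
  \int[mu]_x (F n x * v x) @[n --> \oo] --> \int[mu]_x (f x * v x).
Proof.
move=> iv mF Ff FC.
have mv : measurable_fun setT v by apply/measurable_EFinP; exact: measurable_int iv.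
apply: (@Rintegral_cvg _ _ _ mu setT _ _ (fun x => C * `|v x|)) => //.
- by move=> n; apply: measurable_funM.
- by move=> x _; apply: cvgM; [exact: Ff|exact: cvg_cst].
- rewrite (_ : _ \o _ = (fun x => C%:E * ((abse \o (EFin \o v)) x))%E)//.
  by apply: integrableZl => //; exact: integrable_abse.
- by move=> n x _; rewrite normrM ler_wpM2r.
Qed.

Lemma funrposBnegE {R : realDomainType} {T : Type} (v : T -> R) x :
  v x = v^\+ x - v^\- x.
Proof. by rewrite -[v in LHS]funrposBneg. Qed.

(** * Test functions of several variables *)

Section class_C.
Context {R : realType} {d : nat}.
Implicit Types (f g : 'rV[R]_d -> R) (x v : 'rV[R]_d).

Local Notation e_ i := (delta_mx ord0 i : 'rV[R]_d).

Lemma class_C_continuous k f : class_C k f -> continuous f.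
Proof. by case: k => [//|k] []. Qed.

Lemma class_CW k f : class_C k.+1 f -> class_C k f.
Proof.
elim: k f => [|k IH] f; first by case.
by move=> [cf sf]; split=> // i; split; [case: (sf i)|apply: IH; case: (sf i)].
Qed.

Lemma class_CS k f (g : 'I_d -> 'rV[R]_d -> R) : continuous f ->
  (forall i x, is_derive x (e_ i) f (g i x)) -> (forall i, class_C k (g i)) ->
  class_C k.+1 f.
Proof.
move=> cf fg sg; split=> // i; split; first by move=> x; exact: ex_derive.
suff -> : partial i f = g i by [].
by apply/funext => x; rewrite /partial; have := fg i x => ?; exact: derive_val.
Qed.

Lemma class_C_is_derive k f i x : class_C k.+1 f ->
  is_derive x (e_ i) f (partial i f x).
Proof. by case=> cf /(_ i)[df _]; exact: derivableP. Qed.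

Lemma class_C_partial k f i : class_C k.+1 f -> class_C k (partial i f).
Proof. by case=> cf /(_ i)[]. Qed.

Lemma class_C_cst k (c : R) : class_C k ((fun=> c) : 'rV[R]_d -> R).
Proof.
elim: k c => [|k IH] c; first by move=> x; exact: cst_continuous.
apply: (@class_CS _ _ (fun=> fun=> 0)) => //; first by move=> x; exact: cst_continuous.
Qed.

Lemma continuousD_rV f g : continuous f -> continuous g ->
  continuous (fun x => f x + g x).
Proof. by move=> cf cg x; exact: (continuousD (cf x) (cg x)). Qed.

Lemma continuousM_rV f g : continuous f -> continuous g ->
  continuous (fun x => f x * g x).
Proof. by move=> cf cg x; exact: (continuousM (cf x) (cg x)). Qed.

Lemma class_CD k f g : class_C k f -> class_C k g ->
  class_C k (fun x => f x + g x).
Proof.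
elim: k f g => [|k IH] f g sf sg.
  by apply: continuousD_rV; [exact: (class_C_continuous sf)|exact: (class_C_continuous sg)].
apply: (@class_CS _ _ (fun i x => partial i f x + partial i g x)).
- by apply: continuousD_rV; [exact: (class_C_continuous sf)|exact: (class_C_continuous sg)].
- by move=> i x; exact: (is_deriveD (class_C_is_derive i x sf) (class_C_is_derive i x sg)).
- by move=> i; apply: IH; exact: class_C_partial.
Qed.

Lemma class_CM k f g : class_C k f -> class_C k g ->
  class_C k (fun x => f x * g x).
Proof.
elim: k f g => [|k IH] f g sf sg.
  by apply: continuousM_rV; [exact: (class_C_continuous sf)|exact: (class_C_continuous sg)].
apply: (@class_CS _ _ (fun i x => f x * partial i g x + g x * partial i f x)).
- by apply: continuousM_rV; [exact: (class_C_continuous sf)|exact: (class_C_continuous sg)].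
- by move=> i x; exact: (is_deriveM (class_C_is_derive i x sf) (class_C_is_derive i x sg)).
- move=> i; apply: class_CD; apply: IH; try exact: class_CW; exact: class_C_partial.
Qed.

Lemma partialM i f g x : derivable f x (e_ i) -> derivable g x (e_ i) ->
  partial i (fun y => f y * g y) x = f x * partial i g x + g x * partial i f x.
Proof. by move=> df dg; exact: (deriveM df dg). Qed.

Lemma class_C_prod (I : Type) (r : seq I) (P : pred I) k (F : I -> 'rV[R]_d -> R) :
  (forall i, P i -> class_C k (F i)) ->
  class_C k (fun x => \prod_(i <- r | P i) F i x).
Proof.
move=> sF; elim: r => [|i r IH].
  rewrite (_ : (fun x => _) = fun=> 1); first exact: class_C_cst.
  by apply/funext => x; rewrite big_nil.
rewrite (_ : (fun x => _) = fun x => (if P i then F i x else 1) * \prod_(i <- r | P i) F i x).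
  by apply: class_CM => //; case Pi : (P i); [exact: sF|exact: class_C_cst].
by apply/funext => x; rewrite big_cons; case: ifP => //; rewrite mul1r.
Qed.

Lemma coord_line (h : R) i j x : (h *: e_ i + x) ord0 j = h * (i == j)%:R + x ord0 j.
Proof. by rewrite !mxE eqxx /= eq_sym. Qed.

Lemma is_derive_line_cst f x v : (forall h : R, f (h *: v + x) = f x) ->
  is_derive x v f 0.
Proof.
move=> fx; suff h : h^-1 *: ((f \o shift x) (h *: v) - f x) @[h --> 0^'] --> (0 : R).
  by apply: DeriveDef; [apply/cvg_ex; exists 0|exact: cvg_lim].
under eq_fun do rewrite /= fx subrr scaler0.
exact: cvg_cst.
Qed.

Lemma is_derive_coord (b : R -> R) (b' : R) i x :
  is_derive (x ord0 i) (1 : R) b b' -> is_derive x (e_ i) (fun y => b (y ord0 i)) b'.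
Proof.
move=> [db <-].
have E : (fun h : R => h^-1 *: (((fun y => b (y ord0 i)) \o shift x) (h *: e_ i) -
    (fun y => b (y ord0 i)) x)) =
  (fun h : R => h^-1 *: ((b \o shift (x ord0 i)) (h *: 1) - b (x ord0 i))).
  by apply/funext => h /=; rewrite coord_line eqxx.
by apply: DeriveDef; rewrite /derivable /derive E.
Qed.

Lemma coord_rV_continuous i : continuous (fun x : 'rV[R]_d => x ord0 i).
Proof. exact: coord_continuous. Qed.

Lemma class_C_coord k (b : R -> R) i : smooth1 k b ->
  class_C k (fun x => b (x ord0 i)).
Proof.
elim: k b => [|k IH] b sb.
  by move=> x; apply: continuous_comp; [exact: coord_rV_continuous|exact: sb].
apply: (@class_CS _ _ (fun j x => (j == i)%:R * derive1 b (x ord0 i))).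
- move=> x; apply: continuous_comp; first exact: coord_rV_continuous.
  exact: smooth1_continuous sb _.
- move=> j x; have [->|ji] := eqVneq j i.
    by rewrite mul1r; apply: is_derive_coord; exact: smooth1_is_derive sb.
  rewrite mul0r; apply: is_derive_line_cst => h.
  by rewrite coord_line (negbTE ji) mulr0 add0r.
- move=> j; apply: class_CM; first exact: class_C_cst.
  by apply: IH; case: sb.
Qed.

Lemma dotv_line (h : R) (u : 'rV[R]_d) i x : dotv u (h *: e_ i + x) = h * u ord0 i + dotv u x.
Proof.
rewrite /dotv (eq_bigr (fun j => h * (u ord0 j * (i == j)%:R) + u ord0 j * x ord0 j)).
  rewrite big_split/= -mulr_sumr (bigD1 i)//= eqxx mulr1 big1 ?addr0//.
  by move=> j ji; rewrite eq_sym (negbTE ji) mulr0.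
move=> j _; rewrite coord_line; ring.
Qed.

Lemma class_C_sum (I : Type) (r : seq I) k (F : I -> 'rV[R]_d -> R) :
  (forall i, class_C k (F i)) -> class_C k (fun x => \sum_(i <- r) F i x).
Proof.
move=> sF; elim: r => [|i r IH].
  rewrite (_ : (fun x => _) = fun=> 0); first exact: class_C_cst.
  by apply/funext => x; rewrite big_nil.
rewrite (_ : (fun x => _) = fun x => F i x + \sum_(i <- r) F i x).
  exact: class_CD.
by apply/funext => x; rewrite big_cons.
Qed.

Lemma dotv_continuous (u : 'rV[R]_d) : continuous (dotv u).
Proof.
apply: (@class_C_continuous 0); apply: class_C_sum => i.
apply: class_CM; first exact: class_C_cst.
by apply: (@class_C_coord 0 id) => x; exact: cvg_id.
Qed.

Lemma is_derive_dotv (b : R -> R) (b' : R) (u : 'rV[R]_d) i x :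
  is_derive (dotv u x) (1 : R) b b' ->
  is_derive x (e_ i) (fun y => b (dotv u y)) (u ord0 i * b').
Proof.
move=> db.
have dl : is_derive (0 : R) (1 : R) (fun h : R => u ord0 i * h + dotv u x) (u ord0 i).
  rewrite -[X in is_derive _ _ _ X]addr0; apply: is_deriveD.
  rewrite -[X in is_derive _ _ _ X]mulr1; exact: is_deriveZ.
have {db} : is_derive (0 : R) (1 : R) (b \o (fun h : R => u ord0 i * h + dotv u x)) (b' * u ord0 i).
  by apply: is_derive1_comp => //; rewrite mulr0 add0r.
rewrite (mulrC b'); move=> [+ <-].
have E : (fun h : R => h^-1 *: (((fun y => b (dotv u y)) \o shift x) (h *: e_ i) -
    (fun y => b (dotv u y)) x)) =
  (fun h : R => h^-1 *: (((b \o (fun h : R => u ord0 i * h + dotv u x)) \o shift 0) (h *: 1) -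
     (b \o (fun h : R => u ord0 i * h + dotv u x)) 0)).
  apply/funext => h /=; rewrite dotv_line addr0 mulr0 add0r.
  by rewrite -[h *: 1]/(h * 1) mulr1 (mulrC h).
by move=> db; apply: DeriveDef; rewrite /derivable /derive E.
Qed.

Lemma test_function_box f (p q : 'I_d -> R) : (forall k, class_C k f) ->
  (forall x, f x != 0 -> forall i, p i <= x ord0 i <= q i) -> test_function f.
Proof.
move=> sf fpq; split=> //.
pose B := [set x : 'rV[R]_d | forall i, `[p i, q i]%classic (x ord0 i)].
have cB : compact B by apply: (@rV_compact R d (fun i => `[p i, q i]%classic)) => i; exact: segment_compact.
apply: (subclosed_compact _ cB); first exact: closed_closure.
rewrite closureE; apply: smallest_sub.
  by apply: compact_closed => //; exact: norm_hausdorff.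
by move=> x /= fx i; rewrite /= in_itv/=; exact: fpq.
Qed.

(** The partial derivative is a pointwise limit of the difference quotients with increments
    [1 / n.+1]. *)
Lemma measurable_partial f i : measurable_fun setT f ->
  (forall x, derivable f x (e_ i)) -> measurable_fun setT (partial i f).
Proof.
move=> mf df.
pose F n x := n.+1%:R * (f (n.+1%:R^-1 *: e_ i + x) - f x).
apply: (@measurable_fun_cvg _ _ _ _ F) => [n|x _].
  apply: measurable_funM => //; apply: measurable_funB => //.
  apply: measurableT_comp => //; apply/measurable_fun_rVP => j.
  under eq_fun do rewrite coord_line.
  by apply: measurable_funD => //; exact: measurable_rV_coord.
have {df} := df x; rewrite /derivable => /cvg_ex[l hl].
have <- : l = partial i f x by apply/esym; exact: cvg_lim hl.
have /(_ (fun n => n.+1%:R^-1)) :=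
  (cvgr_dnbhsP (fun h : R => h^-1 *: ((f \o shift x) (h *: e_ i) - f x)) 0 l).1 hl.
rewrite /F /=; under [X in (_ -> X @ _ --> _) -> _]eq_fun do rewrite invrK.
move=> H; apply: H; split; last exact: cvg_harmonic.
by move=> n; rewrite invr_neq0.
Qed.

Lemma class_C_trig k (u : 'rV[R]_d) :
  class_C k (fun x => cos (dotv u x)) /\ class_C k (fun x => sin (dotv u x)).
Proof.
have cc : continuous (fun x => cos (dotv u x)).
  by move=> x; apply: continuous_comp; [exact: dotv_continuous|exact: continuous_cos].
have cs : continuous (fun x => sin (dotv u x)).
  by move=> x; apply: continuous_comp; [exact: dotv_continuous|exact: continuous_sin].
elim: k => [//|k [IHc IHs]]; split.
- apply: (@class_CS _ _ (fun i x => (- u ord0 i) * sin (dotv u x))) => //.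
    move=> i x; rewrite mulNr -mulrN; apply: is_derive_dotv; exact: is_derive_cos.
  by move=> i; apply: class_CM => //; exact: class_C_cst.
- apply: (@class_CS _ _ (fun i x => u ord0 i * cos (dotv u x))) => //.
    by move=> i x; apply: is_derive_dotv; exact: is_derive_sin.
  by move=> i; apply: class_CM => //; exact: class_C_cst.
Qed.

Section product_test.
Variables (b : 'I_d -> R -> R) (p q : 'I_d -> R).
Hypothesis sb : forall i k, smooth1 k (b i).
Hypothesis b0 : forall i s, ~~ (p i < s < q i) -> b i s = 0.

Lemma class_C_product k : class_C k (fun x => \prod_i b i (x ord0 i)).
Proof. by apply: class_C_prod => i _; exact: class_C_coord. Qed.

Lemma test_function_product : test_function (fun x => \prod_i b i (x ord0 i)).
Proof.
apply: (@test_function_box _ p q); first exact: class_C_product.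
move=> x /negP h i; case: (boolP (p i < x ord0 i < q i)) => [/andP[h1 h2]|/b0 bi].
  by rewrite !ltW.
by exfalso; apply: h; rewrite (bigD1 i)//= bi mul0r.
Qed.

Lemma partial_product j x : partial j (fun x => \prod_i b i (x ord0 i)) x =
  derive1 (b j) (x ord0 j) * \prod_(i | i != j) b i (x ord0 i).
Proof.
have E : (fun x : 'rV[R]_d => \prod_i b i (x ord0 i)) =
    fun x => b j (x ord0 j) * \prod_(i | i != j) b i (x ord0 i).
  by apply/funext => y; rewrite (bigD1 j).
have d1 : is_derive x (e_ j) (fun y : 'rV[R]_d => b j (y ord0 j)) (derive1 (b j) (x ord0 j)).
  by apply: is_derive_coord; exact: (smooth1_is_derive _ (sb j 1)).
have d2 : is_derive x (e_ j) (fun y : 'rV[R]_d => \prod_(i | i != j) b i (y ord0 i)) 0.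
  apply: is_derive_line_cst => h; apply: eq_bigr => i ij.
  by rewrite coord_line eq_sym (negbTE ij) mulr0 add0r.
rewrite E partialM; [|exact: ex_derive|exact: ex_derive].
by rewrite /partial !derive_val mulr0 add0r mulrC.
Qed.

End product_test.

(** Tensor products are enough to approach indicators of boxes, and one of their factors can be
    replaced by a primitive without touching the others. They are stable under products and partial
    derivatives. *)
Definition product_test (h : 'rV[R]_d -> R) : Prop :=
  exists (b : 'I_d -> R -> R) (p q : 'I_d -> R),
  [/\ forall i k, smooth1 k (b i),
      forall i s, ~~ (p i < s < q i) -> b i s = 0 &
      h = fun x => \prod_i b i (x ord0 i)].

Lemma product_testW h : product_test h -> test_function h.
Proof. by move=> [b [p [q [sb b0 ->]]]]; exact: test_function_product sb b0. Qed.

End class_C.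

(** * Boxes and the Lebesgue measure on row vectors *)

Section boxes.
Context {R : realType} {d : nat}.

Definition box (p q : 'I_d -> R) : set 'rV[R]_d :=
  [set x | forall i, `]p i, q i[%classic (x ord0 i)].

Definition boxes : set (set 'rV[R]_d) :=
  [set B | exists p q, B = box p q].

Lemma measurable_coord_preimage (i : 'I_d) (A : set R) : measurable A ->
  measurable [set x : 'rV[R]_d | A (x ord0 i)].
Proof.
by move=> mA; rewrite -[X in measurable X]setTI; exact: measurable_rV_coord.
Qed.

Lemma measurable_box p q : measurable (box p q).
Proof.
rewrite (_ : box p q = \bigcap_(i in [set: 'I_d])
    [set x : 'rV[R]_d | `]p i, q i[%classic (x ord0 i)]).
  apply: fin_bigcap_measurable => [|i _]; first exact: finite_finset.
  exact: measurable_coord_preimage.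
by apply/seteqP; split => x /= h i; [move=> _; exact: h|exact: h i I].
Qed.

Lemma boxes_setI : setI_closed boxes.
Proof.
move=> A B [p [q ->]] [p' [q' ->]].
exists (fun i => Num.max (p i) (p' i)), (fun i => Num.min (q i) (q' i)).
apply/seteqP; split => x /=.
  move=> [h1 h2] i; have := h1 i; have := h2 i; rewrite /= !in_itv/=.
  by rewrite gt_max lt_min => /andP[-> ->] /andP[-> ->].
by move=> h; split=> i; have := h i; rewrite /= !in_itv/= gt_max lt_min =>
  /andP[/andP[h1 h2] /andP[h3 h4]]; apply/andP.
Qed.

Lemma near_gtn (r : R) : \forall n \near \oo, r < n%:R.
Proof. exact: nbhs_infty_gtr. Qed.

Lemma bigcup_box : \bigcup_n box (fun=> - n%:R) (fun=> n%:R) = [set: 'rV[R]_d].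
Proof.
rewrite -subTset => x _.
have : \forall n \near \oo, forall i : 'I_d, `|x ord0 i| < n%:R.
  by apply: filter_forall => i; exact: near_gtn.
case=> n _ /(_ n (leqnn n)) h; exists n => // i.
by rewrite /= in_itv/= -ltr_norml.
Qed.

Lemma measurable_rV_boxes :
  (measurable : set (set 'rV[R]_d)) = <<s boxes >>.
Proof.
apply/seteqP; split; last first.
  apply: smallest_sub; first exact: sigma_algebra_measurable.
  by move=> _ [p [q ->]]; exact: measurable_box.
apply: smallest_sub; first exact: smallest_sigma_algebra.
rewrite -bigcup_seq/= => _ [i _ [B mB <-]]; rewrite setTI.
have : measurable B by [].
have -> : (measurable : set (set R)) = <<s @RGenOInfty.G R >>.
  exact: RGenOInfty.measurableE.
suff: <<s @RGenOInfty.G R >> `<=`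
  [set B | <<s boxes >> ((fun x : 'rV[R]_d => x ord0 i) @^-1` B)] by apply.
have sb := smallest_sigma_algebra setT boxes.
apply: smallest_sub.
  split=> /=.
  - by rewrite preimage_set0; case: sb.
  - move=> A; rewrite !setTD preimage_setC; case: sb => _ + _.
    by move=> h /h; rewrite setTD.
  - by move=> F h; rewrite preimage_bigcup; case: sb => _ _; apply.
move=> _ [r ->] /=.
(* A half-space in direction [i] is exhausted by bounded boxes: only the lower end [r] in direction
   [i] is kept fixed. *)
rewrite (_ : _ @^-1` _ = \bigcup_n
  box (fun k => if k == i then r else - n%:R) (fun=> n%:R)).
  case: sb => _ _; apply => n; apply: sub_sigma_algebra.
  by exists (fun k => if k == i then r else - n%:R), (fun=> n%:R).
apply/seteqP; split => x /=; last first.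
  by move=> [n _ /(_ i)]/=; rewrite eqxx !in_itv/= andbT => /andP[].
rewrite in_itv/= andbT => rx.
have : [set: 'rV[R]_d] x by [].
rewrite -bigcup_box.
case=> n _ h; exists n => // k; have := h k; rewrite /= !in_itv/=.

by case: eqP => // -> /andP[_ ->]; rewrite rx.
Qed.

(** Boxes are stable under intersection, generate the measurable sets, and growing cubes of finite
    measure exhaust the space. *)
Lemma measure_rV_unique (m1 m2 : {measure set 'rV[R]_d -> \bar R}) :
  (forall p q, m1 (box p q) = m2 (box p q)) ->
  (forall p q, (m1 (box p q) < +oo)%E) ->
  forall A, measurable A -> m1 A = m2 A.
Proof.
move=> m12 m1oo A mA.
apply: (measure_unique boxes (fun n => box (fun=> - n%:R) (fun=> n%:R))) => //.
- exact: measurable_rV_boxes.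
- exact: boxes_setI.
- by move=> n; exists (fun=> - n%:R), (fun=> n%:R).
- exact: bigcup_box.
- by move=> _ [p [q ->]].
Qed.

End boxes.

(** [lebesgue_measure_rV] returns a bundled measure; this copy is a function to which the
    sigma-finite structure required by Fubini's theorem can be attached. *)
Definition lam {R : realType} n : set 'rV[R]_n -> \bar R := lebesgue_measure_rV n.

HB.instance Definition _ (R : realType) n :=
  Measure.copy (@lam R n) (lebesgue_measure_rV n).

Lemma lam_box {R : realType} n (p q : 'I_n -> R) :
  lam (box p q) = (\prod_(i < n) lebesgue_measure (`]p i, q i[%classic : set R))%E.
Proof. exact: lebesgue_measure_rV_box. Qed.

Lemma leb_oo_lty {R : realType} (p q : R) :
  (lebesgue_measure (`]p, q[%classic : set R) < +oo)%E.
Proof.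
by rewrite lebesgue_measure_itv/=; case: ifP => // _; rewrite -EFinB ltry.
Qed.

Lemma lam_box_lty {R : realType} n (p q : 'I_n -> R) : (lam (box p q) < +oo)%E.
Proof.
rewrite lam_box; suff: (0 <= \prod_(i < n) lebesgue_measure (`]p i, q i[%classic : set R))%E /\
    (\prod_(i < n) lebesgue_measure (`]p i, q i[%classic : set R) < +oo)%E by case.
elim/big_ind : _ => [|x y [x0 xoo] [y0 yoo]|i _]; first by rewrite ltry lee_fin ler01.
- split; first exact: mule_ge0.
  by apply: lte_mul_pinfty => //; rewrite ge0_fin_numE.
by split; [exact: measure_ge0|exact: leb_oo_lty].
Qed.

Lemma lam_sigma_finite {R : realType} n : sigma_finite setT (@lam R n).
Proof.
exists (fun n => box (fun=> - n%:R) (fun=> n%:R)); first by rewrite bigcup_box.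
by move=> k; split; [exact: measurable_box|exact: lam_box_lty].
Qed.

HB.instance Definition _ (R : realType) n :=
  Measure_isSigmaFinite.Build _ _ _ (@lam R n) (@lam_sigma_finite R n).

(** * Splitting off an arbitrary coordinate *)

Section insert.
Context {R : realType} {n : nat}.
Local Notation leb := (@lebesgue_measure R).

Definition insert (j : 'I_n.+1) (z : measurableTypeR R * 'rV[R]_n) : 'rV[R]_n.+1 :=
  \row_i oapp (z.2 ord0) z.1 (unlift j i).

Lemma insert_same j z : insert j z ord0 j = z.1.
Proof. by rewrite mxE unlift_none. Qed.

Lemma insert_lift j z k : insert j z ord0 (lift j k) = z.2 ord0 k.
Proof. by rewrite mxE liftK. Qed.

Lemma measurable_insert j : measurable_fun setT (insert j).
Proof.
apply/measurable_fun_rVP => i; have [k ->|->] := unliftP j i.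
- under eq_fun do rewrite insert_lift.
  exact: (measurableT_comp (@measurable_rV_coord _ R n k) measurable_snd).
- under eq_fun do rewrite insert_same.
  exact: measurable_fst.
Qed.

Lemma insert_box j p q : insert j @^-1` box p q =
  `]p j, q j[%classic `*` box (fun k => p (lift j k)) (fun k => q (lift j k)).
Proof.
apply/seteqP; split => [[s x] /= h|[s x] /= [h1 h2] i].
  by split; [have := h j; rewrite insert_same|move=> k; have := h (lift j k); rewrite insert_lift].
by have [k ->|->] := unliftP j i; rewrite ?insert_lift ?insert_same//; exact: h2.
Qed.

HB.instance Definition _ j := @isMeasurableFun.Build _ _ _ _ (insert j) (measurable_insert j).

(** The measure is built by adding coordinates at the front. On boxes it is a product of lengths,
    whose order is irrelevant, so every direction [j] can serve as the one-dimensional factor. *)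
Lemma lam_insert j (A : set 'rV[R]_n.+1) : measurable A ->
  lam A = (leb \x @lam R n)%E (insert j @^-1` A).
Proof.
move=> mA.
apply: (@measure_rV_unique R n.+1 (@lam R n.+1) (pushforward (leb \x @lam R n)%E (insert j))) => //.
  move=> p q; transitivity ((leb \x @lam R n)%E (`]p j, q j[%classic `*`
    box (fun k => p (lift j k)) (fun k => q (lift j k)))); last first.
    by congr ((_ \x _)%E _); exact/esym/insert_box.
  rewrite product_measure1E//; last exact: measurable_box.
  apply: (etrans (lam_box p q)); rewrite (bigD1_ord j)//=.
  by congr (_ * _)%E; exact/esym/(@lam_box R n).
by move=> p q; exact: lam_box_lty.
Qed.

End insert.

(** * Weak derivatives with respect to a measure *)

Section density.
Context d (T : measurableType d) {R : realType}.
Variables (mu : {measure set T -> \bar R}) (f : T -> \bar R).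
Hypotheses (mf : measurable_fun setT f) (f0 : forall x, (0 <= f x)%E).

(** The two proofs are arguments of the set function so that its measure structure, which depends on
    them, can be inferred from the term. *)
Definition density & measurable_fun setT f & (forall x, (0 <= f x)%E) :=
  fun A => (\int[mu]_(x in A) f x)%E.

Let density0 : density mf f0 set0 = 0%E.
Proof. exact: integral_set0. Qed.

Let density_ge0 A : (0 <= density mf f0 A)%E.
Proof. by apply: integral_ge0 => x _; exact: f0. Qed.

Let density_sigma_additive : semi_sigma_additive (density mf f0).
Proof. exact: semi_sigma_additive_nng_induced. Qed.

HB.instance Definition _ := isMeasure.Build _ _ _ (density mf f0)
  density0 density_ge0 density_sigma_additive.
End density.

Lemma measurable_fun_prod_cond {d} {T : measurableType d} {R : realType}
    (I : Type) (r : seq I) (P : pred I) (F : I -> T -> R) :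
  (forall i, P i -> measurable_fun setT (F i)) ->
  measurable_fun setT (fun x => \prod_(i <- r | P i) F i x).
Proof.
move=> mF; elim: r => [|i r IH].
  by under eq_fun do rewrite big_nil; exact: measurable_cst.
rewrite (_ : (fun x => _) =
    fun x => (if P i then F i x else 1) * \prod_(i <- r | P i) F i x).
  by apply: measurable_funM => //; case Pi : (P i) => //; exact: mF.
by apply/funext => x; rewrite big_cons; case: ifP => //; rewrite mul1r.
Qed.

Lemma cvg_prod_cond {R : realType} (I : Type) (r : seq I) (P : pred I)
    (F : I -> nat -> R) (l : I -> R) :
  (forall i, P i -> F i n @[n --> \oo] --> l i) ->
  \prod_(i <- r | P i) F i n @[n --> \oo] --> \prod_(i <- r | P i) l i.
Proof.
move=> Fl; elim: r => [|i r IH].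
  by rewrite big_nil; under eq_fun do rewrite big_nil; exact: cvg_cst.
rewrite big_cons; under eq_fun do rewrite big_cons.
by case Pi : (P i) => //; apply: cvgM => //; exact: Fl.
Qed.

Section weak_derivative.
Context {R : realType} {d : nat}.
Variables (m : {sigma_finite_measure set 'rV[R]_d -> \bar R}) (j : 'I_d).
Variables (w w' : 'rV[R]_d -> R).
Hypothesis iw : m.-integrable setT (EFin \o w).
Hypothesis iw' : m.-integrable setT (EFin \o w').
Hypothesis ww' : forall h, product_test h ->
  \int[m]_x (partial j h x * w x) = - \int[m]_x (h x * w' x).

Local Notation leb := (@lebesgue_measure R).

Let mw : measurable_fun setT w.
Proof. by apply/measurable_EFinP; exact: measurable_int iw. Qed.

Let mw' : measurable_fun setT w'.
Proof. by apply/measurable_EFinP; exact: measurable_int iw'. Qed.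

Section box.
Variables (p q : 'I_d -> R).

Local Notation side b := (fun x : 'rV[R]_d => \prod_(i | i != j) b i (x ord0 i)).

Let side_bump n x : `|side (fun i => bump (p i) (q i) n) x| <= 1.
Proof.
rewrite ger0_norm; last by apply: prodr_ge0 => i _; exact: bump_ge0.
by apply: prodr_ile1 => i _; rewrite bump_ge0 bump_le1.
Qed.

Let mbump n (i k : 'I_d) (t : R) :
  measurable_fun setT (fun x : 'rV[R]_d => bump (p i) (q i) n (x ord0 k - t)).
Proof.
apply: measurableT_comp.
  by apply: continuous_measurable_fun; exact: (smooth1_bump 0).
by apply: measurable_funB => //; exact: measurable_rV_coord.
Qed.

Let mside n : measurable_fun setT (side (fun i => bump (p i) (q i) n)).
Proof.
apply: measurable_fun_prod_cond => i _.
by under eq_fun do rewrite -[_ ord0 i]subr0; exact: mbump.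
Qed.

Let bumpB_norm n i k t (x : 'rV[R]_d) :
  `|bump (p i) (q i) n (x ord0 k) - bump (p i) (q i) n (x ord0 k - t)| <= 1.
Proof.
rewrite ler_norml; have := bump_ge0 (p i) (q i) n (x ord0 k).
have := bump_le1 (p i) (q i) n (x ord0 k).
have := bump_ge0 (p i) (q i) n (x ord0 k - t).
have := bump_le1 (p i) (q i) n (x ord0 k - t).
by move=> *; apply/andP; split; lra.
Qed.

Let Th n := ramp (bump (p j) (q j) n).

Let mbump1 n : measurable_fun setT (bump (p j) (q j) n).
Proof. by apply: continuous_measurable_fun; exact: (smooth1_bump 0). Qed.

Let sTh n k : smooth1 k (Th n).
Proof.
apply: (@smooth1_ramp _ _ (p j) (q j) 1).
- by move=> k'; exact: smooth1_bump.
- by move=> s; rewrite ger0_norm ?bump_ge0// bump_le1.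
- by move=> s; exact: bump_out.
Qed.

Let L := \int[leb]_t \1_(`]p j, q j[ : set R) t.

Let Th_bound n y : 0 <= Th n y <= L.
Proof.
rewrite ramp_ge0/=; last by move=> s; exact: bump_ge0.
apply: ramp_le; [exact: mbump1|exact: bump_ge0|exact: bump_le_indic].
Qed.

(* The difference of two shifts of [bump] has the compactly supported primitive
   [Th n s - Th n (s - t)]; the shift is then sent to infinity. *)
Let step n t : 0 <= t ->
  \int[m]_x ((bump (p j) (q j) n (x ord0 j) - bump (p j) (q j) n (x ord0 j - t)) *
     side (fun i => bump (p i) (q i) n) x * w x) =
  - \int[m]_x ((Th n (x ord0 j) - Th n (x ord0 j - t)) *
     side (fun i => bump (p i) (q i) n) x * w' x).
Proof.
move=> t0.
pose bj := fun s => Th n s - Th n (s - t).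
have shift_eq : (fun s => - Th n (s - t)) = (fun s => (-1) * Th n (1 * s + - t)).
  by apply/funext => s; rewrite mulN1r mul1r.
have sbj k : smooth1 k bj.
  apply: smooth1D => //; rewrite shift_eq.
  by apply: smooth1M; [exact: smooth1_cst|exact: smooth1_affine].
pose b := fun i => if i == j then bj else bump (p i) (q i) n.
have dbj s : derive1 bj s = bump (p j) (q j) n s - bump (p j) (q j) n (s - t).
  have dTh y : is_derive y (1 : R) (Th n) (bump (p j) (q j) n y).
    apply: (@ramp_is_derive _ _ (p j) (q j) 1).
    - exact: (smooth1_bump 0).
    - by move=> u; rewrite ger0_norm ?bump_ge0// bump_le1.
    - by move=> u; exact: bump_out.
  have dsh : is_derive s (1 : R) (Th n \o (fun u => u - t)) (bump (p j) (q j) n (s - t)).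
    rewrite -[X in is_derive _ _ _ X]mulr1; apply: is_derive1_comp => //.
    rewrite -[X in is_derive _ _ _ X]addr0; exact: is_deriveD.
  by rewrite derive1E; have := is_deriveB (dTh s) dsh => ?; exact: derive_val.
(* In direction [j] the support extends up to [q j + t]: from there on both ramps have reached the
   full integral of the bump and cancel. *)
have b_out i s : ~~ (p i < s < (if i == j then q i + t else q i)) -> b i s = 0.
  rewrite /b; case: eqP => [->|_]; last exact: bump_out.
  rewrite negb_and -!leNgt /bj /Th => /orP[sp|qs].
    have b0 u : ~~ (p j < u < q j) -> bump (p j) (q j) n u = 0 by exact: bump_out.
    rewrite !(@ramp_left _ _ (p j) (q j)) ?subrr//; try exact: bump_ge0; try exact: bump_le_indic.
    by rewrite lerBlDr (le_trans sp)// lerDl.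
  rewrite !(@ramp_right _ _ (p j) (q j)) ?subrr//; try exact: bump_ge0; try exact: bump_le_indic.
    by rewrite lerBrDr.
  by apply: le_trans qs; rewrite lerDl.
have sb i k : smooth1 k (b i) by rewrite /b; case: eqP => // _; exact: smooth1_bump.
have := ww' (ex_intro _ b (ex_intro _ p (ex_intro _ _ (And3 sb b_out erefl)))).
under eq_Rintegral do rewrite (partial_product sb) /b eqxx dbj.
under [in X in _ = - X -> _]eq_Rintegral do rewrite (bigD1 j)//= /b eqxx.
have E (x : 'rV[R]_d) : \prod_(i | i != j) (if i == j then bj else bump (p i) (q i) n) (x ord0 i) =
   side (fun i => bump (p i) (q i) n) x.
  by apply: eq_bigr => i /negbTE ->.
under eq_Rintegral do rewrite E.
by under [in X in _ = - X -> _]eq_Rintegral do rewrite E.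
Qed.

Let cvg_shift (f : R -> R) (a y : R) : (forall s, s <= a -> f s = 0) ->
  f (y - n%:R) @[n --> \oo] --> (0 : R).
Proof.
move=> fa; apply: (@cvg_trans _ ((fun=> 0 : R) @ \oo)); last exact: cvg_cst.
apply: near_eq_cvg; near=> n; rewrite fa// lerBlDr -lerBlDl ltW//.
by near: n; exact: near_gtn.
Unshelve. all: by end_near. Qed.

Let step2 n :
  \int[m]_x (bump (p j) (q j) n (x ord0 j) * side (fun i => bump (p i) (q i) n) x * w x) =
  - \int[m]_x (Th n (x ord0 j) * side (fun i => bump (p i) (q i) n) x * w' x).
Proof.
have mThc t : measurable_fun setT (fun x : 'rV[R]_d => Th n (x ord0 j - t)).
  apply: measurableT_comp.
    by apply: continuous_measurable_fun; exact: (sTh n 0).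
  by apply: measurable_funB => //; exact: measurable_rV_coord.
have mThc0 : measurable_fun setT (fun x : 'rV[R]_d => Th n (x ord0 j)).
  by under eq_fun do rewrite -[_ ord0 j]subr0; exact: mThc.
have mb0 : measurable_fun setT (fun x : 'rV[R]_d => bump (p j) (q j) n (x ord0 j)).
  by under eq_fun do rewrite -[_ ord0 j]subr0; exact: mbump.
have c1 : (fun k : nat => \int[m]_x ((bump (p j) (q j) n (x ord0 j) - bump (p j) (q j) n (x ord0 j - k%:R)) *
     side (fun i => bump (p i) (q i) n) x * w x)) @ \oo -->
  \int[m]_x (bump (p j) (q j) n (x ord0 j) * side (fun i => bump (p i) (q i) n) x * w x).
  apply: (@Rintegral_cvgM _ _ _ m _ _ _ 1) => //.
  - by move=> k; apply: measurable_funM => //; apply: measurable_funB.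
  - move=> x; apply: cvgM; last exact: cvg_cst.
    rewrite -[X in _ --> X]subr0; apply: cvgB; first exact: cvg_cst.
    apply: (@cvg_shift _ (p j)) => s sp; apply: bump_out.
    by rewrite negb_and -leNgt sp.
  - by move=> k x; rewrite normrM mulr_ile1.
have c2 : (fun k : nat => - \int[m]_x ((Th n (x ord0 j) - Th n (x ord0 j - k%:R)) *
     side (fun i => bump (p i) (q i) n) x * w' x)) @ \oo -->
  - \int[m]_x (Th n (x ord0 j) * side (fun i => bump (p i) (q i) n) x * w' x).
  apply: cvgN; apply: (@Rintegral_cvgM _ _ _ m _ _ _ L) => //.
  - by move=> k; apply: measurable_funM => //; apply: measurable_funB.
  - move=> x; apply: cvgM; last exact: cvg_cst.
    rewrite -[X in _ --> X]subr0; apply: cvgB; first exact: cvg_cst.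
    apply: (@cvg_shift _ (p j)) => s sp.
    by apply: (@ramp_left _ _ (p j) (q j)) => //; try exact: bump_ge0; exact: bump_le_indic.
  - move=> k x; rewrite normrM.
    have h1 : `|Th n (x ord0 j) - Th n (x ord0 j - k%:R)| <= L.
      have /andP[a1 a2] := Th_bound n (x ord0 j).
      have /andP[a3 a4] := Th_bound n (x ord0 j - k%:R).
      by rewrite ler_norml; apply/andP; split; lra.
    by apply: le_trans (ler_wpM2l _ (side_bump n x)) _ => //; rewrite mulr1.
have E : (fun k : nat => \int[m]_x ((bump (p j) (q j) n (x ord0 j) - bump (p j) (q j) n (x ord0 j - k%:R)) *
     side (fun i => bump (p i) (q i) n) x * w x)) = (fun k : nat => - \int[m]_x ((Th n (x ord0 j) - Th n (x ord0 j - k%:R)) *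
     side (fun i => bump (p i) (q i) n) x * w' x)).
  by apply/funext => k; exact: step.
rewrite E in c1; exact: (cvg_unique _ c1 c2).
Qed.

Local Notation ind i := (\1_(`]p i, q i[ : set R) : R -> R).

(** The bumps of [step2] are sharpened to indicators. The bounds [1] and [L] do not depend on [n],
    so dominated convergence applies to both sides. *)
Lemma weak_derivative_box :
  \int[m]_x (ind j (x ord0 j) * side (fun i => ind i) x * w x) =
  - \int[m]_x (ramp (ind j) (x ord0 j) * side (fun i => ind i) x * w' x).
Proof.
have side_cvg x : side (fun i => bump (p i) (q i) n) x @[n --> \oo] -->
    side (fun i => ind i) x.
  by apply: cvg_prod_cond => i _; exact: bump_cvg.
have mThc0 n : measurable_fun setT (fun x : 'rV[R]_d => Th n (x ord0 j)).
  apply: (@measurableT_comp _ _ _ _ _ _ (Th n)); last exact: measurable_rV_coord.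
  by apply: continuous_measurable_fun; exact: (sTh n 0).
have mb0 n : measurable_fun setT (fun x : 'rV[R]_d => bump (p j) (q j) n (x ord0 j)).
  by under eq_fun do rewrite -[_ ord0 j]subr0; exact: mbump.
have c1 : (fun n : nat => \int[m]_x (bump (p j) (q j) n (x ord0 j) * side (fun i => bump (p i) (q i) n) x * w x)) @ \oo -->
  \int[m]_x (ind j (x ord0 j) * side (fun i => ind i) x * w x).
  apply: (@Rintegral_cvgM _ _ _ m _ _ _ 1) => //.
  - by move=> k; apply: measurable_funM.
  - by move=> x; apply: cvgM => //; exact: bump_cvg.
  - move=> k x; rewrite normrM mulr_ile1//.
    by rewrite ger0_norm ?bump_ge0// bump_le1.
have c2 : (fun n : nat => - \int[m]_x (Th n (x ord0 j) * side (fun i => bump (p i) (q i) n) x * w' x)) @ \oo -->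
  - \int[m]_x (ramp (ind j) (x ord0 j) * side (fun i => ind i) x * w' x).
  apply: cvgN; apply: (@Rintegral_cvgM _ _ _ m _ _ _ L) => //.
  - by move=> k; apply: measurable_funM.
  - by move=> x; apply: cvgM => //; exact: ramp_bump_cvg.
  - move=> k x; rewrite normrM.
    have /andP[a1 a2] := Th_bound k (x ord0 j).
    rewrite (ger0_norm a1).
    by apply: le_trans (ler_wpM2l _ (side_bump k x)) _ => //; rewrite mulr1.
have E : (fun n : nat => \int[m]_x (bump (p j) (q j) n (x ord0 j) * side (fun i => bump (p i) (q i) n) x * w x)) = (fun n : nat => - \int[m]_x (Th n (x ord0 j) * side (fun i => bump (p i) (q i) n) x * w' x)).
  by apply/funext => k; exact: step2.
rewrite E in c1; exact: (cvg_unique _ c1 c2).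
Qed.

End box.
End weak_derivative.

Lemma norm_indic_le1 {R : realType} (T : Type) (A : set T) (x : T) :
  `|\1_A x : R| <= 1.
Proof. by rewrite indicE; case: (x \in A); rewrite ?normr1 ?normr0 ?ler01. Qed.

Section replace.
Context {R : realType} {d : nat}.
Variable j : 'I_d.
Local Notation leb := (@lebesgue_measure R).

Definition replace (z : 'rV[R]_d * measurableTypeR R) : 'rV[R]_d :=
  \row_i if i == j then z.2 else z.1 ord0 i.

Lemma replaceE z i : replace z ord0 i = if i == j then z.2 else z.1 ord0 i.
Proof. by rewrite mxE. Qed.

Lemma measurable_replace : measurable_fun setT replace.
Proof.
apply/measurable_fun_rVP => i; under eq_fun do rewrite replaceE.
case: eqP => _; first exact: measurable_snd.
exact: (measurableT_comp (@measurable_rV_coord _ R d i) measurable_fst).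
Qed.

Lemma measurable_replace_line x :
  measurable_fun setT (fun s : measurableTypeR R => replace (x, s)).
Proof.
apply/measurable_fun_rVP => i; under eq_fun do rewrite replaceE.
by case: eqP => _; [exact: measurable_id|exact: measurable_cst].
Qed.

HB.instance Definition _ :=
  @isMeasurableFun.Build _ _ _ _ replace measurable_replace.

Definition below : set ('rV[R]_d * measurableTypeR R) :=
  [set z : 'rV[R]_d * R | z.2 <= z.1 ord0 j].

Lemma measurable_below : measurable below.
Proof.
rewrite (_ : below = (fun z : 'rV[R]_d * R => z.1 ord0 j - z.2) @^-1` `[0, +oo[%classic).
  rewrite -[X in measurable X]setTI.
  have : measurable_fun setT
      (fun z : 'rV[R]_d * measurableTypeR R => z.1 ord0 j - z.2).
    apply: measurable_funB; last exact: measurable_snd.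
    exact: (measurableT_comp (@measurable_rV_coord _ R d j) measurable_fst).
  by apply.
by apply/seteqP; split => z /=; rewrite in_itv/= andbT subr_ge0.
Qed.

Lemma ramp_indicE (p q y : R) :
  (\int[leb]_s (\1_(`]-oo, y] : set R) s * \1_(`]p, q[ : set R) s)%:E)%E =
  (ramp (\1_(`]p, q[ : set R)) y)%:E.
Proof.
rewrite /ramp /Rintegral fineK; last first.
  apply: integrable_fin_num => //.
  exact: integrableS (integrable_indic_itv p q false true).
rewrite [RHS]integral_mkcond; apply: eq_integral => s _.
rewrite patchE indicE; case: ifP => _; first by rewrite mul1r.
by rewrite mul0r.
Qed.

End replace.

Section weak_derivative_measure.
Context {R : realType} {d : nat}.
Variables (m : {sigma_finite_measure set 'rV[R]_d -> \bar R}) (j : 'I_d).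
Local Notation leb := (@lebesgue_measure R).

Section nonneg.
Variable v : 'rV[R]_d -> R.
Hypothesis iv : m.-integrable setT (EFin \o v).
Hypothesis v0 : forall x, 0 <= v x.

Let mv : measurable_fun setT v.
Proof. by apply/measurable_EFinP; exact: measurable_int iv. Qed.

Definition below_density (z : 'rV[R]_d * measurableTypeR R) : \bar R :=
  (v z.1 * \1_(below j) z)%:E.

Lemma measurable_below_density : measurable_fun setT below_density.
Proof.
apply/measurable_EFinP; apply: measurable_funM.
  exact: (measurableT_comp mv measurable_fst).
by apply: measurable_indic; exact: measurable_below.
Qed.

Lemma below_density_ge0 z : (0 <= below_density z)%E.
Proof. by rewrite lee_fin mulr_ge0. Qed.

(** For nonnegative [v] this is the opposite of the double integral of the overview, seen as the
    image under [replace j] of a measure with a density on the product space. As for [density], the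
    proofs are arguments for the sake of the measure structure. *)
Definition below_measure & m.-integrable setT (EFin \o v) & (forall x, 0 <= v x) :=
  fun A : set 'rV[R]_d => (\int[m \x leb]_(z in replace j @^-1` A) below_density z)%E.

Let below_measure0 : below_measure iv v0 set0 = 0%E.
Proof. by rewrite /below_measure preimage_set0 integral_set0. Qed.

Let below_measure_ge0 A : (0 <= below_measure iv v0 A)%E.
Proof. by apply: integral_ge0 => z _; exact: below_density_ge0. Qed.

Let below_measure_sigma_additive : semi_sigma_additive (below_measure iv v0).
Proof.
move=> F mF tF mUF; rewrite /below_measure preimage_bigcup.
have mr A : measurable A -> measurable (replace j @^-1` A).
  by move=> mA; rewrite -[X in measurable X]setTI; exact: measurable_replace.
apply: (semi_sigma_additive_nng_induced measurable_below_density below_density_ge0).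
- by move=> n; exact: mr.
- apply/trivIsetP => /= i k _ _ ik; rewrite -preimage_setI.
  by move/trivIsetP : tF => /(_ _ _ _ _ ik) ->//; rewrite preimage_set0.
- by rewrite -preimage_bigcup; exact: mr.
Qed.

HB.instance Definition _ := isMeasure.Build _ _ _ (below_measure iv v0)
  below_measure0 below_measure_ge0 below_measure_sigma_additive.

Lemma integral_below_density (A : set 'rV[R]_d) : measurable A ->
  (\int[m \x leb]_(z in replace j @^-1` A) below_density z =
   \int[m]_x ((v x)%:E *
     \int[leb]_s (\1_(`]-oo, x ord0 j] : set R) s * \1_A (replace j (x, s)))%:E))%E.
Proof.
move=> mA; rewrite integral_mkcond/=.
have mrA : measurable (replace j @^-1` A).
  by rewrite -[X in measurable X]setTI; exact: measurable_replace.
rewrite fubini_tonelli1//; last first.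
- by move=> z; rewrite patchE; case: ifP => // _; exact: below_density_ge0.
- apply/(measurable_restrictT _ _).1 => //.
  apply: measurable_funTS; exact: measurable_below_density.
apply: eq_integral => x _; rewrite /fubini_F.
rewrite -ge0_integralZl//; last first.
- by rewrite lee_fin.
- apply/measurable_EFinP; apply: measurable_funM => //.
  exact: (measurableT_comp (measurable_indic mA) (measurable_replace_line j x)).
apply: eq_integral => s _; rewrite patchE /below_density !indicE.
rewrite (_ : ((x, s) \in below j) = (s \in `]-oo, x ord0 j]%classic)); last first.
  by apply/idP/idP => /set_mem h; apply/mem_set; move: h; rewrite /below /= in_itv.
rewrite (_ : ((x, s) \in replace j @^-1` A) = (replace j (x, s) \in A)).
  case: ifPn => _; first by rewrite mulr1.
  by rewrite mulr0 mule0.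
by apply/idP/idP => /set_mem h; apply/mem_set.
Qed.

Section box.
Variables (p q : 'I_d -> R).
Local Notation ind i := (\1_(`]p i, q i[ : set R) : R -> R).
Local Notation side := (fun x : 'rV[R]_d => \prod_(i | i != j) ind i (x ord0 i)).

Lemma indic_boxE (x : 'rV[R]_d) :
  \1_(box p q) x = ind j (x ord0 j) * side x.
Proof.
rewrite -(bigD1 j (P := predT) (F := fun i => ind i (x ord0 i)))//=.
case: (pselect (box p q x)) => h.
  rewrite indicE mem_set// big1// => i _.
  by rewrite indicE mem_set//; exact: h.
rewrite indicE memNset//; have [i hi] : exists i, ~ `]p i, q i[%classic (x ord0 i).
  by apply/existsNP => H; apply: h.
by rewrite (bigD1 i)//= indicE memNset// mul0r.
Qed.

Lemma indic_box_replace (x : 'rV[R]_d) s :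
  \1_(box p q) (replace j (x, s)) = ind j s * side x.
Proof.
rewrite indic_boxE replaceE eqxx; congr (_ * _).
by apply: eq_bigr => i /negbTE ij; rewrite replaceE ij.
Qed.

Let side01 x : 0 <= side x <= 1.
Proof.
apply/andP; split; first exact: prodr_ge0.
by apply: prodr_ile1 => i _; rewrite (le_trans (ler_norm _) (norm_indic_le1 _ _)) andbT.
Qed.

Let mind i k : measurable_fun setT (fun x : 'rV[R]_d => ind i (x ord0 k)).
Proof.
apply: (@measurableT_comp _ _ _ _ _ _ (ind i)); last exact: measurable_rV_coord.
exact: measurable_indic.
Qed.

Let mside : measurable_fun setT side.
Proof. exact: measurable_fun_prod_cond. Qed.

Lemma integrable_bounded_mul (C : R) (f : 'rV[R]_d -> R) :
  measurable_fun setT f -> (forall x, `|f x| <= C) ->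
  m.-integrable setT (EFin \o (fun x : 'rV[R]_d => f x * v x)).
Proof.
move=> mf fC; have C0 : 0 <= C by exact: le_trans (fC 0).
apply: (@le_integrable _ _ R m setT measurableT _ (fun x => C%:E * (v x)%:E)%E).
- by apply/measurable_EFinP; exact: measurable_funM.
- move=> x _; rewrite -EFinM /= lee_fin !normrM (ger0_norm C0).
  by rewrite ler_wpM2r.
- exact: integrableZl.
Qed.

Lemma integrable_box :
  m.-integrable setT (EFin \o (fun x : 'rV[R]_d => ind j (x ord0 j) * side x * v x)).
Proof.
apply: (@integrable_bounded_mul 1); first by apply: measurable_funM.
move=> x; have /andP[h1 h2] := side01 x.
by rewrite normrM mulr_ile1// ?norm_indic_le1// ger0_norm.
Qed.

Lemma integral_box : (\int[m]_(x in box p q) (v x)%:E)%E =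
  (\int[m]_x (ind j (x ord0 j) * side x * v x))%:E.
Proof.
rewrite /Rintegral fineK; last first.
  by apply: integrable_fin_num => //; exact: integrable_box.
rewrite [LHS]integral_mkcond; apply: eq_integral => x _.
rewrite -indic_boxE patchE indicE; case: ifP => _; first by rewrite mul1r.
by rewrite mul0r.
Qed.

Lemma integrable_ramp_box : m.-integrable setT
  (EFin \o (fun x : 'rV[R]_d => ramp (ind j) (x ord0 j) * side x * v x)).
Proof.
have mramp : measurable_fun setT (fun x : 'rV[R]_d => ramp (ind j) (x ord0 j)).
  apply: (@measurableT_comp _ _ _ _ _ _ (ramp (ind j))); last exact: measurable_rV_coord.
  (* The ramp of the indicator is measurable as a limit of smooth ramps. *)
  apply: (@measurable_fun_cvg _ _ _ _ (fun n => ramp (bump (p j) (q j) n))).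
    move=> n; apply: continuous_measurable_fun; apply: (@smooth1_ramp _ _ (p j) (q j) 1 _ _ _ 0%N).
    - by move=> k; exact: smooth1_bump.
    - by move=> s; rewrite ger0_norm ?bump_ge0// bump_le1.
    - by move=> s; exact: bump_out.
  by move=> y _; exact: ramp_bump_cvg.
apply: (@integrable_bounded_mul (\int[leb]_t ind j t)).
  by apply: measurable_funM.
move=> x; have /andP[h1 h2] := side01 x.
rewrite normrM (ger0_norm h1) ger0_norm; last by apply: ramp_ge0 => s.
rewrite -[leRHS]mulr1; apply: ler_pM => //; first by apply: ramp_ge0 => s.
by apply: ramp_le.
Qed.

(** For fixed [x] the new coordinate [s] ranges over the part of []p j, q j[] below [x ord0 j],
    whose length is the ramp. *)
Lemma integral_below_density_box :
  (\int[m \x leb]_(z in replace j @^-1` box p q) below_density z)%E =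
  (\int[m]_x (ramp (ind j) (x ord0 j) * side x * v x))%:E.
Proof.
rewrite /Rintegral fineK; last first.
  by apply: integrable_fin_num => //; exact: integrable_ramp_box.
rewrite integral_below_density; last exact: measurable_box.
apply: eq_integral => x _.
under eq_integral do rewrite indic_box_replace mulrA EFinM.
rewrite ge0_integralZr//.
- by rewrite ramp_indicE -!EFinM mulrC.
- by apply/measurable_EFinP; apply: measurable_funM.
- by rewrite lee_fin; have /andP[] := side01 x.
Qed.
End box.

End nonneg.

Variables (w w' : 'rV[R]_d -> R).
Hypothesis iw : m.-integrable setT (EFin \o w).
Hypothesis iw' : m.-integrable setT (EFin \o w').
Hypothesis ww' : forall h, product_test h ->
  \int[m]_x (partial j h x * w x) = - \int[m]_x (h x * w' x).

Let iposneg (v : 'rV[R]_d -> R) : m.-integrable setT (EFin \o v) ->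
  m.-integrable setT (EFin \o v^\+) /\ m.-integrable setT (EFin \o v^\-).
Proof.
by move=> iv; split; [exact: integrable_funrpos|exact: integrable_funrneg].
Qed.

(** With the negative parts moved across, each side is a sum of two positive measures that is finite
    on boxes. [weak_derivative_box] says that they agree on boxes, hence they agree on all
    measurable sets. *)
Lemma weak_derivative_measure (A : set 'rV[R]_d) : measurable A ->
  (\int[m]_(x in A) ((w^\+)%R x)%:E +
   \int[m \x leb]_(z in replace j @^-1` A) below_density (w'^\+)%R z =
   \int[m]_(x in A) ((w^\-)%R x)%:E +
   \int[m \x leb]_(z in replace j @^-1` A) below_density (w'^\-)%R z)%E.
Proof.
have [iwp iwn] := iposneg iw.
have [iwp' iwn'] := iposneg iw'.
have p0 (v : 'rV[R]_d -> R) x : (0 <= ((v^\+)%R x)%:E)%E by rewrite lee_fin funrpos_ge0.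
have n0 (v : 'rV[R]_d -> R) x : (0 <= ((v^\-)%R x)%:E)%E by rewrite lee_fin funrneg_ge0.
pose m1 := measure_add (density m (measurable_int _ iwp) (p0 w))
  (below_measure iwp' (funrpos_ge0 w')).
pose m2 := measure_add (density m (measurable_int _ iwn) (n0 w))
  (below_measure iwn' (funrneg_ge0 w')).
have m1E p q : m1 (box p q) = (\int[m]_x (\1_(`]p j, q j[ : set R) (x ord0 j) *
    (\prod_(i | i != j) \1_(`]p i, q i[ : set R) (x ord0 i)) * w^\+ x) +
   \int[m]_x (ramp (\1_(`]p j, q j[ : set R)) (x ord0 j) *
    (\prod_(i | i != j) \1_(`]p i, q i[ : set R) (x ord0 i)) * w'^\+ x))%:E.
  rewrite /m1 measure_addE EFinD -(integral_box iwp).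
  by rewrite -(integral_below_density_box iwp' (funrpos_ge0 w')).
have m2E p q : m2 (box p q) = (\int[m]_x (\1_(`]p j, q j[ : set R) (x ord0 j) *
    (\prod_(i | i != j) \1_(`]p i, q i[ : set R) (x ord0 i)) * w^\- x) +
   \int[m]_x (ramp (\1_(`]p j, q j[ : set R)) (x ord0 j) *
    (\prod_(i | i != j) \1_(`]p i, q i[ : set R) (x ord0 i)) * w'^\- x))%:E.
  rewrite /m2 measure_addE EFinD -(integral_box iwn).
  by rewrite -(integral_below_density_box iwn' (funrneg_ge0 w')).
move=> mA; suff : m1 A = m2 A by rewrite /m1 /m2 !measure_addE.
apply: measure_rV_unique mA => p q; last first.
  suff : (m1 (box p q) < +oo)%E by [].
  by rewrite m1E ltry.
suff : m1 (box p q) = m2 (box p q) by [].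
rewrite m1E m2E; congr EFin.
have := weak_derivative_box iw iw' ww' p q.
under eq_Rintegral do rewrite (funrposBnegE w) mulrBr.
under [in X in _ = - X -> _]eq_Rintegral do rewrite (funrposBnegE w') mulrBr.
have i1 := integrable_box iwp p q.
have i2 := integrable_box iwn p q.
have i3 := integrable_ramp_box iwp' p q.
have i4 := integrable_ramp_box iwn' p q.
rewrite RintegralB// RintegralB// => h.
lra.
Qed.

End weak_derivative_measure.

(** * Absolute continuity *)

Lemma ge0_integral_eq0 d (T : measurableType d) (R : realType)
    (mu : {measure set T -> \bar R}) (f : T -> \bar R) :
  measurable_fun setT f -> (forall x, 0 <= f x)%E -> (\int[mu]_x f x = 0)%E ->
  {ae mu, forall x, f x = 0%E}.
Proof.
move=> mf f0 If.
have /(ae_eq_integral_abs mu measurableT mf) : (\int[mu]_x `|f x| = 0)%E.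
  by rewrite -[RHS]If; apply: eq_integral => x _; rewrite gee0_abs.
by apply: filterS => x /(_ I).
Qed.

Lemma ae_null d (T : measurableType d) (R : realType)
    (mu : {measure set T -> \bar R}) (A : set T) :
  measurable A -> {ae mu, forall x, ~ A x} -> mu A = 0%E.
Proof.
move=> mA [B [mB B0 AB]]; apply/eqP; rewrite eq_le measure_ge0 andbT -B0.
by apply: le_measure; rewrite ?inE// => x Ax; apply: AB => /=; exact.
Qed.

Section slice.
Context {R : realType} {d : nat}.
Local Notation leb := (@lebesgue_measure R).

Definition slice (j : 'I_d) (B : set 'rV[R]_d) (x : 'rV[R]_d) : \bar R :=
  leb [set s | B (replace j (x, s))].

(* [slice j B x] is the length of the section of [B] by the line through [x] in
   direction [j]. *)
Definition fat_slices j B : set 'rV[R]_d := [set x | slice j B x != 0%E].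

Lemma measurable_slice j B : measurable B -> measurable_fun setT (slice j B).
Proof.
move=> mB; have mr : measurable (replace j @^-1` B).
  by rewrite -[X in measurable X]setTI; exact: measurable_replace.
have := measurable_fun_xsection (@lebesgue_measure R) mr.
congr measurable_fun; apply/funext => x /=; congr leb.
by apply/seteqP; split => s; rewrite /xsection/= inE.
Qed.

Lemma measurable_fat_slices j B : measurable B -> measurable (fat_slices j B).
Proof.
move=> mB; rewrite (_ : fat_slices j B = ~` (slice j B @^-1` [set 0%E])).
  apply: measurableC; rewrite -[X in measurable X]setTI.
  exact: measurable_slice.
by apply/seteqP; split => x /= => [/eqP|h]; last exact/eqP.
Qed.

End slice.

Section null_ideal.
Context {R : realType}.
Local Notation leb := (@lebesgue_measure R).

Let tail n (x : 'rV[R]_n.+1) : 'rV[R]_n := \row_k x ord0 (lift ord0 k).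

Let measurable_tail n (N : set 'rV[R]_n) : measurable N ->
  measurable (@tail n @^-1` N).
Proof.
move=> mN; rewrite -[X in measurable X]setTI.
suff : measurable_fun setT (@tail n) by apply.
apply/measurable_fun_rVP => i; under eq_fun do rewrite mxE.
exact: measurable_rV_coord.
Qed.

Let slice_tail n (N : set 'rV[R]_n) j x :
  slice (lift ord0 j) (@tail n @^-1` N) x = slice j N (tail x).
Proof.
rewrite /slice; congr leb.
suff H s : tail (replace (lift ord0 j) (x, s)) = replace j (tail x, s).
  by apply/seteqP; split => s /=; rewrite H.
by apply/rowP => k; rewrite !mxE/= (inj_eq lift_inj).
Qed.

Let slice_head n (B : set 'rV[R]_n.+1) x :
  slice ord0 B x = leb [set s | B (insert ord0 (s, tail x))].
Proof.
rewrite /slice; congr leb.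
suff H s : replace ord0 (x, s) = insert ord0 (s, tail x).
  by apply/seteqP; split => s /=; rewrite H.
apply/rowP => k; rewrite replaceE; have [i ->|->] := unliftP ord0 k.
  by rewrite insert_lift mxE.
by rewrite insert_same.
Qed.

(* By induction on the dimension: the tails of the fat slices of [B] in the
   first direction form a null set. *)
Lemma null_ideal d (I : set (set 'rV[R]_d)) : I set0 ->
  (forall j B, measurable B -> I (fat_slices j B) -> I B) ->
  forall B, measurable B -> lam B = 0%E -> I B.
Proof.
elim: d I => [|n IH] I I0 Ifat B mB B0.
  suff -> : B = set0 by [].
  rewrite -subset0 => x Bx.
  (* In dimension 0 the measure is a unit mass at the only point, so a null set is empty. *)
  have := B0; rewrite /lam /= diracE (_ : 0 \in B).
    by move=> /eqP; rewrite onee_eq0.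
  by rewrite inE (_ : 0 = x)//; apply/rowP; case.
apply: (Ifat ord0) => //.
pose N : set 'rV[R]_n := [set y | leb [set s | B (insert ord0 (s, y))] != 0%E].
have -> : fat_slices ord0 B = @tail n @^-1` N.
  by apply/seteqP; split => x; rewrite /fat_slices/= slice_head.
have mi : measurable (insert ord0 @^-1` B).
  by rewrite -[X in measurable X]setTI; exact: measurable_insert.
have ms : measurable_fun setT (fun y => leb [set s | B (insert ord0 (s, y))]).
  have := measurable_fun_ysection (@lebesgue_measure R) mi.
  congr measurable_fun; apply/funext => x /=; congr leb.
  by apply/seteqP; split => s; rewrite /ysection/= inE.
have mN : measurable N.
  rewrite (_ : N = ~` ((fun y => leb [set s | B (insert ord0 (s, y))]) @^-1` [set 0%E])).
    by apply: measurableC; rewrite -[X in measurable X]setTI; exact: ms.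
  by apply/seteqP; split => x /= => [/eqP|h]; last exact/eqP.
(* Slicing [tail @^-1 M] in a later direction amounts to slicing [M], so the sets [M] whose preimage
   lies in [I] satisfy the same closure property in one dimension less. *)
apply: (IH (fun M => I (@tail n @^-1` M))) => //.
- move=> j M mM; rewrite (_ : _ @^-1` fat_slices j M = fat_slices (lift ord0 j) (@tail n @^-1` M)).
    by apply: Ifat; exact: measurable_tail.
  by apply/seteqP; split => x; rewrite /fat_slices/= slice_tail.
apply: ae_null => //.
have : (\int[@lam R n]_y leb [set s | B (insert ord0 (s, y))] = 0)%E.
  rewrite -[RHS]B0 (lam_insert ord0 mB).
  rewrite (product_measure_unique (m' := (leb \x^ @lam R n)%E))//; last first.
    (* The product is taken in the order that integrates the slices over the remaining coordinates:
       the lengths integrate to the measure of [B], which is 0. *)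
    move=> A1 A2 mA1 mA2; exact: (product_measure2E _ _ mA1 mA2).
  rewrite /product_measure2; apply: eq_integral => y _ /=; congr leb.
  by apply/seteqP; split => s; rewrite /ysection/= inE.
move=> /ge0_integral_eq0 h; apply: filterS (h _ _) => //.
by move=> y h0; rewrite /N /= h0 eqxx.
Qed.

End null_ideal.

Section absolute_continuity.
Context {R : realType} {d : nat}.
Local Notation leb := (@lebesgue_measure R).
Variables (mu : {finite_measure set 'rV[R]_d -> \bar R}).
Variable rho : 'I_d -> 'rV[R]_d -> R.
Hypothesis mu_rho : forall i, measure_partial mu i (rho i).

Let itg_one : mu.-integrable setT (EFin \o (fun=> 1 : R)).
Proof. exact: finite_measure_integrable_cst. Qed.

(** With the weight 1, [weak_derivative_measure] reads: [mu B] plus a nonnegative term in the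
    positive part of [rho j] equals a term in its negative part. The latter is an integral over
    [replace j @^-1 B], which is null for [mu \x leb] when almost every slice is null. *)
Let fat_slices_null j B : measurable B ->
  mu (fat_slices j B) = 0%E -> mu B = 0%E.
Proof.
move=> mB fat0; have [irho Irho] := mu_rho j.
have ww' h : product_test h ->
    \int[mu]_x (partial j h x * 1) = - \int[mu]_x (h x * rho j x).
  by move=> th; rewrite -(Irho _ (product_testW th)); apply: eq_Rintegral => x _; rewrite mulr1.
have := weak_derivative_measure itg_one irho ww' mB.
have -> : (\int[mu]_(x in B) ((fun=> 1 : R)^\+%R x)%:E = mu B)%E.
  rewrite -[RHS]mul1e -integral_cst//; apply: eq_integral => x _.
  by rewrite /funrpos/= max_l.
have -> : (\int[mu]_(x in B) ((fun=> 1 : R)^\-%R x)%:E = 0)%E.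
  by rewrite integral0_eq// => x _; rewrite /funrneg max_r// oppr_le0.
have irn := integrable_funrneg measurableT irho; rewrite add0e.
have -> : (\int[mu \x leb]_(z in replace j @^-1` B) below_density j ((rho j)^\-)%R z = 0)%E.
  have mr : measurable (replace j @^-1` B).
    by rewrite -[X in measurable X]setTI; exact: measurable_replace.
  apply: null_set_integral => //.
    by apply: measurable_funTS; exact: (measurable_below_density j irn).
  have <- : (\int[mu]_x slice j B x = 0)%E.
    rewrite -(integral0 mu setT); apply: ae_eq_integral => //.
      exact: measurable_slice.
    exists (fat_slices j B); split => //; first exact: measurable_fat_slices.
    by move=> x /= h; apply/eqP => h'; apply: h => _.
  rewrite /product_measure1; apply: eq_integral => x _ /=; congr leb.
  by apply/seteqP; split => s; rewrite /xsection/= inE.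
move=> muB; apply/eqP; rewrite eq_le measure_ge0 andbT -[leRHS]muB leeDl//.
by apply: integral_ge0 => z _; apply: below_density_ge0 => x; exact: funrpos_ge0.
Qed.

Lemma measure_partial_dominated : mu `<< @lam R d.
Proof.
apply/null_content_dominatesP => A mA A0.
exact: (null_ideal (I := fun B => mu B = 0%E) (measure0 mu) fat_slices_null mA A0).
Qed.

End absolute_continuity.

(** * Integrals under a dominated measure through its real-valued density *)

Section density_function.
Context {R : realType} d (T : measurableType d).
Variables (nu : {finite_measure set T -> \bar R})
  (mu : {sigma_finite_measure set T -> \bar R}).
Hypothesis numu : nu `<< mu.

Definition rn_density (x : T) : R := fine (Radon_Nikodym_SigmaFinite.f nu mu x).

Let F := Radon_Nikodym_SigmaFinite.f nu mu.

Let FE x : (rn_density x)%:E = F x.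
Proof. by rewrite fineK//; exact: Radon_Nikodym_SigmaFinite.f_fin_num. Qed.

Lemma integrable_rn_density : mu.-integrable setT (EFin \o rn_density).
Proof.
rewrite (_ : EFin \o _ = F); last by apply/funext => x /=; exact: FE.
exact: Radon_Nikodym_SigmaFinite.f_integrable.
Qed.

Let mf : measurable_fun setT rn_density.
Proof. by apply/measurable_EFinP; exact: measurable_int integrable_rn_density. Qed.

Lemma integrable_rn_densityM (g : T -> R) : nu.-integrable setT (EFin \o g) ->
  mu.-integrable setT (EFin \o (fun x => g x * rn_density x)).
Proof.
move=> ig.
have mg : measurable_fun setT g by apply/measurable_EFinP; exact: measurable_int ig.
have := Radon_Nikodym_SigmaFinite.integrableM numu
  (f := abse \o (EFin \o g)) (fun x => abse_ge0 _) measurableT (integrable_abse ig).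
apply: le_integrable => //.
  by apply/measurable_EFinP; exact: measurable_funM.
move=> x _; rewrite -/F -FE (_ : (abse \o (EFin \o g)) x = `|g x|%:E)//.
by rewrite -EFinM /= lee_fin !normrM normr_id.
Qed.

Let ge0_integral_rn (g : T -> R) : nu.-integrable setT (EFin \o g) ->
  (forall x, 0 <= g x) ->
  \int[mu]_x (g x * rn_density x) = \int[nu]_x g x.
Proof.
move=> ig g0; rewrite /Rintegral; congr fine.
rewrite -(Radon_Nikodym_SigmaFinite.change_of_variables numu
  (f := EFin \o g) (E := setT))//.
- by apply: eq_integral => x _; rewrite EFinM /= FE.
- exact: measurable_int ig.
Qed.

Lemma Rintegral_rn_density (g : T -> R) : nu.-integrable setT (EFin \o g) ->
  \int[mu]_x (g x * rn_density x) = \int[nu]_x g x.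
Proof.
move=> ig.
have ip : nu.-integrable setT (EFin \o g^\+) by exact: integrable_funrpos.
have im : nu.-integrable setT (EFin \o g^\-) by exact: integrable_funrneg.
have gE x : g x = g^\+ x - g^\- x by rewrite -[g in LHS]funrposBneg.
under eq_Rintegral do rewrite gE mulrBl.
under [RHS]eq_Rintegral do rewrite gE.
rewrite RintegralB//; [|exact: integrable_rn_densityM|exact: integrable_rn_densityM].
by rewrite RintegralB// !ge0_integral_rn.
Qed.

End density_function.

(** * Integration by parts on lines *)

Section lines.
Context {R : realType} {n : nat}.
Variable j : 'I_n.+1.
Local Notation leb := (@lebesgue_measure R).
Local Notation lm := (@lam R n.+1).

Lemma replace_insert (r s : R) (y : 'rV[R]_n) :
  replace j (insert j (r, y), s) = insert j (s, y).
Proof.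
apply/rowP => k; rewrite replaceE; have [i ->|->] := unliftP j k.
  by rewrite eq_sym (negbTE (neq_lift _ _)) !insert_lift.
by rewrite eqxx insert_same.
Qed.

Lemma measurable_insert_line (y : 'rV[R]_n) :
  measurable_fun setT (fun s : measurableTypeR R => insert j (s, y)).
Proof. exact: (measurableT_comp (measurable_insert j) (measurable_pair2 y)). Qed.

Lemma ge0_integral_lam_insert (f : 'rV[R]_n.+1 -> \bar R) :
  measurable_fun setT f -> (forall x, 0 <= f x)%E ->
  (\int[lm]_x f x = \int[@lam R n]_y \int[leb]_s f (insert j (s, y)))%E.
Proof.
move=> mf f0.
rewrite (eq_measure_integral (pushforward (leb \x @lam R n)%E (insert j))); last first.
  by move=> A mA _; exact: lam_insert.
rewrite ge0_integral_pushforward//.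
rewrite preimage_setT fubini_tonelli2//; last by move=> z; exact: f0.
exact: (measurableT_comp mf (measurable_insert j)).
Qed.

(** Tonelli's theorem for the indicator of a null set: almost every line meets the exceptional set
    in a null set. *)
Lemma ae_lam_insert (P : 'rV[R]_n.+1 -> Prop) :
  {ae lm, forall x, P x} ->
  {ae @lam R n, forall y, {ae leb, forall s, P (insert j (s, y))}}.
Proof.
move=> [N [mN N0 PN]].
have mi : measurable (insert j @^-1` N).
  by rewrite -[X in measurable X]setTI; exact: measurable_insert.
have := ge0_integral_lam_insert (f := EFin \o \1_N) _ _.
rewrite integral_indic//= setIT N0 => H.
have {}H : (\int[@lam R n]_y \int[leb]_s (\1_N (insert j (s, y)))%:E = 0)%E.
  apply/esym; apply: H; first exact/measurable_EFinP.
  by move=> x; rewrite lee_fin.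
have mF : measurable_fun setT (fun y => \int[leb]_s (\1_N (insert j (s, y)))%:E)%E.
  apply: (measurable_fun_fubini_tonelli_G (m1 := @lebesgue_measure R)
    (fun z => (\1_N (insert j z))%:E)).
    apply/measurable_EFinP.
    exact: (measurableT_comp (measurable_indic mN) (measurable_insert j)).
  by move=> z; rewrite lee_fin.
apply: filterS (ge0_integral_eq0 mF _ H) => y; last first.
  by apply: integral_ge0 => s _; rewrite lee_fin.
have ml : measurable [set s | N (insert j (s, y))].
  by rewrite -[X in measurable X]setTI; exact: measurable_insert_line.
move=> Hy; exists [set s | N (insert j (s, y))]; split => //.
  by rewrite -[RHS]Hy -[LHS]/(leb _) -[X in leb X]setIT -integral_indic.
by move=> s /= Ps; apply: PN.
Qed.

Lemma integrable_lam_insert (f : 'rV[R]_n.+1 -> R) :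
  lm.-integrable setT (EFin \o f) ->
  (leb \x @lam R n)%E.-integrable setT (fun z => (f (insert j z))%:E).
Proof.
move=> /integrableP[mf lf]; apply/integrableP; split.
  exact: (measurableT_comp mf (measurable_insert j)).
rewrite fubini_tonelli2//.
  rewrite ge0_integral_lam_insert in lf => //.
  exact: measurableT_comp.
by apply: measurableT_comp => //; exact: (measurableT_comp mf (measurable_insert j)).
Qed.

Lemma integral_lam_insert (f : 'rV[R]_n.+1 -> R) :
  lm.-integrable setT (EFin \o f) ->
  (\int[lm]_x (f x)%:E = \int[@lam R n]_y \int[leb]_s (f (insert j (s, y)))%:E)%E.
Proof.
move=> itf; have itfi := integrable_lam_insert itf.
rewrite (eq_measure_integral (pushforward (leb \x @lam R n)%E (insert j))); last first.
  by move=> A mA _; exact: lam_insert.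
rewrite integral_pushforward//; last exact: measurable_int itf.
by rewrite preimage_setT -integral21_prod_meas1.
Qed.

Lemma ae_integrable_line (f : 'rV[R]_n.+1 -> R) :
  lm.-integrable setT (EFin \o f) ->
  {ae @lam R n, forall y,
    leb.-integrable setT (EFin \o (fun s => f (insert j (s, y))))}.
Proof. by move=> /integrable_lam_insert; exact: ae_integrable2. Qed.

Section weak.
Variables (G G' : 'rV[R]_n.+1 -> R).
Hypothesis iG : lm.-integrable setT (EFin \o G).
Hypothesis iG' : lm.-integrable setT (EFin \o G').
Hypothesis GG' : forall h, product_test h ->
  \int[lm]_x (partial j h x * G x) = - \int[lm]_x (h x * G' x).

(** Extended real values are kept, since an integrable [v] may have an infinite integral on
    exceptional lines. *)
Definition tail_integral (v : 'rV[R]_n.+1 -> R) (x : 'rV[R]_n.+1) : \bar R :=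
  (\int[leb]_r (v (replace j (x, r)) * \1_(`[x ord0 j, +oo[ : set R) r)%:E)%E.

Section tail.
Variable v : 'rV[R]_n.+1 -> R.
Hypothesis iv : lm.-integrable setT (EFin \o v).
Hypothesis v0 : forall x, 0 <= v x.

Let mv : measurable_fun setT v.
Proof. by apply/measurable_EFinP; exact: measurable_int iv. Qed.

Let above : set ('rV[R]_n.+1 * measurableTypeR R) :=
  [set z : 'rV[R]_n.+1 * R | z.1 ord0 j <= z.2].

Let measurable_above : measurable above.
Proof.
rewrite (_ : above = (fun z : 'rV[R]_n.+1 * R => z.2 - z.1 ord0 j) @^-1` `[0, +oo[%classic).
  rewrite -[X in measurable X]setTI.
  have : measurable_fun setT
      (fun z : 'rV[R]_n.+1 * measurableTypeR R => z.2 - z.1 ord0 j).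
    apply: measurable_funB; first exact: measurable_snd.
    exact: (measurableT_comp (@measurable_rV_coord _ R n.+1 j) measurable_fst).
  by apply.
by apply/seteqP; split => z /=; rewrite in_itv/= andbT subr_ge0.
Qed.

Let aboveE (x : 'rV[R]_n.+1) (r : R) :
  \1_above (x, r) = \1_(`[x ord0 j, +oo[ : set R) r :> R.
Proof.
rewrite !indicE; congr ((nat_of_bool _)%:R); apply/idP/idP => /set_mem h;
  by apply/mem_set; move: h; rewrite /above /= in_itv/= andbT.
Qed.

Lemma measurable_tail_integral : measurable_fun setT (tail_integral v).
Proof.
rewrite (_ : tail_integral v = fubini_F leb
   (fun z => (v (replace j z) * \1_above z)%:E)).
  apply: measurable_fun_fubini_tonelli_F => /=.
    apply/measurable_EFinP; apply: measurable_funM.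
      exact: (measurableT_comp mv (measurable_replace j)).
    exact: measurable_indic.
  by move=> z; rewrite lee_fin mulr_ge0.
by apply/funext => x; apply: eq_integral => r _; rewrite aboveE.
Qed.

Lemma tail_integral_ge0 x : (0 <= tail_integral v x)%E.
Proof. by apply: integral_ge0 => r _; rewrite lee_fin mulr_ge0. Qed.

(** Under Lebesgue measure the old and the new value of coordinate [j] are integrated against the
    same measure and can be exchanged. So [below_measure] acquires a density, which is what turns an
    equality of measures into an equality of functions. *)
Lemma integral_tail_integral (B : set 'rV[R]_n.+1) : measurable B ->
  (\int[lm \x leb]_(z in replace j @^-1` B) below_density j v z =
   \int[lm]_(x in B) tail_integral v x)%E.
Proof.
move=> mB.
have mr : measurable (replace j @^-1` B).
  by rewrite -[X in measurable X]setTI; exact: measurable_replace.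
pose K (z : 'rV[R]_n.+1 * measurableTypeR R) : \bar R :=
  (v z.1 * \1_(below j) z * \1_B (replace j z))%:E.
have mK : measurable_fun setT K.
  apply/measurable_EFinP; apply: measurable_funM.
    apply: measurable_funM; first exact: (measurableT_comp mv measurable_fst).
    by apply: measurable_indic; exact: measurable_below.
  exact: (measurableT_comp (measurable_indic mB) (measurable_replace j)).
have K0 z : (0 <= K z)%E by rewrite lee_fin !mulr_ge0.
pose K' (z : 'rV[R]_n.+1 * measurableTypeR R) : \bar R :=
  (v (replace j z) * \1_above z * \1_B z.1)%:E.
have mK' : measurable_fun setT K'.
  apply/measurable_EFinP; apply: measurable_funM.
    apply: measurable_funM; first exact: (measurableT_comp mv (measurable_replace j)).
    exact: measurable_indic.
  exact: (measurableT_comp (measurable_indic mB) measurable_fst).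
have K'0 z : (0 <= K' z)%E by rewrite lee_fin !mulr_ge0.
transitivity (\int[lm \x leb]_z K z)%E.
  rewrite integral_mkcond; apply: eq_integral => z _.
  rewrite patchE /K (indicE _ B) (_ : (replace j z \in B) = (z \in replace j @^-1` B)).
    by case: ifP => _; rewrite ?mulr1 ?mulr0.
  by apply/idP/idP => /set_mem h; apply/mem_set.
have fF f (f0 : forall z : 'rV[R]_n.+1 * measurableTypeR R, (0 <= f z)%E) x :
    (0 <= fubini_F leb f x)%E by apply: integral_ge0.
apply: (etrans (@fubini_tonelli1 _ _ _ _ _ lm leb K mK K0)).
apply: (etrans (@ge0_integral_lam_insert (fubini_F leb K)
  (measurable_fun_fubini_tonelli_F (m2 := @lebesgue_measure R) K mK K0) (fF K K0))).
transitivity (\int[lm]_x fubini_F leb K' x)%E; last first.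
  rewrite [RHS]integral_mkcond; apply: eq_integral => x _; rewrite patchE.
  rewrite /fubini_F /K' /=; case: ifPn => xB.
    apply: eq_integral => r _; rewrite aboveE (indicE _ B) xB mulr1//.
  rewrite integral0_eq// => r _; rewrite (indicE _ B) (negbTE xB) mulr0//.
rewrite [RHS]ge0_integral_lam_insert; last 2 first.
- exact: measurable_fun_fubini_tonelli_F.
- by move=> x; apply: integral_ge0.
apply: eq_integral => y _.
(* The other coordinates [y] are frozen; [z.1] is the old and [z.2] the new value of coordinate
   [j]. *)
pose Q (z : measurableTypeR R * measurableTypeR R) := K (insert j (z.1, y), z.2).
have mQ : measurable_fun setT Q.
  apply: (measurableT_comp mK); apply: measurable_fun_pair; last exact: measurable_snd.
  exact: (measurableT_comp (measurable_insert_line y) measurable_fst).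
have Q0 z : (0 <= Q z)%E by exact: K0.
transitivity (\int[leb]_r fubini_F leb Q r)%E; first by [].
apply: (etrans (esym (@fubini_tonelli1 _ _ _ _ _ leb leb Q mQ Q0))).
apply: (etrans (@fubini_tonelli2 _ _ _ _ _ leb leb Q mQ Q0)).
apply: eq_integral => s _; apply: eq_integral => r _.
rewrite /Q /K /K' /= !replace_insert; congr EFin; congr (_ * _ * _).
rewrite /above !indicE; congr ((nat_of_bool _)%:R); apply/idP/idP => /set_mem h;
  by apply/mem_set; move: h; rewrite /below /= !insert_same.
Qed.

End tail.

Let iposneg (v : 'rV[R]_n.+1 -> R) : lm.-integrable setT (EFin \o v) ->
  lm.-integrable setT (EFin \o v^\+) /\ lm.-integrable setT (EFin \o v^\-).
Proof.
by move=> iv; split; [exact: integrable_funrpos|exact: integrable_funrneg].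
Qed.

(** Integrability is claimed on boxes only: a tail integral need not decay when the coordinate tends
    to minus infinity. On a box its integral is the finite one computed with the ramp. *)
Let integrable_tail p q (u v : 'rV[R]_n.+1 -> R) :
  lm.-integrable setT (EFin \o u) -> (forall x, 0 <= u x) ->
  lm.-integrable setT (EFin \o v) -> (forall x, 0 <= v x) ->
  lm.-integrable (box p q) (fun x => (u x)%:E + tail_integral v x)%E.
Proof.
move=> iu u0 iv v0; have mb := @measurable_box R _ p q.
apply: integrableD => //; first exact: integrableS iu.
apply/integrableP; split.
  by apply: measurable_funTS; exact: measurable_tail_integral.
rewrite (eq_integral (tail_integral v)).
  by rewrite -integral_tail_integral// integral_below_density_box// ltry.
by move=> x _; rewrite gee0_abs// tail_integral_ge0.
Qed.

(** Both sides are integrable on each cube and have equal integrals over all its measurable subsets,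
    hence they agree almost everywhere there; countably many cubes cover the space. *)
Lemma ae_tail_integral : {ae lm, forall x,
  ((G^\+%R x)%:E + tail_integral G'^\+%R x =
   (G^\-%R x)%:E + tail_integral G'^\-%R x)%E}.
Proof.
have [iGp iGn] := iposneg iG.
have [iGp' iGn'] := iposneg iG'.
have p0 (v : 'rV[R]_n.+1 -> R) x : 0 <= v^\+ x by exact: funrpos_ge0.
have n0 (v : 'rV[R]_n.+1 -> R) x : 0 <= v^\- x by exact: funrneg_ge0.
have p0e (v : 'rV[R]_n.+1 -> R) x : (0 <= (EFin \o (v^\+)%R) x)%E by rewrite /= lee_fin.
have n0e (v : 'rV[R]_n.+1 -> R) x : (0 <= (EFin \o (v^\-)%R) x)%E by rewrite /= lee_fin.
have mtp := measurable_tail_integral iGp' (p0 G').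
have mtn := measurable_tail_integral iGn' (n0 G').
have H k : ae_eq lm (box (fun=> - k%:R) (fun=> k%:R))
    (fun x => (G^\+%R x)%:E + tail_integral G'^\+%R x)%E
    (fun x => (G^\-%R x)%:E + tail_integral G'^\-%R x)%E.
  apply: integral_ae_eq.
  - exact: measurable_box.
  - exact: integrable_tail.
  - by have /integrableP[] := @integrable_tail (fun=> - k%:R) (fun=> k%:R) _ _ iGn (n0 G) iGn' (n0 G').
  - move=> B _ mB.
    rewrite (ge0_integralD lm mB (f1 := fun x => ((G^\+)%R x)%:E) (f2 := tail_integral (G'^\+)%R)
      (fun x _ => p0e G x) (measurable_funTS (measurable_int _ iGp))
      (fun x _ => tail_integral_ge0 (p0 G') x) (measurable_funTS mtp)).
    rewrite (ge0_integralD lm mB (f1 := fun x => ((G^\-)%R x)%:E) (f2 := tail_integral (G'^\-)%R)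
      (fun x _ => n0e G x) (measurable_funTS (measurable_int _ iGn))
      (fun x _ => tail_integral_ge0 (n0 G') x) (measurable_funTS mtn)).
    rewrite -!integral_tail_integral//.
    exact: (weak_derivative_measure iG iG' GG' mB).
have {H} := ae_foralln H.
apply: filterS => x H.
have : [set: 'rV[R]_n.+1] x by [].
rewrite -bigcup_box => -[k _ xk]; exact: H xk.
Qed.

(** On almost every line [G'] is integrable, so all tails are finite and the negative parts can be
    moved back. The primitive is the one vanishing at plus infinity. *)
Lemma ae_line : {ae @lam R n, forall y,
  leb.-integrable setT (EFin \o (fun s => G' (insert j (s, y)))) /\
  {ae leb, forall s, G (insert j (s, y)) =
    - \int[leb]_(r in `[s, +oo[) G' (insert j (r, y))}}.
Proof.
apply: filterS2 (ae_integrable_line iG') (ae_lam_insert ae_tail_integral) => y ig.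
move=> H; split=> //; apply: filterS H => s.
have ig' : leb.-integrable `[s, +oo[ (EFin \o (fun r => G' (insert j (r, y)))).
  exact: integrableS ig.
have igp : leb.-integrable `[s, +oo[ (EFin \o (fun r => G' (insert j (r, y)))^\+).
  exact: integrable_funrpos.
have ign : leb.-integrable `[s, +oo[ (EFin \o (fun r => G' (insert j (r, y)))^\-).
  exact: integrable_funrneg.
have tE (v : 'rV[R]_n.+1 -> R) : tail_integral v (insert j (s, y)) =
    (\int[leb]_(r in `[s, +oo[) (v (insert j (r, y)))%:E)%E.
  rewrite [RHS]integral_mkcond; apply: eq_integral => r _.
  rewrite replace_insert insert_same patchE indicE.
  by case: ifP => _; rewrite ?mulr1 ?mulr0.
rewrite !tE.
have Ep : (\int[leb]_(r in `[s, +oo[) ((G'^\+)%R (insert j (r, y)))%:E)%E =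
   (\int[leb]_(r in `[s, +oo[) ((fun r => G' (insert j (r, y)))^\+)%R r)%:E.
  by rewrite /Rintegral fineK//; exact: integrable_fin_num.
have En : (\int[leb]_(r in `[s, +oo[) ((G'^\-)%R (insert j (r, y)))%:E)%E =
   (\int[leb]_(r in `[s, +oo[) ((fun r => G' (insert j (r, y)))^\-)%R r)%:E.
  by rewrite /Rintegral fineK//; exact: integrable_fin_num.
have aux (a b p m : R) : a + p = b + m -> a - b = - (p - m) by move=> h; lra.
rewrite Ep En -!EFinD => -[H].
have -> : G (insert j (s, y)) = G^\+ (insert j (s, y)) - G^\- (insert j (s, y)).
  exact: funrposBnegE.
have -> : \int[leb]_(r in `[s, +oo[) G' (insert j (r, y)) =
   \int[leb]_(r in `[s, +oo[) ((fun r => G' (insert j (r, y)))^\+) r -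
   \int[leb]_(r in `[s, +oo[) ((fun r => G' (insert j (r, y)))^\-) r.
  rewrite -RintegralB//; apply: eq_Rintegral => r _.
  exact: (funrposBnegE (fun r => G' (insert j (r, y)))).
exact: aux H.
Qed.

End weak.
End lines.

(** * Integration by parts for two primitives on one line *)

Section line.
Context {R : realType}.
Local Notation leb := (@lebesgue_measure R).
Variables (f f' g g' : R -> R).
Hypotheses (mf : measurable_fun setT f) (mg : measurable_fun setT g).
Hypotheses (if' : leb.-integrable setT (EFin \o f'))
  (ig' : leb.-integrable setT (EFin \o g')).
Hypothesis ff' : {ae leb, forall s, f s = - \int[leb]_(r in `[s, +oo[) f' r}.
Hypothesis gg' : {ae leb, forall s, g s = - \int[leb]_(r in `[s, +oo[) g' r}.
Hypothesis g'0 : \int[leb]_r g' r = 0.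

Let mf' : measurable_fun setT f'.
Proof. by apply/measurable_EFinP; exact: measurable_int if'. Qed.

Let mg' : measurable_fun setT g'.
Proof. by apply/measurable_EFinP; exact: measurable_int ig'. Qed.

Let D : set (measurableTypeR R * measurableTypeR R) := [set z : R * R | z.1 <= z.2].

Let measurable_D : measurable D.
Proof.
rewrite (_ : D = (fun z : R * R => z.2 - z.1) @^-1` `[0, +oo[%classic).
  rewrite -[X in measurable X]setTI.
  have : measurable_fun setT (fun z : measurableTypeR R * measurableTypeR R => z.2 - z.1).
    by apply: measurable_funB; [exact: measurable_snd|exact: measurable_fst].
  by apply.
by apply/seteqP; split => z /=; rewrite in_itv/= andbT subr_ge0.
Qed.

Let DE1 (s r : R) : \1_D (s, r) = \1_(`[s, +oo[ : set R) r :> R.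
Proof.
rewrite !indicE; congr ((nat_of_bool _)%:R); apply/idP/idP => /set_mem h;
  by apply/mem_set; move: h; rewrite /D /= in_itv/= andbT.
Qed.

Let DE2 (s r : R) : \1_D (s, r) = \1_(`]-oo, r] : set R) s :> R.
Proof.
rewrite !indicE; congr ((nat_of_bool _)%:R); apply/idP/idP => /set_mem h;
  by apply/mem_set; move: h; rewrite /D /= in_itv/=.
Qed.

Let Q (z : measurableTypeR R * measurableTypeR R) : \bar R :=
  (g' z.1 * f' z.2 * \1_D z)%:E.

Let mQ : measurable_fun setT Q.
Proof.
apply/measurable_EFinP; apply: measurable_funM; last exact: measurable_indic.
by apply: measurable_funM; [exact: (measurableT_comp mg' measurable_fst)|
  exact: (measurableT_comp mf' measurable_snd)].
Qed.

Let iQ : (leb \x leb)%E.-integrable setT Q.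
Proof.
apply/(integrable12ltyP _ _ mQ).
have := integrableP _ _ _ ig' => -[_]; have := integrableP _ _ _ if' => -[mif' lf' lg'].
apply: (@le_lt_trans _ _ (\int[leb]_s (`|(EFin \o g') s| * \int[leb]_r `|(EFin \o f') r|))%E).
  apply: ge0_le_integral => //.
  - by move=> s _; apply: integral_ge0.
  - have mAQ : measurable_fun setT (abse \o Q) by exact: measurableT_comp.
    exact: (measurable_fun_fubini_tonelli_F (m2 := @lebesgue_measure R) (abse \o Q) mAQ (fun z => abse_ge0 _)).
  - apply: emeasurable_funM => //; apply: measurableT_comp => //; exact: measurable_int ig'.
  - move=> s _; rewrite -ge0_integralZl//; last exact: measurableT_comp.
    apply: ge0_le_integral => //.
    + by apply: measurableT_comp => //; exact: (measurableT_comp mQ (measurable_pair1 s)).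
    + by apply: emeasurable_funM => //; exact: measurableT_comp.
    + move=> r _; rewrite /Q /= -EFinM lee_fin !normrM -[leRHS]mulr1.
      by rewrite ler_wpM2l// norm_indic_le1.
rewrite ge0_integralZr//; last 2 first.
- by apply: measurableT_comp => //; exact: measurable_int ig'.
- exact: integral_ge0.
by apply: lte_mul_pinfty => //; [exact: integral_ge0|rewrite ge0_fin_numE// integral_ge0].
Qed.

Let EFinRint (h : R -> R) (A : set R) : measurable A -> leb.-integrable setT (EFin \o h) ->
  (\int[leb]_(r in A) (h r)%:E = (\int[leb]_(r in A) h r)%:E)%E.
Proof.
move=> mA ih; rewrite /Rintegral fineK//.
by apply: integrable_fin_num => //; exact: integrableS ih.
Qed.

Let inner (c : R) (h : R -> R) (A : set R) : measurable A ->
  leb.-integrable setT (EFin \o h) ->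
  (\int[leb]_r (c * h r * \1_A r)%:E = (c * \int[leb]_(r in A) h r)%:E)%E.
Proof.
move=> mA ih; rewrite EFinM -EFinRint// -integralZl//; last exact: integrableS ih.
rewrite [RHS]integral_mkcond; apply: eq_integral => r _.
by rewrite patchE indicE; case: ifP => _; rewrite ?mulr1 ?mulr0.
Qed.

(** Both sides are the double integral of [g' s * f' r] over [s <= r]. Integrating in [r] first
    gives [- f s]. Integrating in [s] first gives the integral of [g'] up to [r], which is [g r]
    because [g'] has total integral 0. *)
Lemma line_integration_by_parts :
  (\int[leb]_s (- (g' s * f s))%:E = \int[leb]_s (g s * f' s)%:E)%E.
Proof.
transitivity (\int[leb]_s fubini_F leb Q s)%E.
  apply/esym; apply: ae_eq_integral => //.
  - exact: measurable_fubini_F iQ.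
  - by apply/measurable_EFinP; apply: measurableT_comp => //; exact: measurable_funM.
  - have := ff'; apply: filterS; first exact: (ae_filter_ringOfSetsType leb).
    move=> s fs _; rewrite fs /fubini_F /Q.
    under eq_integral do rewrite DE1.
    by rewrite mulrN opprK; apply: (inner (g' s) (measurable_itv _) if').
rewrite integral12_prod_meas1// -integral21_prod_meas1//.
apply: ae_eq_integral => //.
- exact: measurable_fubini_G iQ.
- by apply/measurable_EFinP; exact: measurable_funM.
- have := gg'; apply: filterS; first exact: (ae_filter_ringOfSetsType leb).
  move=> r gr _; rewrite gr /fubini_G /Q.
  under eq_integral do rewrite DE2 (mulrC (g' _)).
  rewrite /= inner//; congr EFin; rewrite mulrC; congr (_ * _).
  have := @Rintegral_itvB R g' -oo%O +oo%O r.
  rewrite set_itvNyy => /(_ ig' isT isT).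
  rewrite g'0 sub0r Rintegral_itv_obnd_cbnd; last exact: integrableS ig'.
  by move=> <-; rewrite opprK.
Qed.

End line.

(** The interval []a - 1, a[] has length 1 and so cannot lie in a null set. This provides a point
    that is both to the left of a support and good for the formula of [ae_line]. *)
Lemma ae_witness {R : realType} (P : R -> Prop) (a : R) :
  {ae @lebesgue_measure R, forall s, P s} -> exists2 s, s < a & P s.
Proof.
move=> [N [mN N0 PN]]; apply: contrapT => h.
have sub : `]a - 1, a[%classic `<=` N.
  by move=> s /=; rewrite in_itv/= => /andP[_ sa]; apply: PN => /= Ps; apply: h; exists s.
have : lebesgue_measure (`]a - 1, a[%classic : set R) = 0%E.
  by apply: (@subset_measure0 _ _ _ (@lebesgue_measure R) _ N) => //; exact: measurable_itv.
rewrite lebesgue_measure_itv/= lte_fin ltrBlDr ltrDl ltr01.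
by rewrite -EFinD opprB addrC subrK => /eqP; rewrite eqe oner_eq0.
Qed.

Section global.
Context {R : realType} {n : nat}.
Variable j : 'I_n.+1.
Local Notation leb := (@lebesgue_measure R).
Local Notation lm := (@lam R n.+1).
Variables (G G' f f' : 'rV[R]_n.+1 -> R).
Hypotheses (iG : lm.-integrable setT (EFin \o G))
  (iG' : lm.-integrable setT (EFin \o G'))
  (itf : lm.-integrable setT (EFin \o f))
  (itf' : lm.-integrable setT (EFin \o f')).
Hypothesis GG' : forall h, product_test h ->
  \int[lm]_x (partial j h x * G x) = - \int[lm]_x (h x * G' x).
Hypothesis ff' : forall h, product_test h ->
  \int[lm]_x (partial j h x * f x) = - \int[lm]_x (h x * f' x).
Hypotheses (iG'f : lm.-integrable setT (EFin \o (fun x => G' x * f x)))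
  (iGf' : lm.-integrable setT (EFin \o (fun x => G x * f' x))).
Variable M : R.
Hypothesis GM : forall x : 'rV[R]_n.+1, x ord0 j < M -> G x = 0 /\ G' x = 0.

Let meas_line (h : 'rV[R]_n.+1 -> R) y : lm.-integrable setT (EFin \o h) ->
  measurable_fun setT (fun s => h (insert j (s, y))).
Proof.
move=> ih; apply/measurable_EFinP.
exact: (measurableT_comp (measurable_int _ ih) (measurable_insert_line j y)).
Qed.

Lemma integration_by_parts_lam :
  \int[lm]_x (G' x * f x) = - \int[lm]_x (G x * f' x).
Proof.
have key : (\int[lm]_x (- (G' x * f x))%:E = \int[lm]_x (G x * f' x)%:E)%E.
  have iN : lm.-integrable setT (EFin \o (fun x => - (G' x * f x))).
    by have := integrableN iG'f; apply: eq_integrable.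
  rewrite (integral_lam_insert j iN) (integral_lam_insert j iGf').
  apply: ae_eq_integral => //.
  - exact: (measurable_fubini_G (integrable_lam_insert j iN)).
  - exact: (measurable_fubini_G (integrable_lam_insert j iGf')).
  apply: filterS2 (ae_line iG iG' GG') (ae_line itf itf' ff') => y [ig' gg'] [if' fline] _.
  apply: (line_integration_by_parts (meas_line y itf) (meas_line y iG) if' ig' fline gg').
  (* At this [s] the function [G] vanishes and is also minus the tail of [G']; as [G'] vanishes
     before [s], that tail is the total integral, which is therefore 0. *)
  have [s sM gs] := ae_witness M gg'.
  have [G0 _] : G (insert j (s, y)) = 0 /\ G' (insert j (s, y)) = 0.
    by apply: GM; rewrite insert_same.
  move: gs; rewrite G0 => /esym/eqP; rewrite oppr_eq0 => /eqP.
  rewrite Rintegral_mkcond => <-; congr Rintegral; apply/funext => r.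
  rewrite patchE; case: ifPn => //; rewrite notin_setE/= in_itv/= andbT => /negP.
  rewrite -ltNge => rs; have [_ ->//] : G (insert j (r, y)) = 0 /\ G' (insert j (r, y)) = 0.
  by apply: GM; rewrite insert_same (lt_trans rs).
have <- : \int[lm]_x (- (G' x * f x)) = \int[lm]_x (G x * f' x).
  by rewrite /Rintegral key.
under [in RHS]eq_Rintegral do rewrite -mulN1r.
by rewrite RintegralZl// mulN1r opprK.
Qed.

End global.

(** * Integration by parts under a measure *)

Section support1.
Context {R : realType}.
Variables (b : R -> R) (p q : R).
Hypothesis b0 : forall s, ~~ (p < s < q) -> b s = 0.

Lemma continuous_support_bounded : continuous b ->
  exists2 C, 0 <= C & forall s, `|b s| <= C.
Proof.
move=> cb; have [pq|qp] := leP p q; last first.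
  exists 0 => // s; rewrite b0 ?normr0//; apply/negP => /andP[ps sq].
  by have := lt_trans (lt_trans ps sq) qp; rewrite ltxx.
have cnb : continuous (fun s => `|b s|).
  by move=> s; apply: continuous_comp; [exact: cb|exact: norm_continuous].
have [c _ cmax] := EVT_max pq (continuous_subspaceT cnb).
exists `|b c| => // s; case: (boolP (p < s < q)) => [/andP[ps sq]|/b0 ->].
  by apply: cmax; rewrite in_itv/= !ltW.
by rewrite normr0.
Qed.

(** The margin 1 leaves room for a whole neighbourhood of [s] on which [b] vanishes. *)
Lemma derive1_support s : ~~ (p - 1 < s < q + 1) -> derive1 b s = 0.
Proof.
move=> h; suff H : is_derive s (1 : R) b 0 by rewrite derive1E; exact: derive_val.
apply: (@near_eq_is_derive _ _ _ (fun=> 0)).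
move: h; rewrite negb_and -!leNgt => /orP[h|h].
  near=> t; rewrite b0// negb_and -leNgt ltW//.
  by near: t; apply: lt_nbhsl; lra.
near=> t; rewrite b0// negb_and -!leNgt orbC ltW//.
by near: t; apply: lt_nbhsr; lra.
Unshelve. all: by end_near. Qed.

End support1.

Section bounded_support.
Context {R : realType} {d : nat}.
Implicit Types (u v : 'rV[R]_d -> R).

(** What remains of a test function after multiplication by a bounded measurable one: boundedness
    and a cube outside of which it vanishes. This is enough for integrability against locally
    integrable functions. *)
Definition bounded_support u : Prop :=
  measurable_fun setT u /\ exists C M : R,
    forall x, `|u x| <= C /\ ((exists i, M < `|x ord0 i|) -> u x = 0).

Lemma bounded_supportM u v (C : R) : measurable_fun setT u ->
  (forall x, `|u x| <= C) -> bounded_support v ->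
  bounded_support (fun x => u x * v x).
Proof.
move=> mu uC [mv [D [M vD]]]; split; first exact: measurable_funM.
exists (C * D), M => x; have [h1 h2] := vD x; split; last by move=> /h2 ->; rewrite mulr0.
by rewrite normrM ler_pM.
Qed.

Lemma bounded_supportD u v : bounded_support u -> bounded_support v ->
  bounded_support (fun x => u x + v x).
Proof.
move=> [mu [C [M uC]]] [mv [D [N vD]]]; split; first exact: measurable_funD.
exists (C + D), (Num.max M N) => x; have [h1 h2] := uC x; have [h3 h4] := vD x.
split; first by apply: le_trans (ler_normD _ _) _; exact: lerD.
move=> [i ]; rewrite gt_max => /andP[h5 h6].
by rewrite h2 ?h4 ?addr0//; exists i.
Qed.

Lemma integrable_bounded_support_mul u v : bounded_support u ->
  locally_integrable_rV v -> (@lam R d).-integrable setT (EFin \o (fun x => u x * v x)).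
Proof.
move=> [mu [C [M uC]]] [mv lv].
pose K := [set x : 'rV[R]_d | forall i, `[- M, M]%classic (x ord0 i)].
have cK : compact K.
  by apply: (@rV_compact R d (fun=> `[- M, M]%classic)) => i; exact: segment_compact.
have mK : measurable K.
  rewrite (_ : K = \bigcap_(i in [set: 'I_d]) [set x : 'rV[R]_d | `[- M, M]%classic (x ord0 i)]).
    apply: fin_bigcap_measurable => [|i _]; first exact: finite_finset.
    exact: measurable_coord_preimage.
  by apply/seteqP; split => x /= h i; [move=> _; exact: h|exact: h i I].
have -> : EFin \o (fun x => u x * v x) = (EFin \o (fun x => u x * v x)) \_ K.
  apply/funext => x; rewrite patchE; case: ifPn => // /negP xK /=.
  have [_ ->] := uC x; first by rewrite mul0r.
  apply: contrapT => h; apply: xK; apply/mem_set => i /=.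
  by rewrite in_itv/= -ler_norml leNgt; apply/negP => ?; apply: h; exists i.
apply/(integrable_mkcond (EFin \o (fun x => u x * v x)) mK).
have iv : (@lam R d).-integrable K (EFin \o v).
  apply/integrableP; split; first by apply/measurable_EFinP; exact: measurable_funTS.
  exact: lv cK.
apply: (@le_integrable _ _ R (@lam R d) K mK _ (fun x => C%:E * (abse \o (EFin \o v)) x)%E).
- by apply/measurable_EFinP; apply: measurable_funTS; exact: measurable_funM.
- move=> x _; have [h1 _] := uC x.
  rewrite (_ : (abse \o (EFin \o v)) x = `|v x|%:E)// -EFinM /= lee_fin !normrM normr_id.
  by apply: ler_wpM2r => //; apply: le_trans h1 _; exact: ler_norm.
- by apply: integrableZl => //; exact: integrable_abse.
Qed.

Lemma product_test_bounded_support u : product_test u -> bounded_support u.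
Proof.
move=> [b [p [q [sb b0 ->]]]]; split.
  apply: measurable_fun_prod_cond => i _.
  apply: (@measurableT_comp _ _ _ _ _ _ (b i)); last exact: measurable_rV_coord.
  by apply: continuous_measurable_fun; exact: (sb i 0%N).
have /choice[C Cb] : forall i, exists C, forall s, `|b i s| <= C.
  move=> i; have [C _ Cb] := continuous_support_bounded (b0 i) (sb i 0%N).
  by exists C.
exists (\prod_i C i), (\sum_i (`|p i| + `|q i|)) => x; split.
  rewrite normr_prod; apply: ler_prod => i _.
  by rewrite normr_ge0/=.
move=> [i hi]; rewrite (bigD1 i)//= b0 ?mul0r//.
apply/negP => /andP[h1 h2]; move: hi; rewrite ltNge => /negP; apply.
rewrite (bigD1 i)//=; apply: (@le_trans _ _ (`|p i| + `|q i|)); last first.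
  by rewrite lerDl sumr_ge0// => k _; rewrite addr_ge0.
have := ler_norm (q i); have := ler_norm (- p i); rewrite normrN => h3 h4.
have := normr_ge0 (p i); have := normr_ge0 (q i) => h5 h6.
by rewrite ler_norml; apply/andP; split; lra.
Qed.

Lemma product_test_partial j u : product_test u -> product_test (partial j u).
Proof.
move=> [b [p [q [sb b0 ->]]]].
exists (fun i => if i == j then derive1 (b i) else b i).
exists (fun i => p i - 1), (fun i => q i + 1); split.
- by move=> i k; case: eqP => // _; have [] := sb i k.+1.
- move=> i s h; case: eqP => _; first exact: derive1_support (b0 i) _ h.
  apply: b0; apply: contra h => /andP[h1 h2]; apply/andP; split; lra.
- apply/funext => x; rewrite (partial_product sb) [RHS](bigD1 j)//= eqxx.
  by congr (_ * _); apply: eq_bigr => i /negbTE ->.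
Qed.

Lemma product_testM u v : product_test u -> product_test v ->
  product_test (fun x => u x * v x).
Proof.
move=> [b [p [q [sb b0 ->]]]] [c [p' [q' [sc c0 ->]]]].
exists (fun i s => b i s * c i s), p, q; split.
- by move=> i k; exact: smooth1M.
- by move=> i s /b0 ->; rewrite mul0r.
- by apply/funext => x; rewrite big_split.
Qed.

Lemma product_test_left j u : product_test u ->
  exists M, forall x : 'rV[R]_d, x ord0 j < M -> u x = 0.
Proof.
move=> [b [p [q [sb b0 ->]]]]; exists (p j) => x xp.
by rewrite (bigD1 j)//= b0 ?mul0r// negb_and -leNgt ltW.
Qed.

Lemma product_test_derivable j u x : product_test u ->
  derivable u x (delta_mx ord0 j).
Proof.
move=> /product_testW[su _]; have := class_C_is_derive j x (su 1%N) => ?.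
exact: ex_derive.
Qed.

End bounded_support.

Section product_rule.
Context {R : realType} {n : nat}.
Variable j : 'I_n.+1.
Local Notation lm := (@lam R n.+1).
Local Notation e_j := (delta_mx ord0 j : 'rV[R]_n.+1).

Variables (mu : {finite_measure set 'rV[R]_n.+1 -> \bar R}).
Variable rho : 'I_n.+1 -> 'rV[R]_n.+1 -> R.
Hypothesis mu_rho : forall i, measure_partial mu i (rho i).
Variables g g' : 'rV[R]_n.+1 -> R.
Hypothesis gg' : distribution_partial j g g'.
Hypotheses (ig : mu.-integrable setT (EFin \o g))
  (ig' : mu.-integrable setT (EFin \o g'))
  (igrho : mu.-integrable setT (EFin \o (fun x => g x * rho j x))).
Variables (u : 'rV[R]_n.+1 -> R) (C : R).
Hypothesis su : forall k, class_C k u.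
Hypotheses (mu_u : measurable_fun setT u)
  (uC : forall x, `|u x| <= C) (u'C : forall x, `|partial j u x| <= C).

Let du x : derivable u x e_j.
Proof. by have := class_C_is_derive j x (su 1%N) => ?; exact: ex_derive. Qed.

Let mu' : measurable_fun setT (partial j u).
Proof. by apply: measurable_partial => // x; exact: du. Qed.

Lemma integrable_bounded_fun_mul (v w : 'rV[R]_n.+1 -> R) (D : R) :
  measurable_fun setT v -> (forall x, `|v x| <= D) ->
  mu.-integrable setT (EFin \o w) ->
  mu.-integrable setT (EFin \o (fun x => v x * w x)).
Proof.
move=> mv vD iw.
apply: (@le_integrable _ _ R mu setT measurableT _ (fun x => D%:E * (abse \o (EFin \o w)) x)%E).
- apply/measurable_EFinP; apply: measurable_funM => //.
  by apply/measurable_EFinP; exact: measurable_int iw.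
- move=> x _; rewrite (_ : (abse \o (EFin \o w)) x = `|w x|%:E)// -EFinM /= lee_fin !normrM normr_id.
  by apply: ler_wpM2r => //; apply: le_trans (vD _) _; exact: ler_norm.
- by apply: integrableZl => //; exact: integrable_abse.
Qed.

Section cutoff.
Variable c : 'rV[R]_n.+1 -> R.
Hypothesis tc : product_test c.

Let bc := product_test_bounded_support tc.
Let bc' := product_test_bounded_support (product_test_partial j tc).
Let dc x : derivable c x e_j. Proof. exact: product_test_derivable. Qed.

Let G x := u x * c x * g x.
Let G' x := (partial j u x * c x + u x * partial j c x) * g x + u x * c x * g' x.

Let buc : bounded_support (fun x => u x * c x).
Proof. exact: bounded_supportM bc. Qed.

Let bu'c : bounded_support (fun x => partial j u x * c x + u x * partial j c x).
Proof. by apply: bounded_supportD; [exact: bounded_supportM bc|exact: bounded_supportM bc']. Qed.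

Let iG : lm.-integrable setT (EFin \o G).
Proof. by apply: integrable_bounded_support_mul => //; have [] := gg'. Qed.

Let iG'1 : lm.-integrable setT
  (EFin \o (fun x => (partial j u x * c x + u x * partial j c x) * g x)).
Proof. by apply: integrable_bounded_support_mul => //; have [] := gg'. Qed.

Let iG'2 : lm.-integrable setT (EFin \o (fun x => u x * c x * g' x)).
Proof. by apply: integrable_bounded_support_mul => //; have [] := gg'. Qed.

Let iG' : lm.-integrable setT (EFin \o G').
Proof. by have := integrableD measurableT iG'1 iG'2; apply: eq_integrable. Qed.

(** The weak derivative of [g] is tested against [u * c * h]. This function is smooth with compact
    support, though not a product of one-variable functions; its classical product rule yields the
    weak one for [u * c * g]. *)
Let GG' h : product_test h ->
  \int[lm]_x (partial j h x * G x) = - \int[lm]_x (h x * G' x).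
Proof.
move=> th.
have tch := product_testM tc th.
pose k x := u x * (c x * h x).
have tk : test_function k.
  have [b [p [q [sb b0 E]]]] := tch.
  apply: (@test_function_box _ _ _ p q).
    by move=> l; apply: class_CM => //; have [+ _] := product_testW tch; apply.
  move=> x; rewrite /k (congr1 (@^~ x) E : c x * h x = _) => /negP kx i; case: (boolP (p i < x ord0 i < q i)) => [/andP[h1 h2]|/b0 bi].
    by rewrite !ltW.
  by exfalso; apply: kx; rewrite (bigD1 i)//= bi mul0r mulr0.
have dh x : derivable h x e_j by exact: product_test_derivable.
have [_ _ /(_ k tk)] := gg'.
have pk x : partial j k x = partial j h x * (u x * c x) +
    h x * (partial j u x * c x + u x * partial j c x).
  rewrite /k partialM//; last exact: product_test_derivable.
  rewrite partialM//; ring.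
have bh := product_test_bounded_support th.
have bh' := product_test_bounded_support (product_test_partial j th).
have bM v w : bounded_support v -> bounded_support w -> bounded_support (fun x : 'rV[R]_n.+1 => v x * w x).
  by move=> [mv [D [M vD]]] bw; apply: (bounded_supportM (C := D)) => // x; have [] := vD x.
have [lg lg' _] := gg'.
have i1 : lm.-integrable setT (EFin \o (fun x => partial j h x * G x)).
  have := integrable_bounded_support_mul (bM _ _ bh' buc) lg; apply: eq_integrable => // x _.
  by rewrite /G /= !mulrA.
have i2 : lm.-integrable setT (EFin \o (fun x => h x *
    (partial j u x * c x + u x * partial j c x) * g x)).
  exact: (integrable_bounded_support_mul (bM _ _ bh bu'c) lg).
have i3 : lm.-integrable setT (EFin \o (fun x => k x * g' x)).
  have := integrable_bounded_support_mul (bM _ _ bh buc) lg'; apply: eq_integrable => // x _.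
  rewrite /k /=; congr EFin; ring.
have -> : \int[lm]_x (g x * partial j k x) = \int[lm]_x (partial j h x * G x) +
   \int[lm]_x (h x * (partial j u x * c x + u x * partial j c x) * g x).
  rewrite -RintegralD//; apply: eq_Rintegral => x _; rewrite pk /G; ring.
have -> : \int[lm]_x (h x * G' x) =
   \int[lm]_x (h x * (partial j u x * c x + u x * partial j c x) * g x) +
   \int[lm]_x (g' x * k x).
  rewrite -RintegralD//; last first.
    by move: i3; apply: eq_integrable => // x _ /=; rewrite mulrC.
  apply: eq_Rintegral => x _; rewrite /G' /k; ring.
move=> H; apply/eqP; rewrite -subr_eq0; apply/eqP.
move: H; set a := (X in X + _ = _ -> _); set b := (X in _ + X = _ -> _).
set e := (X in _ = - X -> _) => H; rewrite opprK.
by rewrite addrCA addrA [b + a]addrC H addNr.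
Qed.

Let iG'mu1 : mu.-integrable setT
  (EFin \o (fun x => (partial j u x * c x + u x * partial j c x) * g x)).
Proof.
have [mb [D [M bD]]] := bu'c.
by apply: (integrable_bounded_fun_mul (D := D)) => // x; have [] := bD x.
Qed.

Let integrable_uc (w : 'rV[R]_n.+1 -> R) : mu.-integrable setT (EFin \o w) ->
  mu.-integrable setT (EFin \o (fun x => u x * c x * w x)).
Proof.
have [mb [D [M bD]]] := buc.
by move=> iw; apply: (integrable_bounded_fun_mul (D := D)) => // x; have [] := bD x.
Qed.

(** Integration by parts under Lebesgue measure between [G], supported in a box, and the density [f]
    of [mu], followed by a translation back to [mu]. The products [G' * f] and [G * (rho j * f)] are
    Lebesgue integrable because [G'] and [G * rho j] are [mu]-integrable. *)
Lemma cutoff_integration_by_parts :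
  \int[mu]_x ((partial j u x * c x + u x * partial j c x) * g x) +
  \int[mu]_x (u x * c x * g' x) = - \int[mu]_x (u x * c x * (g x * rho j x)).
Proof.
have dom := measure_partial_dominated mu_rho.
have [irho Irho] := mu_rho j.
pose f := rn_density mu lm.
have iG'mu : mu.-integrable setT (EFin \o G').
  by have := integrableD measurableT iG'mu1 (integrable_uc ig'); apply: eq_integrable.
(* The hypothesis [measure_partial], rewritten under Lebesgue measure: [f] has the weak derivative
   [rho j * f]. *)
have ff' h : product_test h ->
    \int[lm]_x (partial j h x * f x) = - \int[lm]_x (h x * (rho j x * f x)).
  move=> th; have [mh [D [M hD]]] := product_test_bounded_support th.
  have [mh' [D' [M' hD']]] := product_test_bounded_support (product_test_partial j th).
  have i1 : mu.-integrable setT (EFin \o partial j h).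
    have i0 : mu.-integrable setT (EFin \o (fun=> 1 : R)) by exact: finite_measure_integrable_cst.
    have := integrable_bounded_fun_mul (D := D') mh' (fun x => (hD' x).1) i0.
    by apply: eq_integrable => // x _ /=; rewrite mulr1.
  have i2 : mu.-integrable setT (EFin \o (fun x => h x * rho j x)).
    exact: integrable_bounded_fun_mul (fun x => (hD x).1) irho.
  rewrite (Rintegral_rn_density dom i1) (Irho _ (product_testW th)).
  rewrite -(Rintegral_rn_density dom i2); congr (- _).
  by apply: eq_Rintegral => x _; rewrite mulrA.
have [M cM] := product_test_left j tc.
have [M' cM'] := product_test_left j (product_test_partial j tc).
have igr := integrable_uc igrho.
have iGf' : lm.-integrable setT (EFin \o (fun x => G x * (rho j x * f x))).
  have := integrable_rn_densityM dom igr; apply: eq_integrable => // x _.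
  rewrite /G /f /=; congr EFin; ring.
have GM (x : 'rV[R]_n.+1) : x ord0 j < Num.min M M' -> G x = 0 /\ G' x = 0.
  by rewrite lt_min => /andP[/cM c0 /cM' c'0]; rewrite /G /G' c0 c'0 !(mulr0, mul0r, addr0).
have := integration_by_parts_lam iG iG' (integrable_rn_density dom)
  (integrable_rn_densityM dom irho) GG' ff' (integrable_rn_densityM dom iG'mu) iGf' GM.
rewrite (Rintegral_rn_density dom iG'mu) /G' RintegralD//; last exact: integrable_uc.
move=> ->; rewrite -(Rintegral_rn_density dom igr); congr (- _).
apply: eq_Rintegral => x _; rewrite /G /f; ring.
Qed.

End cutoff.

(* The value [c0] at the origin of the bump is not [1]; it cancels at the end. *)
Let cut (i : nat) (s : R) := bump (- 1) 1 0 (i.+1%:R^-1 * s + 0).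
Let tcut i := fun x : 'rV[R]_n.+1 => \prod_k cut i (x ord0 k).

Let scut i k : smooth1 k (cut i).
Proof. by apply: smooth1_affine; exact: smooth1_bump. Qed.

Let cut0 i s : ~~ (- i.+1%:R < s < i.+1%:R) -> cut i s = 0.
Proof.
move=> h; apply: bump_out; apply: contra h; rewrite addr0 -ltr_norml -ltr_norml.
by rewrite normrM gtr0_norm ?invr_gt0// mulrC ltr_pdivrMr// mul1r.
Qed.

Let tcut_test i : product_test (tcut i).
Proof.
exists (fun=> cut i), (fun=> - i.+1%:R), (fun=> i.+1%:R); split => //.
by move=> _ s; exact: cut0.
Qed.

Let c0 : R := bump (- 1) 1 0 0.

Let c0_gt0 : 0 < c0.
Proof.
rewrite /c0 /bump /polyexp !mul1r !subr0 opprK add0r ltr01 !hornerE.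
by rewrite /= mulr1 mulr_gt0// expR_gt0.
Qed.

Let cut_cvg s : cut i s @[i --> \oo] --> c0.
Proof.
have cb : continuous (bump (- 1) (1 : R) 0) by exact: (smooth1_bump 0).
apply: continuous_cvg; first exact: cb.
rewrite -[X in _ --> X]add0r; apply: cvgD; last exact: cvg_cst.
by rewrite -[X in _ --> X](mul0r s); apply: cvgM; [exact: cvg_harmonic|exact: cvg_cst].
Qed.

Let tcut_cvg x : tcut i x @[i --> \oo] --> c0 ^+ n.+1.
Proof.
rewrite -[X in _ ^+ X]card_ord -prodr_const.
by apply: cvg_prod_cond => i _; exact: cut_cvg.
Qed.

Let tcut_le1 i x : `|tcut i x| <= 1.
Proof.
rewrite ger0_norm; last by apply: prodr_ge0 => k _; exact: bump_ge0.
by apply: prodr_ile1 => k _; rewrite bump_ge0 bump_le1.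
Qed.

Let dbump := derive1 (bump (- 1) (1 : R) 0).

Let dcut i s : derive1 (cut i) s = dbump (i.+1%:R^-1 * s + 0) * i.+1%:R^-1.
Proof.
have d1 : is_derive s (1 : R) (fun s => i.+1%:R^-1 * s + 0) (i.+1%:R^-1 : R).
  rewrite -[X in is_derive _ _ _ X]addr0; apply: is_deriveD.
  rewrite -[X in is_derive _ _ _ X]mulr1; exact: is_deriveZ.
have d2 : is_derive (i.+1%:R^-1 * s + 0) (1 : R) (bump (- 1) 1 0) (dbump (i.+1%:R^-1 * s + 0)).
  exact: smooth1_is_derive (smooth1_bump 1 (-1) 1 0).
have := @is_derive1_comp R (bump (- 1) 1 0) (fun s => i.+1%:R^-1 * s + 0) s _ _ d2 d1.
by rewrite derive1E => ?; exact: derive_val.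
Qed.

Let dbump_bounded : exists2 B, 0 <= B & forall s, `|dbump s| <= B.
Proof.
have [_ sb] := smooth1_bump 1 (- 1) (1 : R) 0.
apply: (@continuous_support_bounded _ _ (- 1 - 1) (1 + 1)); last exact: sb.
by move=> s; apply: derive1_support; move=> t; exact: bump_out.
Qed.

Let dtcut_bound B : (forall s, `|dbump s| <= B) ->
  forall i x, `|partial j (tcut i) x| <= B / i.+1%:R.
Proof.
move=> dB i x; rewrite (partial_product (fun=> scut i)) dcut normrM.
rewrite -[leRHS]mulr1; apply: ler_pM => //.
  by rewrite normrM ler_pM// gtr0_norm.
rewrite ger0_norm; last by apply: prodr_ge0 => k _; exact: bump_ge0.
by apply: prodr_ile1 => k _; rewrite bump_ge0 bump_le1.
Qed.

(** The cutoff is dilated to infinity. It tends to the nonzero constant [c0 ^+ n.+1], while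
    boundedness of [u] and of its partial derivative lets dominated convergence act under the finite
    measure [mu]. *)
Lemma measure_integration_by_parts :
  \int[mu]_x (partial j u x * g x) + \int[mu]_x (u x * g' x) =
  - \int[mu]_x (u x * (g x * rho j x)).
Proof.
have [B B0 dB] := dbump_bounded.
have mt i : measurable_fun setT (tcut i) by have [] := product_test_bounded_support (tcut_test i).
have mt' i : measurable_fun setT (partial j (tcut i)).
  by have [] := product_test_bounded_support (product_test_partial j (tcut_test i)).
have C0 : 0 <= C by exact: le_trans (uC 0).
have cv (v w : 'rV[R]_n.+1 -> R) : measurable_fun setT v -> (forall x, `|v x| <= C) ->
    mu.-integrable setT (EFin \o w) ->
    \int[mu]_x (v x * tcut i x * w x) @[i --> \oo] --> \int[mu]_x (v x * c0 ^+ n.+1 * w x).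
  move=> mv vC iw; apply: (@Rintegral_cvgM _ _ _ mu _ _ _ C) => //.
  - by move=> i; exact: measurable_funM.
  - by move=> x; apply: cvgM; [exact: cvg_cst|exact: tcut_cvg].
  - by move=> i x; rewrite normrM -[leRHS]mulr1 ler_pM.
(* The term where the derivative falls on the cutoff is of order [1 / i.+1] and disappears. *)
have cv' : \int[mu]_x (u x * partial j (tcut i) x * g x) @[i --> \oo] --> \int[mu]_x (u x * 0 * g x).
  apply: (@Rintegral_cvgM _ _ _ mu _ _ _ (C * B)) => //.
  - by move=> i; exact: measurable_funM.
  - move=> x; apply: cvgM; first exact: cvg_cst.
    apply/norm_cvg0P.
    apply: (@squeeze_cvgr _ _ _ _ (fun=> 0) (fun i => B / i.+1%:R)).
    + by apply: nearW => i; rewrite normr_ge0 dtcut_bound.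
    + exact: cvg_cst.
    + by rewrite -[X in _ --> X](mulr0 B); apply: cvgM; [exact: cvg_cst|exact: cvg_harmonic].
  - move=> i x; rewrite normrM ler_pM//; apply: le_trans (dtcut_bound dB i x) _.
    by rewrite ler_pdivrMr// ler_peMr// ler1n.
have iu't i : mu.-integrable setT (EFin \o (fun x => partial j u x * tcut i x * g x)).
  apply: (integrable_bounded_fun_mul (D := C)) => //; first exact: measurable_funM.
  by move=> x; rewrite normrM -[leRHS]mulr1 ler_pM.
have iut' i : mu.-integrable setT (EFin \o (fun x => u x * partial j (tcut i) x * g x)).
  apply: (integrable_bounded_fun_mul (D := C * (B / i.+1%:R))) => //; first exact: measurable_funM.
  by move=> x; rewrite normrM ler_pM// dtcut_bound.
have E : (fun i => \int[mu]_x (partial j u x * tcut i x * g x) +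
    \int[mu]_x (u x * partial j (tcut i) x * g x) + \int[mu]_x (u x * tcut i x * g' x)) =
  (fun i => - \int[mu]_x (u x * tcut i x * (g x * rho j x))).
  apply/funext => i; rewrite -(cutoff_integration_by_parts (tcut_test i)); congr (_ + _).
  by rewrite -RintegralD//; apply: eq_Rintegral => x _; rewrite mulrDl.
have : \int[mu]_x (partial j u x * c0 ^+ n.+1 * g x) + \int[mu]_x (u x * 0 * g x) +
    \int[mu]_x (u x * c0 ^+ n.+1 * g' x) = - \int[mu]_x (u x * c0 ^+ n.+1 * (g x * rho j x)).
  have Rr : (fun i => - \int[mu]_x (u x * tcut i x * (g x * rho j x))) @ \oo -->
      - \int[mu]_x (u x * c0 ^+ n.+1 * (g x * rho j x)).
    by apply: cvgN; exact: (cv _ (fun x => g x * rho j x) mu_u uC igrho).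
  rewrite -E in Rr; apply: (cvg_unique _ _ Rr) => //.
  by apply: cvgD; [apply: cvgD|]; [exact: cv|exact: cv'|exact: cv].
have cst (v w : 'rV[R]_n.+1 -> R) : measurable_fun setT v -> (forall x, `|v x| <= C) ->
    mu.-integrable setT (EFin \o w) ->
    \int[mu]_x (v x * c0 ^+ n.+1 * w x) = c0 ^+ n.+1 * \int[mu]_x (v x * w x).
  move=> mv vC iw; rewrite -RintegralZl//; last exact: integrable_bounded_fun_mul vC iw.
  by apply: eq_Rintegral => x _; ring.
rewrite !cst//.
have -> : \int[mu]_x (u x * 0 * g x) = 0.
  under eq_Rintegral do rewrite mulr0 mul0r.
  by rewrite Rintegral_cst// mul0r.
rewrite addr0 -mulrDr -mulrN => /mulfI; apply.
by rewrite expf_neq0// gt_eqF.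
Qed.

End product_rule.

(** * Square integrable and complex functions *)

Section L2.
Context {R : realType} d (T : measurableType d).
Variable mu : {finite_measure set T -> \bar R}.
Implicit Types f g : T -> R.

Lemma Lfun_measurable p f : f \in Lfun mu p -> measurable_fun setT f.
Proof. by move=> /sub_Lfun_mfun /set_mem. Qed.

Lemma Lfun2P f : f \in Lfun mu 2%:E <->
  measurable_fun setT f /\ mu.-integrable setT (EFin \o (fun x => f x ^+ 2)).
Proof.
split=> [f2|[mf if2]].
  by split; [exact: Lfun_measurable f2|exact: Lfun2_integrable_sqr].
apply/andP; split; first exact/mem_set.
apply/mem_set; rewrite /finite_norm/=.
have N2 : ('N[mu]_2%:E[EFin \o f] `^ 2 < +oo)%E.
  rewrite powR_Lnorm//; have /integrableP[_] := if2.
  congr (_ < _)%E; apply: eq_integral => x _ /=.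
  rewrite ger0_norm ?sqr_ge0// powR_mulrn// real_normK// num_real//.
rewrite ltNge; apply/negP; rewrite leye_eq => /eqP Noo.
by move: N2; rewrite Noo poweRyr// ltxx.
Qed.

Lemma Lfun2_integrable f : f \in Lfun mu 2%:E -> mu.-integrable setT (EFin \o f).
Proof.
move=> f2; apply/Lfun1_integrable; apply: Lfun_subset12 f2.
exact: fin_num_measure.
Qed.

Lemma Lfun2_1 : (fun=> 1 : R) \in Lfun mu 2%:E.
Proof. exact: Lfun_cst. Qed.

Lemma Lfun2D f g : f \in Lfun mu 2%:E -> g \in Lfun mu 2%:E ->
  (fun x => f x + g x) \in Lfun mu 2%:E.
Proof.
have h1 : (1 <= 2%:E :> \bar R)%E by rewrite lee1n.
have [_ h] := @Lfun_addr_closed _ _ _ mu 2%:E h1.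
exact: h.
Qed.

Lemma ae_bounded_mul_integrable f g (C : R) : measurable_fun setT f ->
  {ae mu, forall x, `|f x| <= C} -> mu.-integrable setT (EFin \o g) ->
  mu.-integrable setT (EFin \o (fun x => f x * g x)).
Proof.
move=> mf fC ig.
have mg : measurable_fun setT g by apply/measurable_EFinP; exact: measurable_int ig.
apply/integrableP; split; first by apply/measurable_EFinP; exact: measurable_funM.
have : mu.-integrable setT (fun x => C%:E * (abse \o (EFin \o g)) x)%E.
  by apply: integrableZl => //; exact: integrable_abse.
move=> /integrableP[mCg]; apply: le_lt_trans.
apply: ae_ge0_le_integral => //.
- by apply: measurableT_comp => //; apply/measurable_EFinP; exact: measurable_funM.
- exact: measurableT_comp.
- apply: filterS fC => x fC _ /=.
  rewrite lee_fin !normrM normr_id.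
  by apply: ler_wpM2r => //; apply: le_trans fC _; exact: ler_norm.
Qed.

Lemma ae_bounded_mul_Lfun2 f g (C : R) : measurable_fun setT f ->
  {ae mu, forall x, `|f x| <= C} -> g \in Lfun mu 2%:E ->
  (fun x => f x * g x) \in Lfun mu 2%:E.
Proof.
move=> mf fC /Lfun2P[mg ig]; apply/Lfun2P; split; first exact: measurable_funM.
have := @ae_bounded_mul_integrable (fun x => f x ^+ 2) (fun x => g x ^+ 2) (C ^+ 2).
under [X in _ -> _ -> _ -> mu.-integrable _ (_ \o X)]eq_fun do rewrite -exprMn.
apply => //; first exact: measurable_funX.
apply: filterS fC => x fC; rewrite normrX; apply: lerXn2r => //.
by rewrite nnegrE (le_trans _ fC).
Qed.

(** Positivity of the total mass settles the case distinction in the norm of order [+oo], which then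
    is the essential supremum. *)
Lemma Lfuny_ae_bounded f : (0 < mu setT)%E -> f \in Lfun mu +oo%E ->
  exists C : R, {ae mu, forall x, `|f x| <= C}.
Proof.
move=> muT /sub_Lfun_finLfun/set_mem; rewrite /= /finite_norm unlock muT.
exact: (@ess_supr_bounded _ _ _ mu (fun x => `|f x|)).
Qed.

Lemma Lfun2_sum (I : Type) (r : seq I) (F : I -> T -> R) :
  (forall i, F i \in Lfun mu 2%:E) ->
  (fun x => \sum_(i <- r) F i x) \in Lfun mu 2%:E.
Proof.
move=> HF; elim: r => [|i r IH].
  rewrite (_ : (fun x => _) = cst 0); first exact: Lfun_cst.
  by apply/funext => x; rewrite big_nil.
rewrite (_ : (fun x => _) = (fun x => F i x + \sum_(k <- r) F k x)).
  exact: Lfun2D.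
by apply/funext => x; rewrite big_cons.
Qed.

End L2.

(** * Complex numbers and limits through real and imaginary parts *)

Section complex_parts.
Context {R : realType}.
Implicit Types x y : R[i].

Lemma cReD x y : complex.Re (x + y) = complex.Re x + complex.Re y.
Proof. by case: x; case: y. Qed.

Lemma cImD x y : complex.Im (x + y) = complex.Im x + complex.Im y.
Proof. by case: x; case: y. Qed.

Lemma cReN x : complex.Re (- x) = - complex.Re x. Proof. by case: x. Qed.

Lemma cImN x : complex.Im (- x) = - complex.Im x. Proof. by case: x. Qed.

Lemma cReM x y : complex.Re (x * y) =
  complex.Re x * complex.Re y - complex.Im x * complex.Im y.
Proof. by case: x; case: y. Qed.

Lemma cImM x y : complex.Im (x * y) =
  complex.Re x * complex.Im y + complex.Im x * complex.Re y.
Proof. by case: x; case: y. Qed.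

Lemma complex_eqP x y : complex.Re x = complex.Re y ->
  complex.Im x = complex.Im y -> x = y.
Proof. by case: x; case: y => ? ? ? ? /= -> ->. Qed.

Lemma cRe_sum (I : Type) (r : seq I) (F : I -> R[i]) :
  complex.Re (\sum_(i <- r) F i) = \sum_(i <- r) complex.Re (F i).
Proof. by elim/big_rec2 : _ => // i x y _ <-; exact: cReD. Qed.

Lemma cIm_sum (I : Type) (r : seq I) (F : I -> R[i]) :
  complex.Im (\sum_(i <- r) F i) = \sum_(i <- r) complex.Im (F i).
Proof. by elim/big_rec2 : _ => // i x y _ <-; exact: cImD. Qed.

Lemma expiD (s t : R) : expi (s + t) = expi s * expi t.
Proof.
apply: complex_eqP; rewrite ?cReM ?cImM /= ?cosD ?sinD//.
ring.
Qed.

Lemma expi0 : expi (0 : R) = 1.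
Proof. by rewrite /expi cos0 sin0. Qed.

(** The modulus is at most the sum of the absolute values of the two parts. The bound is requested
    only eventually, as the third moment of [xi n] is known to be finite only for large [n]. *)
Lemma Ccvg0 (z : nat -> R[i]) (b : nat -> R) : b @ \oo --> (0 : R) ->
  (\forall n \near \oo, `|complex.Re (z n)| + `|complex.Im (z n)| <= b n) ->
  Ccvg z 0.
Proof.
move=> b0 zb; apply/(@cvgr0Pnorm_lt R[i] R[i]^o) => e.
rewrite ltcE /= => /andP[/eqP Ie Re0].
have h0 : \forall n \near \oo, `|b n| < complex.Re e by exact: cvgr0_norm_lt.
near=> n; have zbn : `|complex.Re (z n)| + `|complex.Im (z n)| <= b n by near: n.
have bn : `|b n| < complex.Re e by near: n.
rewrite normc_def ltcE /= Ie eqxx /=.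
apply: (@le_lt_trans _ _ (`|complex.Re (z n)| + `|complex.Im (z n)|)).
  rewrite -[leRHS]ger0_norm; last by rewrite addr_ge0.
  rewrite -sqrtr_sqr ler_sqrt ?sqr_ge0// sqrrD !real_normK ?num_real//.
  by rewrite lerD2r lerDl mulrn_wge0// mulr_ge0.
by apply: le_lt_trans zbn _; exact: le_lt_trans (ler_norm _) bn.
Unshelve. all: by end_near. Qed.

Lemma CcvgD (z z' : nat -> R[i]) l l' : Ccvg z l -> Ccvg z' l' ->
  Ccvg (fun n => z n + z' n) (l + l').
Proof. by move=> zl zl'; exact: (@cvgD R[i] R[i]^o _ _ _ z z' l l' zl zl'). Qed.

Lemma CcvgZ (z : nat -> R[i]) c l : Ccvg z l -> Ccvg (fun n => c * z n) (c * l).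
Proof. by move=> zl; apply: (@cvgMr _ _ _ _ (z : nat -> R[i]^o)). Qed.

Lemma Ccvg_near (z z' : nat -> R[i]) l :
  (\forall n \near \oo, z n = z' n) -> Ccvg z l -> Ccvg z' l.
Proof. by move=> zz' zl; apply: cvg_trans zl; exact: near_eq_cvg. Qed.

Lemma Ccvg_sum (I : Type) (r : seq I) (z : I -> nat -> R[i]) (l : I -> R[i]) :
  (forall i, Ccvg (z i) (l i)) ->
  Ccvg (fun n => \sum_(i <- r) z i n) (\sum_(i <- r) l i).
Proof.
move=> zl; elim: r => [|i r IH].
  rewrite big_nil; under eq_fun do rewrite big_nil.
  exact: (@cvg_cst R[i]^o).
rewrite big_cons; under eq_fun do rewrite big_cons.
exact: (CcvgD (zl i) IH).
Qed.

End complex_parts.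

(** * Trigonometric polynomials *)

Section Cintegral.
Context {R : realType} d (T : measurableType d).
Implicit Types f g : T -> R[i].

Definition Cmeasurable f : Prop :=
  measurable_fun setT (fun x => complex.Re (f x)) /\
  measurable_fun setT (fun x => complex.Im (f x)).

Definition Cbounded f : Prop :=
  Cmeasurable f /\
  exists C : R, forall x, `|complex.Re (f x)| <= C /\ `|complex.Im (f x)| <= C.

Lemma CmeasurableD f g : Cmeasurable f -> Cmeasurable g ->
  Cmeasurable (fun x => f x + g x).
Proof.
move=> [rf jf] [rg jg]; split.
  by under eq_fun do rewrite cReD; exact: measurable_funD.
by under eq_fun do rewrite cImD; exact: measurable_funD.
Qed.

Lemma CmeasurableM f g : Cmeasurable f -> Cmeasurable g ->
  Cmeasurable (fun x => f x * g x).
Proof.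
move=> [rf jf] [rg jg]; split.
  by under eq_fun do rewrite cReM; apply: measurable_funB; exact: measurable_funM.
by under eq_fun do rewrite cImM; apply: measurable_funD; exact: measurable_funM.
Qed.

Lemma Cbounded_cst (c : R[i]) : Cbounded (fun=> c).
Proof.
split; first by split; exact: measurable_cst.
exists (`|complex.Re c| + `|complex.Im c|) => x.
by rewrite lerDl lerDr.
Qed.

Lemma CboundedD f g : Cbounded f -> Cbounded g -> Cbounded (fun x => f x + g x).
Proof.
move=> [mf [C fC]] [mg [D gD]]; split; first exact: CmeasurableD.
exists (C + D) => x; have [f1 f2] := fC x; have [g1 g2] := gD x.
by rewrite cReD cImD; split; apply: le_trans (ler_normD _ _) _; exact: lerD.
Qed.

Lemma CboundedM f g : Cbounded f -> Cbounded g -> Cbounded (fun x => f x * g x).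
Proof.
move=> [mf [C fC]] [mg [D gD]]; split; first exact: CmeasurableM.
exists (C * D + C * D) => x; have [f1 f2] := fC x; have [g1 g2] := gD x.
rewrite cReM cImM; split.
  by apply: le_trans (ler_normB _ _) _; rewrite !normrM; apply: lerD; exact: ler_pM.
by apply: le_trans (ler_normD _ _) _; rewrite !normrM; apply: lerD; exact: ler_pM.
Qed.

Lemma CboundedB f g : Cbounded f -> Cbounded g -> Cbounded (fun x => f x - g x).
Proof.
move=> bf bg; have -> : (fun x => f x - g x) = (fun x => f x + (-1) * g x).
  by apply/funext => x; rewrite mulN1r.
by apply: CboundedD => //; apply: CboundedM => //; exact: Cbounded_cst.
Qed.

Lemma Cbounded_sum (I : Type) (r : seq I) (F : I -> T -> R[i]) :
  (forall i, Cbounded (F i)) -> Cbounded (fun x => \sum_(i <- r) F i x).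
Proof.
move=> bF; elim: r => [|i r IH].
  by under eq_fun do rewrite big_nil; exact: Cbounded_cst.
by under eq_fun do rewrite big_cons; exact: CboundedD.
Qed.

Section integral.
Variable mu : {measure set T -> \bar R}.

Definition Cintegrable f : Prop :=
  mu.-integrable setT (EFin \o (fun x => complex.Re (f x))) /\
  mu.-integrable setT (EFin \o (fun x => complex.Im (f x))).

Let iD (u v : T -> R) : mu.-integrable setT (EFin \o u) ->
  mu.-integrable setT (EFin \o v) ->
  mu.-integrable setT (EFin \o (fun x => u x + v x)).
Proof. by move=> iu iv; have := integrableD measurableT iu iv; apply: eq_integrable. Qed.

Let iB (u v : T -> R) : mu.-integrable setT (EFin \o u) ->
  mu.-integrable setT (EFin \o v) ->
  mu.-integrable setT (EFin \o (fun x => u x - v x)).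
Proof. by move=> iu iv; have := integrableB measurableT iu iv; apply: eq_integrable. Qed.

Let iZ (c : R) (u : T -> R) : mu.-integrable setT (EFin \o u) ->
  mu.-integrable setT (EFin \o (fun x => c * u x)).
Proof. by move=> iu; have := integrableZl measurableT c iu; apply: eq_integrable. Qed.

Lemma CintegrableD f g : Cintegrable f -> Cintegrable g ->
  Cintegrable (fun x => f x + g x).
Proof.
move=> [rf jf] [rg jg]; split.
  by under eq_fun do rewrite cReD; exact: iD.
by under eq_fun do rewrite cImD; exact: iD.
Qed.

Lemma CintegrableZ c f : Cintegrable f -> Cintegrable (fun x => c * f x).
Proof.
move=> [rf jf]; split.
  by under eq_fun do rewrite cReM; apply: iB; exact: iZ.
by under eq_fun do rewrite cImM; apply: iD; exact: iZ.
Qed.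

Lemma CintegralD f g : Cintegrable f -> Cintegrable g ->
  Cintegral mu (fun x => f x + g x) = Cintegral mu f + Cintegral mu g.
Proof.
move=> [rf jf] [rg jg]; apply: complex_eqP; rewrite ?cReD ?cImD /=.
  by under eq_Rintegral do rewrite cReD; rewrite RintegralD.
by under eq_Rintegral do rewrite cImD; rewrite RintegralD.
Qed.

Lemma CintegralZ c f : Cintegrable f ->
  Cintegral mu (fun x => c * f x) = c * Cintegral mu f.
Proof.
move=> [rf jf]; apply: complex_eqP; rewrite ?cReM ?cImM /=.
  under eq_Rintegral do rewrite cReM.
  by rewrite RintegralB ?RintegralZl//; exact: iZ.
under eq_Rintegral do rewrite cImM.
by rewrite RintegralD ?RintegralZl//; exact: iZ.
Qed.

Lemma Cintegrable_cst0 : Cintegrable (fun=> 0).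
Proof. by split; exact: integrable0. Qed.

Lemma Cintegral_cst0 : Cintegral mu (fun=> 0) = 0.
Proof. by apply: complex_eqP => /=; rewrite Rintegral_cst// mul0r. Qed.

Lemma Cintegrable_sum (I : Type) (r : seq I) (F : I -> T -> R[i]) :
  (forall i, Cintegrable (F i)) -> Cintegrable (fun x => \sum_(i <- r) F i x).
Proof.
move=> bF; elim: r => [|i r IH].
  by under eq_fun do rewrite big_nil; exact: Cintegrable_cst0.
by under eq_fun do rewrite big_cons; exact: CintegrableD.
Qed.

Lemma Cintegral_sum (I : Type) (r : seq I) (F : I -> T -> R[i]) :
  (forall i, Cintegrable (F i)) ->
  Cintegral mu (fun x => \sum_(i <- r) F i x) = \sum_(i <- r) Cintegral mu (F i).
Proof.
move=> bF; elim: r => [|i r IH].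
  by rewrite big_nil; under eq_fun do rewrite big_nil; exact: Cintegral_cst0.
rewrite big_cons; under eq_fun do rewrite big_cons.
by rewrite CintegralD ?IH//; exact: Cintegrable_sum.
Qed.

Lemma ae_eq_Cintegral f g : Cintegrable f -> Cintegrable g ->
  {ae mu, forall x, f x = g x} -> Cintegral mu f = Cintegral mu g.
Proof.
move=> [rf jf] [rg jg] fg; apply: complex_eqP => /=; congr fine.
  apply: ae_eq_integral => //; [exact: measurable_int rf|exact: measurable_int rg|].
  by apply: filterS fg => x -> _.
apply: ae_eq_integral => //; [exact: measurable_int jf|exact: measurable_int jg|].
by apply: filterS fg => x -> _.
Qed.

Lemma Cintegrable_bounded_mul f (v : T -> R) : Cbounded f ->
  mu.-integrable setT (EFin \o v) -> Cintegrable (fun x => f x * (v x)%:C).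
Proof.
move=> [[mr mi] [C fC]] iv.
have mv : measurable_fun setT v by apply/measurable_EFinP; exact: measurable_int iv.
have H (u : T -> R) : measurable_fun setT u -> (forall x, `|u x| <= C) ->
    mu.-integrable setT (EFin \o (fun x => u x * v x)).
  move=> mu' uC.
  have := integrable_abse iv => /(integrableZl measurableT C).
  apply: le_integrable => //; first by apply/measurable_EFinP; exact: measurable_funM.
  move=> x _ /=; rewrite lee_fin !normrM normr_id.
  by apply: ler_wpM2r => //; apply: le_trans (uC x) _; exact: ler_norm.
split.
  under eq_fun do rewrite cReM /= mulr0 subr0.
  by apply: H => // x; have [] := fC x.
under eq_fun do rewrite cImM /= mulr0 add0r.
by apply: H => // x; have [] := fC x.
Qed.

End integral.

Lemma Cbounded_integrable (mu : {finite_measure set T -> \bar R}) f :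
  Cbounded f -> Cintegrable mu f.
Proof.
move=> bf; have i1 : mu.-integrable setT (EFin \o (fun=> 1 : R)).
  exact: finite_measure_integrable_cst.
have := Cintegrable_bounded_mul bf i1.
by under eq_fun do rewrite mulr1.
Qed.

End Cintegral.

Lemma Cbounded_comp {R : realType} d d' (T : measurableType d) (T' : measurableType d')
    (f : T' -> R[i]) (Z : T -> T') : measurable_fun setT Z -> Cbounded f ->
  Cbounded (fun x => f (Z x)).
Proof.
move=> mZ [[mr mi] [C fC]]; split; last by exists C => x; exact: fC.
split; [exact: (measurableT_comp mr mZ)|exact: (measurableT_comp mi mZ)].
Qed.

Section trig.
Context {R : realType} {d : nat}.
Implicit Types (phi chi : 'rV[R]_d -> R[i]) (u : 'rV[R]_d).
Local Notation e_ i := (delta_mx ord0 i : 'rV[R]_d).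

Lemma measurable_dotv u : measurable_fun setT (dotv u).
Proof.
apply: measurable_sum => i; apply: measurable_funM => //.
exact: measurable_rV_coord.
Qed.

Lemma norm_expi (t : R) : `|complex.Re (expi t)| <= 1 /\ `|complex.Im (expi t)| <= 1.
Proof.
by rewrite /= !ler_norml cos_geN1 cos_le1 sin_geN1 sin_le1.
Qed.

Lemma Cbounded_expi u : Cbounded (fun x : 'rV[R]_d => expi (dotv u x)).
Proof.
split; last by exists 1 => x; exact: norm_expi.
split; apply: (measurableT_comp _ (measurable_dotv u)).
  by apply: continuous_measurable_fun; exact: continuous_cos.
by apply: continuous_measurable_fun; exact: continuous_sin.
Qed.

(** Renumbering a finite index type; the product of two trigonometric polynomials is naturally
    indexed by pairs. *)
Lemma trig_poly_fin (I : finType) (c : I -> R[i]) (u : I -> 'rV[R]_d) :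
  trig_poly (fun x => \sum_i c i * expi (dotv (u i) x)).
Proof.
exists #|I|, (fun k => c (enum_val k)), (fun k => u (enum_val k)).
by apply/funext => x; rewrite (reindex _ (onW_bij _ (@enum_val_bij I))).
Qed.

Lemma dotvDl (u v x : 'rV[R]_d) : dotv (u + v) x = dotv u x + dotv v x.
Proof.
by rewrite /dotv -big_split/=; apply: eq_bigr => i _; rewrite mxE mulrDl.
Qed.

Lemma dotvDr (u x y : 'rV[R]_d) : dotv u (x + y) = dotv u x + dotv u y.
Proof.
by rewrite /dotv -big_split/=; apply: eq_bigr => i _; rewrite mxE mulrDr.
Qed.

Lemma trig_polyM phi chi : trig_poly phi -> trig_poly chi ->
  trig_poly (fun x => phi x * chi x).
Proof.
move=> [m [c [u ->]]] [m' [c' [u' ->]]].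
have := trig_poly_fin (fun k : 'I_m * 'I_m' => c k.1 * c' k.2) (fun k => u k.1 + u' k.2).
congr trig_poly; apply/funext => x.
rewrite big_distrlr/= pair_big/=; apply: eq_bigr => k _.
rewrite dotvDl expiD; ring.
Qed.

Lemma trig_poly_expi u : trig_poly (fun x => expi (dotv u x)).
Proof.
exists 1%N, (fun=> 1), (fun=> u); apply/funext => x.
by rewrite big_ord1 mul1r.
Qed.

Lemma trig_poly1 : trig_poly ((fun=> 1) : 'rV[R]_d -> R[i]).
Proof.
have := trig_poly_expi 0; congr trig_poly; apply/funext => x.
by rewrite /dotv big1 ?expi0// => i _; rewrite mxE mul0r.
Qed.

Lemma trig_poly_bounded phi : trig_poly phi -> Cbounded phi.
Proof.
move=> [m [c [u ->]]]; apply: Cbounded_sum => k; apply: CboundedM.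
  exact: Cbounded_cst.
exact: Cbounded_expi.
Qed.

(** A relation, because the rules of calculus need the differentiability of both parts and not only
    the value [cpartial]. *)
Definition is_cderive j x phi (l : R[i]) : Prop :=
  is_derive x (e_ j) (fun y => complex.Re (phi y)) (complex.Re l) /\
  is_derive x (e_ j) (fun y => complex.Im (phi y)) (complex.Im l).

Lemma is_cderive_cpartial j x phi l : is_cderive j x phi l -> cpartial j phi x = l.
Proof.
move=> [h1 h2]; apply: complex_eqP => /=; rewrite /partial; exact: derive_val.
Qed.

Lemma is_cderiveD j x phi chi l l' : is_cderive j x phi l -> is_cderive j x chi l' ->
  is_cderive j x (fun y => phi y + chi y) (l + l').
Proof.
move=> [h1 h2] [h3 h4]; split; rewrite ?cReD ?cImD.
  by under eq_fun do rewrite cReD; exact: is_deriveD.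
by under eq_fun do rewrite cImD; exact: is_deriveD.
Qed.

Lemma is_cderiveM j x phi chi l l' : is_cderive j x phi l -> is_cderive j x chi l' ->
  is_cderive j x (fun y => phi y * chi y) (phi x * l' + chi x * l).
Proof.
move=> [h1 h2] [h3 h4]; split.
  under eq_fun do rewrite cReM.
  apply: (is_derive_eq (is_deriveB (is_deriveM h1 h3) (is_deriveM h2 h4))).
  rewrite !(cReD, cReM) /GRing.scale /=; ring.
under eq_fun do rewrite cImM.
apply: (is_derive_eq (is_deriveD (is_deriveM h1 h4) (is_deriveM h2 h3))).
rewrite !(cImD, cImM) /GRing.scale /=; ring.
Qed.

Lemma is_cderive_cst j x (c : R[i]) : is_cderive j x (fun=> c) 0.
Proof. by split; exact: is_derive_cst. Qed.

Lemma is_cderive_sum j x (I : Type) (r : seq I) (F : I -> 'rV[R]_d -> R[i]) (l : I -> R[i]) :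
  (forall i, is_cderive j x (F i) (l i)) ->
  is_cderive j x (fun y => \sum_(i <- r) F i y) (\sum_(i <- r) l i).
Proof.
move=> dF; elim: r => [|i r IH].
  by rewrite big_nil; under eq_fun do rewrite big_nil; exact: is_cderive_cst.
by rewrite big_cons; under eq_fun do rewrite big_cons; exact: is_cderiveD.
Qed.

Lemma is_cderive_expi j x u : is_cderive j x (fun y => expi (dotv u y))
  ((0 +i* u ord0 j) * expi (dotv u x)).
Proof.
split; rewrite ?cReM ?cImM /=.
  rewrite mul0r sub0r -mulrN; apply: is_derive_dotv; exact: is_derive_cos.
rewrite mul0r add0r; apply: is_derive_dotv; exact: is_derive_sin.
Qed.

Section explicit.
Variables (m : nat) (c : 'I_m -> R[i]) (u : 'I_m -> 'rV[R]_d).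

Lemma is_cderive_trig j x :
  is_cderive j x (fun x => \sum_k c k * expi (dotv (u k) x))
    (\sum_k (c k * (0 +i* u k ord0 j)) * expi (dotv (u k) x)).
Proof.
apply: is_cderive_sum => k.
have := is_cderiveM (is_cderive_cst j x (c k)) (is_cderive_expi j x (u k)).
by rewrite mulr0 addr0 mulrA.
Qed.

Lemma cpartial_trig j : cpartial j (fun x => \sum_k c k * expi (dotv (u k) x)) =
  fun x => \sum_k (c k * (0 +i* u k ord0 j)) * expi (dotv (u k) x).
Proof. by apply/funext => x; exact: is_cderive_cpartial (is_cderive_trig j x). Qed.

End explicit.

Lemma trig_poly_cpartial j phi : trig_poly phi -> trig_poly (cpartial j phi).
Proof.
move=> [m [c [u ->]]]; rewrite cpartial_trig.
by exists m, (fun k => c k * (0 +i* u k ord0 j)), u.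
Qed.

Lemma trig_poly_is_cderive j x phi : trig_poly phi ->
  is_cderive j x phi (cpartial j phi x).
Proof. by move=> [m [c [u ->]]]; rewrite cpartial_trig; exact: is_cderive_trig. Qed.

Lemma cpartialM j phi chi : trig_poly phi -> trig_poly chi ->
  cpartial j (fun x => phi x * chi x) =
  fun x => phi x * cpartial j chi x + chi x * cpartial j phi x.
Proof.
move=> tphi tchi; apply/funext => x; apply: is_cderive_cpartial.
by apply: is_cderiveM; exact: trig_poly_is_cderive.
Qed.

Lemma cpartialD j phi chi : trig_poly phi -> trig_poly chi ->
  cpartial j (fun x => phi x + chi x) =
  fun x => cpartial j phi x + cpartial j chi x.
Proof.
move=> tphi tchi; apply/funext => x; apply: is_cderive_cpartial.
by apply: is_cderiveD; exact: trig_poly_is_cderive.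
Qed.

(** On an exponential both derivatives are multiplications by coordinates of the frequency. *)
Lemma cpartialC i j phi : trig_poly phi ->
  cpartial i (cpartial j phi) = cpartial j (cpartial i phi).
Proof.
move=> [m [c [u ->]]]; rewrite !cpartial_trig; apply/funext => x.
by apply: eq_bigr => k _; ring.
Qed.

Lemma trig_poly_class_C k phi : trig_poly phi ->
  class_C k (fun x => complex.Re (phi x)) /\ class_C k (fun x => complex.Im (phi x)).
Proof.
move=> [m [c [u ->]]]; split.
  under eq_fun do rewrite cRe_sum; apply: class_C_sum => l.
  under eq_fun do rewrite cReM /=.
  have -> : (fun x : 'rV[R]_d => complex.Re (c l) * cos (dotv (u l) x) -
      complex.Im (c l) * sin (dotv (u l) x)) =
    (fun x => complex.Re (c l) * cos (dotv (u l) x) +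
      (- complex.Im (c l)) * sin (dotv (u l) x)).
    by apply/funext => x; rewrite mulNr.
  by apply: class_CD; apply: class_CM; try exact: class_C_cst; have [] := class_C_trig k (u l).
under eq_fun do rewrite cIm_sum; apply: class_C_sum => l.
under eq_fun do rewrite cImM /=.
by apply: class_CD; apply: class_CM; try exact: class_C_cst; have [] := class_C_trig k (u l).
Qed.

End trig.

(** * Expansion of the exponential *)

Section taylor.
Context {R : realType}.

(** Every Taylor bound below is integrated from a lower one, starting from [cos <= 1] and
    [sin <= 1]. *)
Lemma ge0_is_derive (f f' : R -> R) : (forall s : R, is_derive s (1 : R) f (f' s)) ->
  (forall s, 0 <= s -> 0 <= f' s) -> f 0 = 0 -> forall t, 0 <= t -> 0 <= f t.
Proof.
move=> df f'0 f0 t; rewrite le_eqVlt => /orP[/eqP <-|t0]; first by rewrite f0.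
have cf : {within `[0, t], continuous f}.
  apply: continuous_subspaceT => x; apply: differentiable_continuous.
  by apply/derivable1_diffP; have := df x => ?; exact: ex_derive.
have [c] := MVT t0 (fun x _ => df x) cf.
rewrite in_itv/= => /andP[c0 _]; rewrite f0 !subr0 => ->.
by rewrite mulr_ge0 ?f'0// ltW.
Qed.

Let dX (n : nat) (c s : R) : is_derive s (1 : R) (fun t : R => c * t ^+ n.+1) (c * n.+1%:R * s ^+ n).
Proof.
elim: n => [|n IH].
  apply: (is_derive_eq (is_deriveM (is_derive_cst c s (1 : R)) (is_derive_id s (1 : R)))).
  by rewrite /GRing.scale /= mulr0 addr0 expr0 !mulr1.
rewrite (_ : (fun t : R => _) = (fun t : R => (c * t ^+ n.+1) * t)).
  apply: (is_derive_eq (is_deriveM IH (is_derive_id s (1 : R)))).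
  rewrite /GRing.scale /= mulr1 -[n.+2%:R]natr1 !exprS; ring.
by apply/funext => t; rewrite exprSr mulrA.
Qed.

Let sin_le (t : R) : 0 <= t -> sin t <= t.
Proof.
move=> t0; rewrite -subr_ge0; move: t t0.
apply: (@ge0_is_derive (fun t => t - sin t) (fun t => 1 - cos t)); last by rewrite sin0 subr0.
by move=> s _; rewrite subr_ge0 cos_le1.
Qed.

Let cos_ge (t : R) : 0 <= t -> 0 <= cos t - 1 + 2^-1 * t ^+ 2.
Proof.
move: t; apply: (@ge0_is_derive _ (fun t => t - sin t)); last first.
  by rewrite cos0 expr0n mulr0 subrr addr0.
  by move=> s s0; rewrite subr_ge0 sin_le.
move=> s; apply: (is_derive_eq (is_deriveD (is_deriveB (is_derive_cos s)
  (is_derive_cst (1 : R) s (1 : R))) (dX 1 2^-1 s))).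
by rewrite mulVf ?pnatr_eq0// mul1r expr1 subr0 addrC.
Qed.

Let sin_ge (t : R) : 0 <= t -> 0 <= sin t - t + 6^-1 * t ^+ 3.
Proof.
move: t; apply: (@ge0_is_derive _ (fun t => cos t - 1 + 2^-1 * t ^+ 2)); last first.
  by rewrite sin0 expr0n mulr0 subrr addr0.
  by move=> s s0; exact: cos_ge.
move=> s; apply: (is_derive_eq (is_deriveD (is_deriveB (is_derive_sin s)
  (is_derive_id s (1 : R))) (dX 2 6^-1 s))).
by congr (_ + _ * _); field.
Qed.

(** Of lower order than [sin_ge] on purpose: integrated once, it bounds the error of the cosine by
    [t ^+ 3], the moment that is controlled, and not by [t ^+ 4]. *)
Let sin_ge2 (t : R) : 0 <= t -> 0 <= sin t - t + 2^-1 * t ^+ 2.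
Proof.
have cos_ge1 (s : R) : 0 <= s -> 0 <= cos s - 1 + s.
  move: s; apply: (@ge0_is_derive _ (fun t => 1 - sin t)); last first.
    by rewrite cos0 subrr addr0.
    by move=> s _; rewrite subr_ge0 sin_le1.
  move=> s; apply: (is_derive_eq (is_deriveD (is_deriveB (is_derive_cos s)
    (is_derive_cst (1 : R) s (1 : R))) (is_derive_id s (1 : R)))).
  by rewrite subr0 addrC.
move: t; apply: (@ge0_is_derive _ (fun t => cos t - 1 + t)) => //; last first.
  by rewrite sin0 expr0n mulr0 subrr addr0.
move=> s; apply: (is_derive_eq (is_deriveD (is_deriveB (is_derive_sin s)
  (is_derive_id s (1 : R))) (dX 1 2^-1 s))).
by rewrite mulVf ?pnatr_eq0// mul1r expr1.
Qed.

Let cos_le (t : R) : 0 <= t -> 0 <= 1 - cos t - 2^-1 * t ^+ 2 + 6^-1 * t ^+ 3.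
Proof.
move: t; apply: (@ge0_is_derive _ (fun t => sin t - t + 2^-1 * t ^+ 2)); last first.
  by rewrite cos0 !expr0n !mulr0 !subrr addr0.
  by move=> s s0; exact: sin_ge2.
move=> s; apply: (is_derive_eq (is_deriveD (is_deriveB (is_deriveB
  (is_derive_cst (1 : R) s (1 : R)) (is_derive_cos s)) (dX 1 2^-1 s)) (dX 2 6^-1 s))).
by field.
Qed.

Definition expi_remainder (t : R) : R[i] :=
  (cos t - 1 + 2^-1 * t ^+ 2) +i* (sin t - t).

Lemma expi_taylor (t : R) : expi t - 1 =
  (0 +i* 1) * t%:C - 2^-1 * (t ^+ 2)%:C + expi_remainder t.
Proof.
have h : (2^-1 : R[i]) = (2^-1 : R)%:C by rewrite fmorphV/= rmorph_nat.
rewrite h; apply: complex_eqP; rewrite !(cReD, cReN, cReM, cImD, cImN, cImM) /=; ring.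
Qed.

(** By parity of cosine and sine it suffices to treat [t >= 0], where the one-sided bounds above
    apply; the constant is not optimal. *)
Lemma expi_remainder_le (t : R) : `|complex.Re (expi_remainder t)| <= `|t| ^+ 3 /\
  `|complex.Im (expi_remainder t)| <= `|t| ^+ 3.
Proof.
wlog t0 : t / 0 <= t.
  move=> H; have [/H//|/ltW t0] := leP 0 t.
  have := H (- t); rewrite oppr_ge0 => /(_ t0).
  by rewrite /expi_remainder/= cosN sinN sqrrN normrN -opprD normrN.
have t3 : 0 <= t ^+ 3 by rewrite exprn_ge0.
rewrite /= (ger0_norm t0) !ler_norml.
have := sin_le t0; have := cos_ge t0; have := sin_ge t0; have := cos_le t0.
by move=> *; split; apply/andP; split; lra.
Qed.

End taylor.

Section norms.
Context {R : realType} {d : nat}.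
Implicit Types (u x : 'rV[R]_d).

Lemma euclidean_norm_ge0 x : 0 <= euclidean_norm x.
Proof. exact: sqrtr_ge0. Qed.

(** Each coordinate is at most the Euclidean norm; the constant depends on [u] only, which is all
    that the limits require. *)
Lemma norm_dotv_le u x : `|dotv u x| <= (\sum_i `|u ord0 i|) * euclidean_norm x.
Proof.
rewrite mulr_suml; apply: le_trans (ler_norm_sum _ _ _) _; apply: ler_sum => i _.
rewrite normrM ler_wpM2l// -sqrtr_sqr ler_sqrt; last first.
  by rewrite sumr_ge0// => k _; rewrite -expr2 sqr_ge0.
rewrite /dotv (bigD1 i)//= -expr2 lerDl sumr_ge0// => k _.
by rewrite -expr2 sqr_ge0.
Qed.

Lemma measurable_euclidean_norm : measurable_fun setT (@euclidean_norm R d).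
Proof.
have ms : measurable_fun setT (Num.sqrt : R -> R).
  by apply: continuous_measurable_fun; exact: sqrt_continuous.
apply: (measurableT_comp ms); apply: measurable_sum => i.
apply: measurable_funM; exact: measurable_rV_coord.
Qed.

End norms.

(** * The limit for increments of one exponential *)

Section exponential_limit.
Context {R : realType} (dO : measure_display) (Omega : measurableType dO).
Variables (P : probability Omega R) (d : nat) (Y : {RV P >-> 'rV[R]_d}).
Variables (xi : nat -> 'rV[R]_d -> 'rV[R]_d) (alpha : nat -> R).
Hypothesis xi_meas : forall n, measurable_fun setT (xi n).
Hypothesis alpha_gt0 : forall n, 0 < alpha n.
Hypothesis xi_cubed :
  (fun n => ((alpha n)%:E *
     'E_P[(fun w => euclidean_norm (xi n (Y w)) ^+ 3)%R])%E) @ \oo --> 0%E.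

Let mY : measurable_fun setT (Y : Omega -> 'rV[R]_d).
Proof. exact: measurable_funPT. Qed.

Let N n w := euclidean_norm (xi n (Y w)).

Let mN n : measurable_fun setT (N n).
Proof.
apply: (measurableT_comp measurable_euclidean_norm).
exact: (measurableT_comp (xi_meas n) mY).
Qed.

Let N0 n w : 0 <= N n w. Proof. exact: euclidean_norm_ge0. Qed.

Let cubed_cvg : (fun n => alpha n * \int[P]_w (N n w ^+ 3)) @ \oo --> (0 : R).
Proof.
move/fine_cvgP : xi_cubed => [_]; apply: cvg_trans; apply: near_eq_cvg.
near=> n; rewrite /= /Rintegral unlock; set I := (\int[P]_w _)%E.
(* If the expectation is infinite, [fine] returns 0 before and after the multiplication by
   [alpha n], so the two real sequences agree. *)
by case: I => [r| |] //=; rewrite ?gt0_muley ?gt0_muleNy ?lte_fin//= mulr0.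
Unshelve. all: by end_near. Qed.

(** Convergence to 0 in the extended reals makes the values eventually finite, and since
    [alpha n > 0] the expectation itself is then finite. All splittings of integrals below therefore
    hold for large [n] only. *)
Let integrable_cubed : \forall n \near \oo,
  P.-integrable setT (EFin \o (fun w => N n w ^+ 3)).
Proof.
move/fine_cvgP : xi_cubed => [+ _]; apply: filterS => n.
rewrite unlock => fin; apply/integrableP; split.
  by apply/measurable_EFinP; exact: measurable_funX.
under eq_integral => w _ do rewrite /= ger0_norm ?exprn_ge0//.
have : (0 <= \int[P]_w (N n w ^+ 3)%:E)%E.
  by apply: integral_ge0 => w _; rewrite lee_fin exprn_ge0.
move: fin; rewrite /N; case: (\int[P]_w _)%E => [r| |]//=.
  by rewrite ltry.
by rewrite gt0_muley ?lte_fin.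
Qed.

Variable u : 'rV[R]_d.
Let U : R := \sum_i `|u ord0 i|.
Let U0 : 0 <= U. Proof. exact: sumr_ge0. Qed.
Let t n w := dotv u (xi n (Y w)).
Let tN n w : `|t n w| <= U * N n w. Proof. exact: norm_dotv_le. Qed.

Let mt n : measurable_fun setT (t n).
Proof.
apply: (measurableT_comp (measurable_dotv u)).
exact: (measurableT_comp (xi_meas n) mY).
Qed.

Let integrable_le n (f : Omega -> R) (C : R) : measurable_fun setT f ->
  P.-integrable setT (EFin \o (fun w => N n w ^+ 3)) ->
  (forall w, `|f w| <= C * (1 + N n w ^+ 3)) -> P.-integrable setT (EFin \o f).
Proof.
move=> mf iN fN.
have : P.-integrable setT (EFin \o (fun w => C * (1 + N n w ^+ 3))).
  have i1 : P.-integrable setT (EFin \o (fun=> 1 : R)).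
    exact: finite_measure_integrable_cst.
  have := integrableZl measurableT C (integrableD measurableT i1 iN).
  exact: eq_integrable.
apply: le_integrable => //; first exact/measurable_EFinP.
by move=> w _ /=; rewrite lee_fin (le_trans (fN w))// ler_norm.
Qed.

(** Under a probability the third moment thus controls the first two, which makes the linear and the
    quadratic term integrable. *)
Let pow_le1 (x : R) : 0 <= x -> x <= 1 + x ^+ 3 /\ x ^+ 2 <= 1 + x ^+ 3.
Proof.
move=> x0; have [x1|/ltW x1] := leP x 1.
  have x3 : 0 <= x ^+ 3 by exact: exprn_ge0.
  have x2 : x ^+ 2 <= 1 by rewrite exprn_ile1.
  split; lra.
have h1 : x <= x ^+ 3 by rewrite -[leLHS]expr1 ler_eXnr.
have h2 : x ^+ 2 <= x ^+ 3 by apply: ler_weXn2l.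
by split; lra.
Qed.

Let integrable_t n : P.-integrable setT (EFin \o (fun w => N n w ^+ 3)) ->
  P.-integrable setT (EFin \o t n).
Proof.
move=> iN; apply: (@integrable_le n _ U) => // w.
apply: le_trans (tN n w) _; rewrite ler_wpM2l//.
by have [] := pow_le1 (N0 n w).
Qed.

Let integrable_t2 n : P.-integrable setT (EFin \o (fun w => N n w ^+ 3)) ->
  P.-integrable setT (EFin \o (fun w => t n w ^+ 2)).
Proof.
move=> iN; apply: (@integrable_le n _ (U ^+ 2)) => //.
  exact: measurable_funX.
move=> w; rewrite normrX.
apply: (@le_trans _ _ ((U * N n w) ^+ 2)).
  by rewrite lerXn2r ?nnegrE ?mulr_ge0.
rewrite exprMn ler_wpM2l ?exprn_ge0//.
by have [] := pow_le1 (N0 n w).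
Qed.

Variable v : 'rV[R]_d.
Let e w := expi (dotv v (Y w)).

Let be : Cbounded e.
Proof. exact: (Cbounded_comp mY (Cbounded_expi v)). Qed.

Let r n w := e w * expi_remainder (t n w).

Let mr n : Cmeasurable (r n).
Proof.
apply: CmeasurableM; first by case: be.
have mc : measurable_fun setT (cos \o t n).
  by apply: measurableT_comp (mt n); apply: continuous_measurable_fun; exact: continuous_cos.
have ms : measurable_fun setT (sin \o t n).
  by apply: measurableT_comp (mt n); apply: continuous_measurable_fun; exact: continuous_sin.
split => /=; last exact: measurable_funB.
apply: measurable_funD; first exact: measurable_funB.
by apply: measurable_funM => //; exact: measurable_funX.
Qed.

Let r_le n w : `|complex.Re (r n w)| <= 2 * U ^+ 3 * N n w ^+ 3 /\
  `|complex.Im (r n w)| <= 2 * U ^+ 3 * N n w ^+ 3.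
Proof.
have [e1 e2] := norm_expi (dotv v (Y w)).
have [h1 h2] := expi_remainder_le (t n w).
have h3 : `|t n w| ^+ 3 <= U ^+ 3 * N n w ^+ 3.
  by rewrite -exprMn lerXn2r ?nnegrE ?mulr_ge0.
have H a b : `|a| <= 1 -> `|b| <= `|t n w| ^+ 3 -> `|a * b| <= U ^+ 3 * N n w ^+ 3.
  by move=> a1 b1; rewrite normrM (le_trans _ h3)// -[leRHS]mul1r ler_pM.
rewrite /r cReM cImM -mulrA mulr_natl mulr2n; split.
  by apply: le_trans (ler_normB _ _) _; apply: lerD; exact: H.
by apply: le_trans (ler_normD _ _) _; apply: lerD; exact: H.
Qed.

Let integrable_r n : P.-integrable setT (EFin \o (fun w => N n w ^+ 3)) ->
  Cintegrable P (r n).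
Proof.
move=> iN; have [mr1 mr2] := mr n.
have H w : 2 * U ^+ 3 * N n w ^+ 3 <= 2 * U ^+ 3 * (1 + N n w ^+ 3).
  by rewrite ler_wpM2l ?mulr_ge0 ?exprn_ge0// lerDr.
split; apply: (@integrable_le n _ (2 * U ^+ 3)) => // w; apply: le_trans (H w).
  by have [] := r_le n w.
by have [] := r_le n w.
Qed.

Let r_cvg : Ccvg (fun n => (alpha n)%:C * Cintegral P (r n)) 0.
Proof.
(* The real and the imaginary part of the integral contribute [2 * U ^+ 3] each. *)
apply: (@Ccvg0 _ _ (fun n => (4 * U ^+ 3) * (alpha n * \int[P]_w (N n w ^+ 3)))).
  by rewrite -[0](mulr0 (4 * U ^+ 3)); apply: cvgM cubed_cvg; exact: cvg_cst.
have := integrable_cubed; apply: filterS => n iN.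
have [ir1 ir2] := integrable_r iN.
have H (f : Omega -> R) : P.-integrable setT (EFin \o f) ->
    (forall w, `|f w| <= 2 * U ^+ 3 * N n w ^+ 3) ->
    `|\int[P]_w f w| <= 2 * U ^+ 3 * \int[P]_w (N n w ^+ 3).
  move=> jf fN; apply: le_trans (le_normr_Rintegral measurableT jf) _.
  rewrite -RintegralZl//; apply: le_Rintegral => //.
    by have := integrable_abse jf; exact: eq_integrable.
  by have := integrableZl measurableT (2 * U ^+ 3) iN; exact: eq_integrable.
have h1 := H _ ir1 (fun w => (r_le n w).1).
have h2 := H _ ir2 (fun w => (r_le n w).2).
rewrite cReM cImM /= !mul0r subr0 addr0 !normrM (gtr0_norm (alpha_gt0 n)).
rewrite -mulrDr mulrCA ler_wpM2l ?(ltW (alpha_gt0 n))//.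
apply: le_trans (lerD h1 h2) _.
rewrite le_eqVlt; apply/orP; left; apply/eqP; ring.
Qed.

Hypothesis xi_mean :
  Ccvg (fun n => (alpha n)%:C * Cintegral P (fun w => e w * (t n w)%:C)) 0.
Variable l : R[i].
Hypothesis xi_squared :
  Ccvg (fun n => (alpha n)%:C * Cintegral P (fun w => e w * (t n w ^+ 2)%:C)) l.

Lemma expi_increment_cvg :
  Ccvg (fun n => (alpha n)%:C * Cintegral P (fun w => e w * (expi (t n w) - 1)))
       (- 2^-1 * l).
Proof.
have := CcvgD (CcvgD (CcvgZ (c := 0 +i* 1) xi_mean) (CcvgZ (c := - 2^-1) xi_squared)) r_cvg.
rewrite mulr0 add0r addr0; apply: Ccvg_near.
have := integrable_cubed; apply: filterS => n iN.
have i1 := Cintegrable_bounded_mul be (integrable_t iN).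
have i2 := Cintegrable_bounded_mul be (integrable_t2 iN).
have i3 := integrable_r iN.
have -> : (fun w => e w * (expi (t n w) - 1)) = (fun w =>
    ((0 +i* 1) * (e w * (t n w)%:C) + (- 2^-1) * (e w * (t n w ^+ 2)%:C)) + r n w).
  apply/funext => w; rewrite expi_taylor /r; ring.
rewrite CintegralD//; last by apply: CintegrableD; exact: CintegrableZ.
rewrite CintegralD; [|exact: CintegrableZ|exact: CintegrableZ].
rewrite !CintegralZ//; ring.
Qed.

Lemma expi_increment_Cbounded n :
  Cbounded (fun w => e w * (expi (t n w) - 1)).
Proof.
apply: CboundedM => //; apply: CboundedB; last exact: Cbounded_cst.
exact: (Cbounded_comp (measurableT_comp (xi_meas n) mY) (Cbounded_expi u)).
Qed.

End exponential_limit.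

(** * The bias operators *)

Section CL2.
Context {R : realType} d (T : measurableType d).
Variable mu : {finite_measure set T -> \bar R}.
Implicit Types f g : T -> R[i].

Lemma CL2_real (v : T -> R) : v \in Lfun mu 2%:E -> CL2 mu (fun x => (v x)%:C).
Proof. by move=> v2; split => //=; exact: Lfun_cst. Qed.

Lemma CL2D f g : CL2 mu f -> CL2 mu g -> CL2 mu (fun x => f x + g x).
Proof.
move=> [f1 f2] [g1 g2]; split.
  by under eq_fun do rewrite cReD; exact: Lfun2D.
by under eq_fun do rewrite cImD; exact: Lfun2D.
Qed.

Lemma CL2_sum (I : Type) (r : seq I) (F : I -> T -> R[i]) :
  (forall i, CL2 mu (F i)) -> CL2 mu (fun x => \sum_(i <- r) F i x).
Proof.
move=> F2; split.
  by under eq_fun do rewrite cRe_sum; apply: Lfun2_sum => i; have [] := F2 i.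
by under eq_fun do rewrite cIm_sum; apply: Lfun2_sum => i; have [] := F2 i.
Qed.

Lemma CL2_bounded_mul f g : Cbounded f -> CL2 mu g -> CL2 mu (fun x => f x * g x).
Proof.
move=> [[mr mi] [C fC]] [g1 g2].
have Hr (v : T -> R) : v \in Lfun mu 2%:E -> (fun x => complex.Re (f x) * v x) \in Lfun mu 2%:E.
  by apply: (@ae_bounded_mul_Lfun2 _ _ _ _ _ _ C) => //; apply: aeW => x; have [] := fC x.
have Hi (v : T -> R) : v \in Lfun mu 2%:E -> (fun x => complex.Im (f x) * v x) \in Lfun mu 2%:E.
  by apply: (@ae_bounded_mul_Lfun2 _ _ _ _ _ _ C) => //; apply: aeW => x; have [] := fC x.
split.
  under eq_fun do rewrite cReM; apply: Lfun2D; first exact: Hr.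
  rewrite (_ : (fun x => _) = (fun x => (-1) * (complex.Im (f x) * complex.Im (g x)))).
    apply: (@ae_bounded_mul_Lfun2 _ _ _ _ (fun=> -1) _ 1) => //; last exact: Hi.
    by apply: aeW => x; rewrite normrN1.
  by apply/funext => x; rewrite mulN1r.
by under eq_fun do rewrite cImM; apply: Lfun2D; [exact: Hr|exact: Hi].
Qed.

Lemma CL2Z (c : R[i]) f : CL2 mu f -> CL2 mu (fun x => c * f x).
Proof. by apply: CL2_bounded_mul; exact: Cbounded_cst. Qed.

Lemma CL2_Cintegrable f : CL2 mu f -> Cintegrable mu f.
Proof. by move=> [f1 f2]; split; exact: Lfun2_integrable. Qed.

End CL2.

Section complex_parts_integration.
Context {R : realType}.

Lemma trig_poly_integration_by_parts {d : nat} (j : 'I_d)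
    (mu : {finite_measure set 'rV[R]_d -> \bar R}) (rho : 'I_d -> 'rV[R]_d -> R)
    (g g' : 'rV[R]_d -> R) (h : 'rV[R]_d -> R[i]) :
  (forall i, measure_partial mu i (rho i)) -> distribution_partial j g g' ->
  mu.-integrable setT (EFin \o g) -> mu.-integrable setT (EFin \o g') ->
  mu.-integrable setT (EFin \o (fun x => g x * rho j x)) -> trig_poly h ->
  Cintegral mu (fun x => cpartial j h x * (g x)%:C) +
  Cintegral mu (fun x => h x * (g' x)%:C) =
  - Cintegral mu (fun x => h x * (g x * rho j x)%:C).
Proof.
(* The lines of the previous sections need a coordinate to split off; in dimension 0 there is no
   direction [j]. *)
case: d => [|n] in j mu rho g g' h *; first by case: j.
move=> mu_rho gg' ig ig' igrho th.
have [[mr mi] [C hC]] := trig_poly_bounded th.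
have [_ [C' h'C]] := trig_poly_bounded (trig_poly_cpartial j th).
have sr k : class_C k (fun x => complex.Re (h x)) by have [] := trig_poly_class_C k th.
have si k : class_C k (fun x => complex.Im (h x)) by have [] := trig_poly_class_C k th.
(* The real lemma asks for one constant bounding both the function and its partial derivative. *)
have le1 x : x <= C -> x <= Num.max C C' by rewrite le_max => ->.
have le2 x : x <= C' -> x <= Num.max C C' by rewrite le_max orbC => ->.
have hr := measure_integration_by_parts mu_rho gg' ig ig' igrho sr mr
  (fun x => le1 _ (hC x).1) (fun x => le2 _ (h'C x).1).
have hi := measure_integration_by_parts mu_rho gg' ig ig' igrho si mi
  (fun x => le1 _ (hC x).2) (fun x => le2 _ (h'C x).2).
have Er (f : 'rV[R]_n.+1 -> R[i]) (v : 'rV[R]_n.+1 -> R) :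
    complex.Re (Cintegral mu (fun x => f x * (v x)%:C)) =
    \int[mu]_x (complex.Re (f x) * v x).
  by apply: eq_Rintegral => x _; rewrite cReM /= mulr0 subr0.
have Ei (f : 'rV[R]_n.+1 -> R[i]) (v : 'rV[R]_n.+1 -> R) :
    complex.Im (Cintegral mu (fun x => f x * (v x)%:C)) =
    \int[mu]_x (complex.Im (f x) * v x).
  by apply: eq_Rintegral => x _; rewrite cImM /= mulr0 add0r.
by apply: complex_eqP; rewrite ?(cReD, cReN, cImD, cImN) ?Er ?Ei.
Qed.

End complex_parts_integration.

(** * The second order operator, its form and the drift *)

Section operators.
Context {R : realType} {d : nat}.
Variable gamma : 'rV[R]_d -> 'M[R]_d.
Implicit Types phi chi : 'rV[R]_d -> R[i].

Definition second_order phi x : R[i] :=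
  2%:R^-1 * \sum_i \sum_j (gamma x i j)%:C * cpartial i (cpartial j phi) x.

Definition gamma_form phi chi x : R[i] :=
  \sum_i \sum_j (gamma x i j)%:C * cpartial i phi x * cpartial j chi x.

(** The Leibniz rule of a second order operator. The cross terms are the form and its transpose,
    which merge where [gamma] is symmetric or when [phi = chi]. *)
Lemma second_orderM phi chi x : trig_poly phi -> trig_poly chi ->
  second_order (fun y => phi y * chi y) x =
  phi x * second_order chi x + chi x * second_order phi x +
  2%:R^-1 * (gamma_form phi chi x + gamma_form chi phi x).
Proof.
move=> tphi tchi; rewrite /second_order /gamma_form.
have factor (a s p s1 q s2 r : R[i]) : s = p * s1 + q * s2 + r ->
    a * s = p * (a * s1) + q * (a * s2) + a * r by move=> ->; ring.
apply: factor; rewrite !mulr_sumr -!big_split/=; apply: eq_bigr => i _.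
rewrite !mulr_sumr -!big_split/=; apply: eq_bigr => j _.
have tphij := trig_poly_cpartial j tphi; have tchij := trig_poly_cpartial j tchi.
rewrite (cpartialM j tphi tchi).
rewrite (cpartialD i (trig_polyM tphi tchij) (trig_polyM tchi tphij)).
rewrite (cpartialM i tphi tchij) (cpartialM i tchi tphij).
move: (cpartial i (cpartial j chi) x) (cpartial i (cpartial j phi) x) => chiij phiij.
move: (cpartial i phi x) (cpartial j phi x) (cpartial i chi x) (cpartial j chi x).
by move: (phi x) (chi x) (gamma x i j)%:C => p q g *; ring.
Qed.

Lemma gamma_form_sym phi chi x : (gamma x)^T = gamma x ->
  gamma_form chi phi x = gamma_form phi chi x.
Proof.
move=> gs; rewrite /gamma_form exchange_big/=; apply: eq_bigr => i _.
apply: eq_bigr => j _; rewrite -[in LHS]gs mxE; ring.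
Qed.

(** Two derivatives of an exponential of frequency [u] multiply it by [- u_i u_j], so the operator
    has the symbol [- 1/2 u gamma u^T]; this is the shape in which [xi_squared] delivers its
    limit. *)
Lemma second_order_trig (m : nat) (c : 'I_m -> R[i]) (u : 'I_m -> 'rV[R]_d) x :
  second_order (fun x => \sum_k c k * expi (dotv (u k) x)) x =
  \sum_k (c k * - 2^-1) *
    (expi (dotv (u k) x) * ((u k *m gamma x *m (u k)^T) ord0 ord0)%:C).
Proof.
rewrite /second_order.
under eq_bigr do under eq_bigr do rewrite !cpartial_trig mulr_sumr.
under eq_bigr do rewrite exchange_big/=.
rewrite exchange_big/= mulr_sumr; apply: eq_bigr => k _.
have -> : ((u k *m gamma x *m (u k)^T) ord0 ord0)%:C =
    \sum_i \sum_j (u k ord0 i)%:C * (gamma x i j)%:C * (u k ord0 j)%:C :> R[i].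
  rewrite mxE rmorph_sum/= exchange_big/=; apply: eq_bigr => j _.
  rewrite !mxE rmorphM rmorph_sum/= mulr_suml; apply: eq_bigr => i _.
  by rewrite rmorphM.
rewrite !mulr_sumr; apply: eq_bigr => i _; rewrite !mulr_sumr; apply: eq_bigr => j _.
have E (a : R) : (0 +i* a : R[i]) = (0 +i* 1) * a%:C.
  by apply: complex_eqP; rewrite ?cReM ?cImM/=; ring.
have I2 : ((0 : R) +i* 1) * (0 +i* 1) = -1.
  by apply: complex_eqP; rewrite ?cReM ?cImM/= ?cReN ?cImN/=; ring.
rewrite (E (u k ord0 i)) (E (u k ord0 j)); transitivity (2^-1 * (((0 : R) +i* 1) * (0 +i* 1)) * (c k * expi (dotv (u k) x) *
  ((u k ord0 i)%:C * (gamma x i j)%:C * (u k ord0 j)%:C))); first by ring.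
by rewrite I2; ring.
Qed.

Variable mu : {finite_measure set 'rV[R]_d -> \bar R}.
Hypothesis gamma_L2 : forall i j, (fun x => gamma x i j) \in Lfun mu 2%:E.

Lemma CL2_mul_trig (v : 'rV[R]_d -> R) phi : v \in Lfun mu 2%:E -> trig_poly phi ->
  CL2 mu (fun x => (v x)%:C * phi x).
Proof.
move=> v2 tphi; under eq_fun do rewrite mulrC.
by apply: CL2_bounded_mul; [exact: trig_poly_bounded|exact: CL2_real].
Qed.

Lemma CL2_second_order phi : trig_poly phi -> CL2 mu (second_order phi).
Proof.
move=> tphi; apply: CL2Z; apply: CL2_sum => i; apply: CL2_sum => j.
by apply: CL2_mul_trig => //; do 2 apply: trig_poly_cpartial.
Qed.

Lemma CL2_quadratic (u : 'rV[R]_d) :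
  CL2 mu (fun x => ((u *m gamma x *m u^T) ord0 ord0)%:C).
Proof.
apply: CL2_real; under eq_fun do rewrite mxE; apply: Lfun2_sum => j.
rewrite (_ : (fun x => _) = (fun x => \sum_i (u ord0 i * u ord0 j) * gamma x i j)).
  apply: Lfun2_sum => i.
  apply: (@ae_bounded_mul_Lfun2 _ _ _ _ (fun=> u ord0 i * u ord0 j) _ `|u ord0 i * u ord0 j|) => //.
  by apply: aeW => x.
apply/funext => x; rewrite !mxE mulr_suml; apply: eq_bigr => i _; ring.
Qed.

Lemma CL2_gamma_form phi chi : trig_poly phi -> trig_poly chi ->
  CL2 mu (gamma_form phi chi).
Proof.
move=> tphi tchi; apply: CL2_sum => i; apply: CL2_sum => j.
under eq_fun do rewrite -mulrA; apply: CL2_mul_trig => //.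
by apply: trig_polyM; exact: trig_poly_cpartial.
Qed.

Variables (dgamma : 'I_d -> 'I_d -> 'rV[R]_d -> R) (rho : 'I_d -> 'rV[R]_d -> R).
Hypothesis dgamma_L2 : forall i j, dgamma i j \in Lfun mu 2%:E.
Hypothesis gamma_rho_L2 : forall i j,
  (fun x => gamma x i j * rho j x) \in Lfun mu 2%:E.
Hypothesis dgamma_partial : forall i j,
  distribution_partial j (fun x => gamma x i j) (dgamma i j).
Hypothesis mu_rho : forall i, measure_partial mu i (rho i).

(** The first order part that makes [second_order + drift] an operator in divergence form for the
    law: with a smooth positive density [f] and [rho j = (d_j f) / f], the sum is [1 / (2 f)] times
    the sum of the [d_j (f gamma_ij d_i phi)]. *)
Definition drift phi x : R[i] :=
  2%:R^-1 * \sum_i (\sum_j (dgamma i j x + gamma x i j * rho j x))%:C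
    * cpartial i phi x.

Lemma CL2_drift phi : trig_poly phi -> CL2 mu (drift phi).
Proof.
move=> tphi; apply: CL2Z; apply: CL2_sum => i.
apply: CL2_mul_trig; last exact: trig_poly_cpartial.
by apply: Lfun2_sum => j; exact: Lfun2D.
Qed.

(* Integration by parts of [gamma i j] against [chi * cpartial i phi]. *)
Lemma Cintegral_gamma_form phi chi : trig_poly phi -> trig_poly chi ->
  Cintegral mu (gamma_form phi chi) =
  - 2%:R * Cintegral mu (fun x => (second_order phi x + drift phi x) * chi x).
Proof.
move=> tphi tchi.
have tp i := trig_poly_cpartial i tphi.
have th i : trig_poly (fun x => chi x * cpartial i phi x) by exact: trig_polyM.
have ibp i j := trig_poly_integration_by_parts mu_rho (dgamma_partial i j)
  (Lfun2_integrable (gamma_L2 i j)) (Lfun2_integrable (dgamma_L2 i j))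
  (Lfun2_integrable (gamma_rho_L2 i j)) (th i).
pose A i j x := (gamma x i j)%:C * cpartial i (cpartial j phi) x * chi x.
pose B i j x := (chi x * cpartial i phi x) * (dgamma i j x)%:C.
pose D i j x := (chi x * cpartial i phi x) * (gamma x i j * rho j x)%:C.
pose G i j x := (gamma x i j)%:C * cpartial i phi x * cpartial j chi x.
have c2 (v : 'rV[R]_d -> R) f : v \in Lfun mu 2%:E -> trig_poly f ->
    Cintegrable mu (fun x => f x * (v x)%:C).
  move=> v2 tf; apply: CL2_Cintegrable; apply: CL2_bounded_mul.
    exact: trig_poly_bounded.
  exact: CL2_real.
have iA i j : Cintegrable mu (A i j).
  have := c2 _ _ (gamma_L2 i j) (trig_polyM (trig_poly_cpartial i (tp j)) tchi).
  by congr Cintegrable; apply/funext => x; rewrite /A; ring.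
have iB i j : Cintegrable mu (B i j) by exact: c2.
have iD i j : Cintegrable mu (D i j) by exact: c2.
have iG i j : Cintegrable mu (G i j).
  have := c2 _ _ (gamma_L2 i j) (trig_polyM (tp i) (trig_poly_cpartial j tchi)).
  by congr Cintegrable; apply/funext => x; rewrite /G; ring.
(* The derivative of [chi * cpartial i phi] splits into the integrands of [A] and [G], so the
   integration by parts reads [A + G + B = - D] after integration. *)
have E i j : Cintegral mu (G i j) =
    - (Cintegral mu (A i j) + Cintegral mu (B i j) + Cintegral mu (D i j)).
  have := ibp i j.
  rewrite (_ : Cintegral mu (fun x => cpartial j _ x * _) =
      Cintegral mu (A i j) + Cintegral mu (G i j)); last first.
    rewrite -CintegralD//; congr Cintegral; apply/funext => x.
    by rewrite cpartialM// /A /G (cpartialC i j tphi); ring.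
  rewrite -/(B i j) -/(D i j) => ibpij.
  have -> : Cintegral mu (G i j) = Cintegral mu (A i j) + Cintegral mu (G i j) +
    Cintegral mu (B i j) - Cintegral mu (A i j) - Cintegral mu (B i j) by ring.
  by rewrite ibpij; ring.
have -> : Cintegral mu (gamma_form phi chi) = \sum_i \sum_j Cintegral mu (G i j).
  rewrite -[gamma_form phi chi]/(fun x => \sum_i \sum_j G i j x).
  rewrite Cintegral_sum; last by move=> i; exact: (Cintegrable_sum _ (iG i)).
  by apply: eq_bigr => i _; rewrite (Cintegral_sum _ (iG i)).
have -> : (fun x => (second_order phi x + drift phi x) * chi x) =
    (fun x => 2%:R^-1 * \sum_i \sum_j (A i j x + B i j x + D i j x)).
  apply/funext => x; rewrite /second_order /drift -mulrDr -mulrA; congr (_ * _).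
  rewrite -big_split/= mulr_suml; apply: eq_bigr => i _.
  rewrite mulrDl mulr_suml rmorph_sum/= !mulr_suml -big_split/=.
  by apply: eq_bigr => j _; rewrite /A /B /D rmorphD/=; ring.
have iS i j : Cintegrable mu (fun x => A i j x + B i j x + D i j x).
  exact: (CintegrableD (CintegrableD (iA i j) (iB i j)) (iD i j)).
have iSi i : Cintegrable mu (fun x => \sum_j (A i j x + B i j x + D i j x)).
  exact: (Cintegrable_sum _ (iS i)).
rewrite CintegralZ; last exact: (Cintegrable_sum _ iSi).
rewrite mulrA mulNr mulfV ?pnatr_eq0// mulN1r.
rewrite (Cintegral_sum _ iSi) -sumrN; apply: eq_bigr => i _.
rewrite (Cintegral_sum _ (iS i)) -sumrN.
apply: eq_bigr => j _; rewrite E; congr (- _).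
by rewrite (CintegralD (CintegrableD (iA i j) (iB i j)) (iD i j)) (CintegralD (iA i j) (iB i j)).
Qed.

End operators.

Lemma half_double {R : realType} (x : R[i]) : 2%:R^-1 * (x + x) = x.
Proof. by rewrite -mulr2n -[x *+ 2]mulr_natl mulKf// pnatr_eq0. Qed.

(** * The four operators *)

Section bias.
Context {R : realType} (dO : measure_display) (Omega : measurableType dO).
Variables (P : probability Omega R) (d : nat) (Y : {RV P >-> 'rV[R]_d}).
Variables (xi : nat -> 'rV[R]_d -> 'rV[R]_d) (alpha : nat -> R).
Hypothesis xi_meas : forall n, measurable_fun setT (xi n).
Hypothesis alpha_gt0 : forall n, 0 < alpha n.
Variable gamma : 'rV[R]_d -> 'M[R]_d.
Hypothesis xi_cubed :
  (fun n => ((alpha n)%:E *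
     'E_P[(fun w => euclidean_norm (xi n (Y w)) ^+ 3)%R])%E) @ \oo --> 0%E.
Local Notation PY := (distribution P Y).
Hypothesis gamma_L2 : forall i j, (fun x => gamma x i j) \in Lfun PY 2%:E.
Hypothesis xi_squared : forall phi, trig_poly phi -> forall u : 'rV[R]_d,
  Ccvg
    (fun n => (alpha n)%:C * Cintegral P (fun w =>
       phi (Y w) * (dotv u (xi n (Y w)) ^+ 2)%:C))
    (Cintegral PY (fun x => phi x * ((u *m gamma x *m u^T) ord0 ord0)%:C)).
Hypothesis xi_mean : forall phi, trig_poly phi -> forall u : 'rV[R]_d,
  Ccvg
    (fun n => (alpha n)%:C * Cintegral P (fun w =>
       phi (Y w) * (dotv u (xi n (Y w)))%:C)) 0.
Implicit Types phi chi : 'rV[R]_d -> R[i].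

Let Yn n w := Y w + xi n (Y w).

Let mY : measurable_fun setT (Y : Omega -> 'rV[R]_d).
Proof. exact: measurable_funPT. Qed.

Let mYn n : measurable_fun setT (Yn n).
Proof.
apply/measurable_fun_rVP => i; rewrite /Yn; under eq_fun do rewrite mxE.
apply: measurable_funD; first exact: (measurableT_comp (@measurable_rV_coord _ R d i) mY).
exact: (measurableT_comp (@measurable_rV_coord _ R d i) (measurableT_comp (xi_meas n) mY)).
Qed.

Let K phi chi n w := (phi (Yn n w) - phi (Y w)) * chi (Y w).

Let bK phi chi n : trig_poly phi -> trig_poly chi -> Cbounded (K phi chi n).
Proof.
move=> /trig_poly_bounded tphi /trig_poly_bounded tchi; apply: CboundedM.
  by apply: CboundedB; [exact: (Cbounded_comp (mYn n) tphi)|exact: (Cbounded_comp mY tphi)].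
exact: (Cbounded_comp mY tchi).
Qed.

Let iK phi chi n : trig_poly phi -> trig_poly chi -> Cintegrable P (K phi chi n).
Proof. by move=> tphi tchi; apply: Cbounded_integrable; exact: bK. Qed.

Lemma theoretical_cvg phi chi : trig_poly phi -> trig_poly chi ->
  Ccvg (fun n => (alpha n)%:C * Cintegral P (K phi chi n))
       (Cintegral PY (fun x => second_order gamma phi x * chi x)).
Proof.
move=> [m [c [u ->]]] [m' [c' [v ->]]].
pose q k l x : R[i] := expi (dotv (u k + v l) x) * ((u k *m gamma x *m (u k)^T) ord0 ord0)%:C.
(* By bilinearity only exponentials remain. The increment of frequency [u k] factors as the
   exponential at [Y] times the exponential of [xi n] minus 1, and the former absorbs the test
   exponential [v l]. *)
pose I k l n w : R[i] := expi (dotv (u k + v l) (Y w)) * (expi (dotv (u k) (xi n (Y w))) - 1).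
have iq k l : Cintegrable PY (q k l).
  apply: CL2_Cintegrable; apply: CL2_bounded_mul; first exact: Cbounded_expi.
  exact: CL2_quadratic.
have iI k l n : Cintegrable P (I k l n).
  by apply: Cbounded_integrable; exact: expi_increment_Cbounded.
have -> : Cintegral PY (fun x => second_order gamma (fun x => \sum_k c k * expi (dotv (u k) x)) x *
    \sum_l c' l * expi (dotv (v l) x)) =
    \sum_k \sum_l (c k * c' l) * (- 2^-1 * Cintegral PY (q k l)).
  rewrite (_ : (fun x => _ * _) = (fun x => \sum_k \sum_l (c k * c' l * - 2^-1) * q k l x)).
    rewrite Cintegral_sum => [|k]; last by apply: Cintegrable_sum => l; exact: CintegrableZ.
    apply: eq_bigr => k _; rewrite Cintegral_sum => [|l]; last exact: CintegrableZ.
    by apply: eq_bigr => l _; rewrite CintegralZ// mulrA.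
  apply/funext => x; rewrite second_order_trig big_distrlr/=.
  apply: eq_bigr => k _; apply: eq_bigr => l _.
  rewrite /q dotvDl expiD; ring.
have -> : (fun n => (alpha n)%:C * Cintegral P (K (fun x => \sum_k c k * expi (dotv (u k) x))
    (fun x => \sum_l c' l * expi (dotv (v l) x)) n)) =
    (fun n => \sum_k \sum_l (c k * c' l) * ((alpha n)%:C * Cintegral P (I k l n))).
  apply/funext => n.
  rewrite (_ : K _ _ n = (fun w => \sum_k \sum_l (c k * c' l) * I k l n w)).
    rewrite Cintegral_sum => [|k]; last by apply: Cintegrable_sum => l; exact: CintegrableZ.
    rewrite mulr_sumr; apply: eq_bigr => k _.
    rewrite Cintegral_sum => [|l]; last exact: CintegrableZ.
    by rewrite mulr_sumr; apply: eq_bigr => l _; rewrite CintegralZ// mulrCA.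
  apply/funext => w; rewrite /K /Yn -sumrB big_distrlr/=.
  apply: eq_bigr => k _; apply: eq_bigr => l _.
  rewrite /I dotvDl dotvDr !expiD; ring.
apply: Ccvg_sum => k; apply: Ccvg_sum => l; apply: CcvgZ.
apply: (expi_increment_cvg xi_meas alpha_gt0 xi_cubed).
  exact: (xi_mean (trig_poly_expi (u k + v l))).
exact: (xi_squared (trig_poly_expi (u k + v l))).
Qed.

Lemma theoretical_bias_second_order :
  theoretical_bias_operator Y Yn alpha (second_order gamma).
Proof.
move=> phi tphi; split; first exact: CL2_second_order.
by move=> chi tchi; rewrite mul1r; exact: theoretical_cvg.
Qed.

Hypothesis gamma_sym : {ae PY, forall x, (gamma x)^T = gamma x}.

Let S phi chi n w := (phi (Yn n w) - phi (Y w)) * (chi (Yn n w) - chi (Y w)).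

Let S_def phi chi n : S phi chi n = fun w =>
  K (fun x => phi x * chi x) (fun=> 1) n w + (-1) * K phi chi n w + (-1) * K chi phi n w.
Proof. by apply/funext => w; rewrite /S /K; ring. Qed.

Let bS phi chi n : trig_poly phi -> trig_poly chi -> Cintegrable P (S phi chi n).
Proof.
move=> tphi tchi; rewrite S_def.
apply: CintegrableD; last by apply: CintegrableZ; exact: iK.
apply: CintegrableD; last by apply: CintegrableZ; exact: iK.
by apply: iK; [exact: trig_polyM|exact: trig_poly1].
Qed.

Lemma symmetric_cvg phi chi : trig_poly phi -> trig_poly chi ->
  Ccvg (fun n => (alpha n)%:C * Cintegral P (S phi chi n))
       (Cintegral PY (gamma_form gamma phi chi)).
Proof.
move=> tphi tchi; have tpc := trig_polyM tphi tchi.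
have t1 := @trig_poly1 R d.
have iso f g : trig_poly f -> trig_poly g ->
    Cintegrable PY (fun x => second_order gamma f x * g x).
  move=> tf tg; under eq_fun do rewrite mulrC.
  apply: CL2_Cintegrable; apply: CL2_bounded_mul; first exact: trig_poly_bounded.
  exact: CL2_second_order.
have -> : (fun n => (alpha n)%:C * Cintegral P (S phi chi n)) = (fun n =>
    (alpha n)%:C * Cintegral P (K (fun x => phi x * chi x) (fun=> 1) n) +
    (-1) * ((alpha n)%:C * Cintegral P (K phi chi n)) +
    (-1) * ((alpha n)%:C * Cintegral P (K chi phi n))).
  apply/funext => n; rewrite S_def.
  have i1 := iK n tpc t1; have i2 := iK n tphi tchi; have i3 := iK n tchi tphi.
  rewrite CintegralD; [|by apply: CintegrableD => //; exact: CintegrableZ|exact: CintegrableZ].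
  rewrite CintegralD//; last exact: CintegrableZ.
  rewrite !CintegralZ//; ring.
have -> : Cintegral PY (gamma_form gamma phi chi) =
    Cintegral PY (fun x => second_order gamma (fun x => phi x * chi x) x * 1) +
    (-1) * Cintegral PY (fun x => second_order gamma phi x * chi x) +
    (-1) * Cintegral PY (fun x => second_order gamma chi x * phi x).
  have i1 := iso _ _ tpc t1; have i2 := iso _ _ tphi tchi; have i3 := iso _ _ tchi tphi.
  rewrite -!CintegralZ// -CintegralD//; last exact: CintegrableZ.
  rewrite -CintegralD; [|by apply: CintegrableD => //; exact: CintegrableZ|exact: CintegrableZ].
  apply: ae_eq_Cintegral.
  - by apply: CL2_Cintegrable; exact: CL2_gamma_form.
  - apply: CintegrableD; last exact: CintegrableZ.
    by apply: CintegrableD => //; exact: CintegrableZ.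
  (* Symmetry of [gamma], known almost everywhere, merges the two cross terms of the Leibniz rule
     into one form. *)
  apply: filterS gamma_sym => x gs.
  rewrite (second_orderM gamma x tphi tchi) (gamma_form_sym phi chi gs).
  move: (gamma_form gamma phi chi x) (second_order gamma phi x) (second_order gamma chi x).
  by move: (phi x) (chi x) => p q g s s'; rewrite half_double; ring.
apply: CcvgD; first (apply: CcvgD; first exact: theoretical_cvg).
  by apply: CcvgZ; exact: theoretical_cvg.
by apply: CcvgZ; exact: theoretical_cvg.
Qed.

Variables (dgamma : 'I_d -> 'I_d -> 'rV[R]_d -> R) (rho : 'I_d -> 'rV[R]_d -> R).
Hypothesis dgamma_L2 : forall i j, dgamma i j \in Lfun PY 2%:E.
Hypothesis gamma_rho_L2 : forall i j,
  (fun x => gamma x i j * rho j x) \in Lfun PY 2%:E.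
Hypothesis dgamma_partial : forall i j,
  distribution_partial j (fun x => gamma x i j) (dgamma i j).
Hypothesis PY_rho : forall i, measure_partial PY i (rho i).

Let b := drift gamma dgamma rho.
Let A phi x := second_order gamma phi x + b phi x.

Let CL2_A phi : trig_poly phi -> CL2 PY (A phi).
Proof.
by move=> tphi; apply: CL2D; [exact: CL2_second_order|exact: CL2_drift].
Qed.

Let iA phi chi : trig_poly phi -> trig_poly chi ->
  Cintegrable PY (fun x => A phi x * chi x).
Proof.
move=> tphi tchi; under eq_fun do rewrite mulrC.
apply: CL2_Cintegrable; apply: CL2_bounded_mul; last exact: CL2_A.
exact: trig_poly_bounded.
Qed.

Let iso phi chi : trig_poly phi -> trig_poly chi ->
  Cintegrable PY (fun x => second_order gamma phi x * chi x).
Proof.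
move=> tphi tchi; under eq_fun do rewrite mulrC.
apply: CL2_Cintegrable; apply: CL2_bounded_mul; last exact: CL2_second_order.
exact: trig_poly_bounded.
Qed.

Let sym_cvg phi chi : trig_poly phi -> trig_poly chi ->
  Ccvg (fun n => (alpha n)%:C * Cintegral P (S phi chi n))
       (- 2%:R * Cintegral PY (fun x => A phi x * chi x)).
Proof.
move=> tphi tchi.
rewrite -(Cintegral_gamma_form gamma_L2 dgamma_L2 gamma_rho_L2 dgamma_partial PY_rho tphi tchi).
exact: symmetric_cvg.
Qed.

Lemma symmetric_bias : symmetric_bias_operator Y Yn alpha A.
Proof.
by move=> phi tphi; split; [exact: CL2_A|move=> chi tchi; exact: sym_cvg].
Qed.

(** The practical increment is [- S - K], so the operator is twice the symmetric one minus the
    theoretical one. *)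
Lemma practical_bias : practical_bias_operator Y Yn alpha
  (fun phi x => second_order gamma phi x + 2%:R * b phi x).
Proof.
move=> phi tphi; split.
  by apply: CL2D; [exact: CL2_second_order|apply: CL2Z; exact: CL2_drift].
move=> chi tchi; rewrite mul1r.
have -> : (fun x => (second_order gamma phi x + 2%:R * b phi x) * chi x) =
    (fun x => 2%:R * (A phi x * chi x) + (-1) * (second_order gamma phi x * chi x)).
  by apply/funext => x; rewrite /A; ring.
have i1 := iA tphi tchi; have i2 := iso tphi tchi.
rewrite CintegralD; [|exact: CintegrableZ|exact: CintegrableZ].
rewrite !CintegralZ//.
have := CcvgD (CcvgZ (c := -1) (sym_cvg tphi tchi))
  (CcvgZ (c := -1) (theoretical_cvg tphi tchi)).
rewrite mulrA mulrN mulN1r opprK; apply: Ccvg_near; apply: nearW => n.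
have -> : (fun w => (phi (Y w) - phi (Yn n w)) * chi (Yn n w)) =
    (fun w => (-1) * S phi chi n w + (-1) * K phi chi n w).
  by apply/funext => w; rewrite /S /K; ring.
have i3 := bS n tphi tchi; have i4 := iK n tphi tchi.
rewrite CintegralD; [|exact: CintegrableZ|exact: CintegrableZ].
rewrite !CintegralZ//; ring.
Qed.

(** The integrand is [S + 2 K], so the operator is the theoretical one minus the symmetric one: the
    second order parts cancel, which leaves a first order operator. *)
Lemma singular_bias : singular_bias_operator Y Yn alpha (fun phi x => - b phi x).
Proof.
move=> phi tphi; split.
  by under eq_fun do rewrite -mulN1r; apply: CL2Z; exact: CL2_drift.
move=> chi tchi.
have -> : (fun x => - b phi x * chi x) =
    (fun x => (-1) * (A phi x * chi x) + second_order gamma phi x * chi x).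
  by apply/funext => x; rewrite /A; ring.
have i1 := iA tphi tchi; have i2 := iso tphi tchi.
rewrite CintegralD//; last exact: CintegrableZ.
rewrite CintegralZ// mulrDr mulrA mulrN1.
have := CcvgD (sym_cvg tphi tchi) (CcvgZ (c := 2%:R) (theoretical_cvg tphi tchi)).
apply: Ccvg_near; apply: nearW => n.
have -> : (fun w => (phi (Yn n w) - phi (Y w)) * (chi (Yn n w) + chi (Y w))) =
    (fun w => S phi chi n w + 2%:R * K phi chi n w).
  by apply/funext => w; rewrite /S /K; ring.
have i3 := bS n tphi tchi; have i4 := iK n tphi tchi.
rewrite CintegralD//; last exact: CintegrableZ.
rewrite !CintegralZ//; ring.
Qed.

(** The drift is a derivation, so it drops out of the square field; the second order part leaves
    exactly the cross terms of its Leibniz rule. *)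
Lemma square_field_gamma phi x : trig_poly phi ->
  square_field A phi x = gamma_form gamma phi phi x.
Proof.
move=> tphi; rewrite /square_field /A.
have -> : (fun y => phi y ^+ 2) = (fun y => phi y * phi y) by [].
have -> : b (fun y => phi y * phi y) x = 2%:R * phi x * b phi x.
  rewrite /b /drift mulrCA; congr (_ * _); rewrite mulr_sumr.
  apply: eq_bigr => i _; rewrite (cpartialM i tphi tphi).
  by move: (cpartial i phi x) (phi x) => p q; ring.
rewrite (second_orderM gamma x tphi tphi) half_double.
move: (gamma_form gamma phi phi x) (second_order gamma phi x) (b phi x).
by move: (phi x) => p g s t; ring.
Qed.

End bias.

Theorem theorem6
  (R : realType) (dO : measure_display) (Omega : measurableType dO)
  (P : probability Omega R) (d : nat)
  (Y : {RV P >-> 'rV[R]_d})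
  (xi : nat -> 'rV[R]_d -> 'rV[R]_d)
  (xi_meas : forall n, measurable_fun setT (xi n))
  (alpha : nat -> R)
  (alpha_gt0 : forall n, 0 < alpha n)
  (alpha_incr : nondecreasing_seq alpha)
  (alpha_infty : alpha @ \oo --> +oo)
  (gamma : 'rV[R]_d -> 'M[R]_d)
  (dgamma : 'I_d -> 'I_d -> 'rV[R]_d -> R)
  (xi_cubed :
    (fun n => ((alpha n)%:E *
       'E_P[(fun w => euclidean_norm (xi n (Y w)) ^+ 3)%R])%E) @ \oo --> 0%E)
  (gamma_sym : {ae distribution P Y, forall x, (gamma x)^T = gamma x})
  (gamma_Linfty : forall i j,
    (fun x => gamma x i j) \in Lfun (distribution P Y) +oo%E)
  (dgamma_partial : forall i j,
    distribution_partial j (fun x => gamma x i j) (dgamma i j))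
  (dgamma_L2 : forall i j, dgamma i j \in Lfun (distribution P Y) 2%:E)
  (xi_squared : forall phi, trig_poly phi -> forall u : 'rV[R]_d,
    Ccvg
      (fun n => (alpha n)%:C * Cintegral P (fun w =>
         phi (Y w) * (dotv u (xi n (Y w)) ^+ 2)%:C))
      (Cintegral (distribution P Y) (fun x =>
         phi x * ((u *m gamma x *m u^T) ord0 ord0)%:C)))
  (xi_mean : forall phi, trig_poly phi -> forall u : 'rV[R]_d,
    Ccvg
      (fun n => (alpha n)%:C * Cintegral P (fun w =>
         phi (Y w) * (dotv u (xi n (Y w)))%:C)) 0) :
  let PY := distribution P Y in
  let Yn := fun n w => Y w + xi n (Y w) in
  (* a) *)
  (exists Abar : ('rV[R]_d -> R[i]) -> ('rV[R]_d -> R[i]),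
    theoretical_bias_operator Y Yn alpha Abar /\
    forall phi, trig_poly phi ->
      {ae PY, forall x, Abar phi x =
        2%:R^-1 * \sum_i \sum_j
          (gamma x i j)%:C * cpartial i (cpartial j phi) x}) /\
  (* b) *)
  (forall rho : 'I_d -> 'rV[R]_d -> R,
    (forall i, rho i \in Lfun PY 2%:E) ->
    (forall i, measure_partial PY i (rho i)) ->
    exists Abar Aund Atilde As : ('rV[R]_d -> R[i]) -> ('rV[R]_d -> R[i]),
      [/\ theoretical_bias_operator Y Yn alpha Abar,
          practical_bias_operator Y Yn alpha Aund,
          symmetric_bias_operator Y Yn alpha Atilde &
          singular_bias_operator Y Yn alpha As] /\
      forall phi, trig_poly phi ->
        {ae PY, forall x, Atilde phi x =
          2%:R^-1 * \sum_i \sum_j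
            (gamma x i j)%:C * cpartial i (cpartial j phi) x
          + 2%:R^-1 * \sum_i
            (\sum_j (dgamma i j x + gamma x i j * rho j x))%:C
            * cpartial i phi x} /\
        {ae PY, forall x, square_field Atilde phi x =
          \sum_i \sum_j
            (gamma x i j)%:C * cpartial i phi x * cpartial j phi x}).
Proof.
move=> PY Yn.
have PYT : (0 < PY setT)%E by rewrite (_ : PY setT = 1%E)//; exact: probability_setT.
have gamma_bounded i j : exists C : R, {ae PY, forall x, `|gamma x i j| <= C}.
  exact: (Lfuny_ae_bounded PYT (gamma_Linfty i j)).
(* Essential boundedness of [gamma] enters here: with [g = 1] it puts [gamma i j] in the square
   integrable functions, and with [g = rho j] the product occurring in the drift. *)
have gamma_mul_L2 i j (g : 'rV[R]_d -> R) : g \in Lfun PY 2%:E ->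
    (fun x => gamma x i j * g x) \in Lfun PY 2%:E.
  have [C gC] := gamma_bounded i j; apply: ae_bounded_mul_Lfun2 gC.
  exact: Lfun_measurable (gamma_Linfty i j).
have gamma_L2 i j : (fun x => gamma x i j) \in Lfun PY 2%:E.
  by have := gamma_mul_L2 i j _ (Lfun2_1 PY); under eq_fun do rewrite mulr1.
have theo : theoretical_bias_operator Y Yn alpha (second_order gamma).
  exact: (theoretical_bias_second_order xi_meas alpha_gt0 xi_cubed gamma_L2 xi_squared xi_mean).
split; first by exists (second_order gamma); split => // phi _; exact: aeW.
move=> rho rho_L2 PY_rho.
have gamma_rho_L2 i j : (fun x => gamma x i j * rho j x) \in Lfun PY 2%:E.
  exact: gamma_mul_L2.
exists (second_order gamma),
  (fun phi x => second_order gamma phi x + 2%:R * drift gamma dgamma rho phi x),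
  (fun phi x => second_order gamma phi x + drift gamma dgamma rho phi x),
  (fun phi x => - drift gamma dgamma rho phi x).
split; first split.
- exact: theo.
- exact: (practical_bias xi_meas alpha_gt0 xi_cubed gamma_L2 xi_squared xi_mean
    gamma_sym dgamma_L2 gamma_rho_L2 dgamma_partial PY_rho).
- exact: (symmetric_bias xi_meas alpha_gt0 xi_cubed gamma_L2 xi_squared xi_mean
    gamma_sym dgamma_L2 gamma_rho_L2 dgamma_partial PY_rho).
- exact: (singular_bias xi_meas alpha_gt0 xi_cubed gamma_L2 xi_squared xi_mean
    gamma_sym dgamma_L2 gamma_rho_L2 dgamma_partial PY_rho).
move=> phi tphi; split; apply: aeW => x //.
exact: square_field_gamma.
Qed.
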